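(* Let $\mathbb{X}=(X,\alpha\colon TX\to X)$ be a weak $\omega$-category and let $W$ be its set of invertible cells. For a set $A$ of cells of $X$, let $C(A)$ be the set of all cells of the form \[ \mathrm{coh}^{\mathbb{X}}\big(B,\ T(s^B_{d-1})(a)\to T(t^B_{d-1})(b),\ \sigma\big), \] where $B$ is a Batanin tree of dimension $d\ge 1$, $a,b\in (T\,\mathrm{Pos}(\partial_{d-1}B))_{d-1}$ are parallel cells each of which covers $\partial_{d-1}B$, and $\sigma\colon \mathrm{Pos}(B)\to X$ is a morphism of globular sets sending every maximal (i.e. $d$-dimensional) position of $B$ to a cell in $A$. Define $W_0=W$, $W_{\le n}=\bigcup_{k\le n}W_k$, $W_{n+1}=C(W_{\le n})$ and $W_\infty=\bigcup_{n}W_n$. Then every cell of $W_\infty$ is invertible, i.e. $W_\infty\subseteq W$. In particular, every composite of invertible cells is invertible.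
   Context: Globular sets: a globular set $X$ has sets $X_n$ ($n\in\mathbb N$) of $n$-cells and source/target maps $\mathrm{src},\mathrm{tgt}\colon X_{n+1}\to X_n$ with $\mathrm{src}\,\mathrm{src}=\mathrm{src}\,\mathrm{tgt}$, $\mathrm{tgt}\,\mathrm{src}=\mathrm{tgt}\,\mathrm{tgt}$; cells are parallel if they have the same source and target (all $0$-cells are parallel). Batanin trees are generated inductively: for every finite list $B_1,\dots,B_n$ ($n\ge0$) of Batanin trees there is a tree $[B_1,\dots,B_n]$; $\dim[B_1,\dots,B_n]=\max_i(\dim B_i+1)$ (and $\dim[\,]=0$). The suspension $\Sigma Y$ of a globular set has $0$-cells $v_-,v_+$ and $(\Sigma Y)_{n+1}=Y_n$, every $1$-cell going from $v_-$ to $v_+$. The globular set of positions is $\mathrm{Pos}([B_1,\dots,B_n])=\Sigma\mathrm{Pos}(B_1)\vee\cdots\vee\Sigma\mathrm{Pos}(B_n)$, the wedge sum gluing $v_+$ of each summand to $v_-$ of the next (for $n=0$ it is a single $0$-cell); $\mathrm{inc}_i$ denotes the inclusion of the $i$-th summand. Boundary trees: $\partial_0B=[\,]$, $\partial_{k+1}[B_1,\dots,B_n]=[\partial_kB_1,\dots,\partial_kB_n]$. Cosource/cotarget $s^B_k,t^B_k\colon\mathrm{Pos}(\partial_kB)\to\mathrm{Pos}(B)$: $s^B_0$ picks $\mathrm{inc}_1(v_-)$, $t^B_0$ picks $\mathrm{inc}_n(v_+)$, and $s^B_{k+1}=\bigvee_i\Sigma s^{B_i}_k$, $t^B_{k+1}=\bigvee_i\Sigma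 t^{B_i}_k$. $T$ is the free weak $\omega$-category monad on globular sets (Batanin–Leinster), in the computad presentation of Dean et al.: for a globular set $Y$ the $n$-cells of $TY$ are generated by (i) $\mathrm{var}\,y$ for $y\in Y_n$, (ii) $\mathrm{coh}(B,A,f)$ for a Batanin tree $B$ with $\dim B\le n$, a full $(n-1)$-sphere $A$ of $T\mathrm{Pos}(B)$ and a globular map $f\colon\mathrm{Pos}(B)\to TY$; the source and target of $\mathrm{coh}(B,(u,v),f)$ are $u,v$ with $f$ substituted. An $m$-sphere is a pair of parallel $m$-cells (there is a unique $(-1)$-sphere, which is full). The support of a cell is the set of generators occurring in it or its iterated sources and targets; a cell of $T\mathrm{Pos}(P)$ covers $P$ if its support contains every position of $P$. An $m$-sphere $(u,v)$ of $T\mathrm{Pos}(B)$ is full if $u=T(s^B_m)(u')$, $v=T(t^B_m)(v')$ for $m$-cells $u',v'$ of $T\mathrm{Pos}(\partial_mB)$ covering $\partial_mB$. A weak $\omega$-category is a $T$-algebra $(X,\alpha)$. For a globular map $f\colon\mathrm{Pos}(B)\to X$, $\mathrm{coh}^{\mathbb X}(B,A,f)=\alpha(Tf(\mathrm{coh}(B,A,\mathrm{id})))$, where $\mathrm{id}$ sends each position $p$ to $\mathrm{var}\,p$. Every weak $\omega$-category has canonical identity operations $\mathrm{id}\colon X_n\to X_{n+1}$ (with $\mathrm{src}\,\mathrm{id}(x)=\mathrm{tgt}\,\mathrm{id}(x)=x$) and binary compositions $x\ast_n y$ of $(n+1)$-cells with $\mathrm{tgt}\,x=\mathrm{src}\,y$.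 Invertibility is coinductive: the set $W$ of invertible cells is the largest set of positive-dimensional cells such that every $x\colon u\to v$ in $W$, of dimension $n+1$, admits a cell $\bar x\colon v\to u$ and cells $\eta_x\colon x\ast_n\bar x\to\mathrm{id}(u)$ and $\varepsilon_x\colon\bar x\ast_n x\to\mathrm{id}(v)$ lying in $W$. *)

(* Defs.v *)
From Stdlib Require Import List Arith Lia.
Import ListNotations.

Inductive tree : Type := node : list tree -> tree.

Definition children (B : tree) : list tree := match B with node l => l end.

Fixpoint tdim (B : tree) : nat :=
  match B with
  | node l =>
      (fix go (l : list tree) : nat :=
         match l with
         | [] => 0
         | B' :: l' => Nat.max (S (tdim B')) (go l')
         end) l
  end.

Fixpoint bdry (k : nat) (B : tree) : tree :=
  match k with
  | 0 => node []
  | S k' => node (map (bdry k') (children B))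
  end.

(* Positions.  Pos([B_0..B_{n-1}]) = Sigma Pos(B_0) v ... v Sigma Pos(B_{n-1}):
   its 0-cells are the vertices pv 0 .. pv n (summand i goes from pv i to
   pv (i+1)), and its (k+1)-cells in summand i are  pin i p  for p a k-cell
   of Pos(B_i). *)
Inductive pos : Type := pv (j : nat) | pin (i : nat) (p : pos).

Fixpoint pvalid (B : tree) (p : pos) : bool :=
  match p with
  | pv j => j <=? length (children B)
  | pin i q => (i <? length (children B)) && pvalid (nth i (children B) (node [])) q
  end.

Fixpoint pdim (p : pos) : nat :=
  match p with pv _ => 0 | pin _ q => S (pdim q) end.

(* source / target (junk on 0-cells) *)
Fixpoint psrc (p : pos) : pos :=
  match p with
  | pv j => pv j
  | pin i q => match q with pv _ => pv i | _ => pin i (psrc q) end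
  end.
Fixpoint ptgt (p : pos) : pos :=
  match p with
  | pv j => pv j
  | pin i q => match q with pv _ => pv (S i) | _ => pin i (ptgt q) end
  end.

Lemma psrc_valid B p : pvalid B p = true -> pvalid B (psrc p) = true.
Proof.
  revert B; induction p as [j|i q IH]; intros B H; simpl in *; auto.
  apply andb_prop in H as [H1 H2].
  destruct q as [j|i' q'].
  - simpl. apply Nat.leb_le. apply Nat.ltb_lt in H1. lia.
  - change (pvalid B (pin i (psrc (pin i' q'))) = true). simpl.
    rewrite H1. simpl. apply IH. exact H2.
Qed.

Lemma ptgt_valid B p : pvalid B p = true -> pvalid B (ptgt p) = true.
Proof.
  revert B; induction p as [j|i q IH]; intros B H; simpl in *; auto.
  apply andb_prop in H as [H1 H2].
  destruct q as [j|i' q'].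
  - change ((S i <=? length (children B)) = true). apply Nat.leb_le. apply Nat.ltb_lt in H1. lia.
  - change (pvalid B (pin i (ptgt (pin i' q'))) = true). simpl.
    rewrite H1. simpl. apply IH. exact H2.
Qed.

Definition PosT (B : tree) : Type := {p : pos | pvalid B p = true}.

Definition psrcT (B : tree) (p : PosT B) : PosT B :=
  exist _ (psrc (proj1_sig p)) (psrc_valid B _ (proj2_sig p)).
Definition ptgtT (B : tree) (p : PosT B) : PosT B :=
  exist _ (ptgt (proj1_sig p)) (ptgt_valid B _ (proj2_sig p)).

Fixpoint cos (k : nat) (B : tree) (p : pos) : pos :=
  match k with
  | 0 => pv 0
  | S k' => match p with
            | pv j => pv j
            | pin i q => pin i (cos k' (nth i (children B) (node [])) q)
            end
  end.
Fixpoint cot (k : nat) (B : tree) (p : pos) : pos :=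
  match k with
  | 0 => pv (length (children B))
  | S k' => match p with
            | pv j => pv j
            | pin i q => pin i (cot k' (nth i (children B) (node [])) q)
            end
  end.

Lemma bdry_leaf k : bdry k (node []) = node [].
Proof. destruct k; reflexivity. Qed.

Lemma nth_bdry k i l : nth i (map (bdry k) l) (node []) = bdry k (nth i l (node [])).
Proof.
  rewrite <- (bdry_leaf k) at 1. apply map_nth.
Qed.

Lemma cos_valid k B p : pvalid (bdry k B) p = true -> pvalid B (cos k B p) = true.
Proof.
  revert B p; induction k as [|k IH]; intros [l] p H; simpl.
  - try reflexivity; apply Nat.leb_le; lia.
  - destruct p as [j|i q]; simpl in *.
    + rewrite length_map in H. exact H.
    + apply andb_prop in H as [H1 H2]. rewrite length_map in H1. rewrite H1. simpl.
      apply IH. rewrite nth_bdry in H2. exact H2.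
Qed.

Lemma cot_valid k B p : pvalid (bdry k B) p = true -> pvalid B (cot k B p) = true.
Proof.
  revert B p; induction k as [|k IH]; intros [l] p H; simpl.
  - try reflexivity; apply Nat.leb_le; lia.
  - destruct p as [j|i q]; simpl in *.
    + rewrite length_map in H. exact H.
    + apply andb_prop in H as [H1 H2]. rewrite length_map in H1. rewrite H1. simpl.
      apply IH. rewrite nth_bdry in H2. exact H2.
Qed.

Definition cosT (k : nat) (B : tree) (p : PosT (bdry k B)) : PosT B :=
  exist _ (cos k B (proj1_sig p)) (cos_valid k B _ (proj2_sig p)).
Definition cotT (k : nat) (B : tree) (p : PosT (bdry k B)) : PosT B :=
  exist _ (cot k B (proj1_sig p)) (cot_valid k B _ (proj2_sig p)).

(* Globular sets, presented by a carrier, a predicate "x is an n-cell",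
   and source/target functions (values on 0-cells are irrelevant). *)
Record GS : Type := {
  cell : Type;
  isc : nat -> cell -> Prop;
  gsrc : cell -> cell;
  gtgt : cell -> cell }.

Definition PosG (B : tree) : GS :=
  {| cell := PosT B;
     isc := fun n p => pdim (proj1_sig p) = n;
     gsrc := psrcT B;
     gtgt := ptgtT B |}.

(* Raw terms of the free weak omega-category T Y on generators G.
   coh0 B f   is coh(B, the unique (-1)-sphere, f);
   coh B u v f is coh(B, (u,v), f) with u v cells of T Pos(B). *)
Inductive tm (G : Type) : Type :=
| var : G -> tm G
| coh0 : forall B : tree, (PosT B -> tm G) -> tm G
| coh : forall B : tree, tm (PosT B) -> tm (PosT B) -> (PosT B -> tm G) -> tm G.
Arguments var {G} _.
Arguments coh0 {G} _ _.
Arguments coh {G} _ _ _ _.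

Fixpoint Tmap {G H : Type} (f : G -> H) (t : tm G) : tm H :=
  match t with
  | var g => var (f g)
  | coh0 B s => coh0 B (fun p => Tmap f (s p))
  | coh B u v s => coh B u v (fun p => Tmap f (s p))
  end.

(* substitution; bind (fun t => t) is the multiplication of T *)
Fixpoint bind {G H : Type} (f : G -> tm H) (t : tm G) : tm H :=
  match t with
  | var g => f g
  | coh0 B s => coh0 B (fun p => bind f (s p))
  | coh B u v s => coh B u v (fun p => bind f (s p))
  end.

Definition tsrc (Y : GS) (t : tm (cell Y)) : tm (cell Y) :=
  match t with
  | var y => var (gsrc Y y)
  | coh0 _ _ => t
  | coh B u v s => bind s u
  end.
Definition ttgt (Y : GS) (t : tm (cell Y)) : tm (cell Y) :=
  match t with
  | var y => var (gtgt Y y)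
  | coh0 _ _ => t
  | coh B u v s => bind s v
  end.

Inductive occurs {G : Type} (g : G) : tm G -> Prop :=
| occ_var : occurs g (var g)
| occ_coh0 : forall B s p, occurs g (s p) -> occurs g (coh0 B s)
| occ_coh : forall B u v s p, occurs g (s p) -> occurs g (coh B u v s).

Fixpoint insupp (Y : GS) (n : nat) (t : tm (cell Y)) (y : cell Y) : Prop :=
  occurs y t \/
  match n with
  | 0 => False
  | S m => insupp Y m (tsrc Y t) y \/ insupp Y m (ttgt Y t) y
  end.

Definition covers (P : tree) (n : nat) (u : tm (PosT P)) : Prop :=
  forall p : PosT P, insupp (PosG P) n u p.

Inductive tvalid : forall Y : GS, nat -> tm (cell Y) -> Prop :=
| tv_var : forall (Y : GS) n (y : cell Y), isc Y n y -> tvalid Y n (var y)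
| tv_coh0 : forall (Y : GS) (B : tree) (s : PosT B -> tm (cell Y)),
    tdim B <= 0 ->
    (forall p : PosT B, tvalid Y (pdim (proj1_sig p)) (s p)) ->
    (forall p : PosT B, 0 < pdim (proj1_sig p) ->
        tsrc Y (s p) = s (psrcT B p) /\ ttgt Y (s p) = s (ptgtT B p)) ->
    tvalid Y 0 (coh0 B s)
| tv_coh : forall (Y : GS) (n : nat) (B : tree) (u v : tm (PosT B))
    (s : PosT B -> tm (cell Y)) (u' v' : tm (PosT (bdry n B))),
    tdim B <= S n ->
    tvalid (PosG B) n u -> tvalid (PosG B) n v ->
    (0 < n -> tsrc (PosG B) u = tsrc (PosG B) v /\ ttgt (PosG B) u = ttgt (PosG B) v) ->
    tvalid (PosG (bdry n B)) n u' -> covers (bdry n B) n u' -> u = Tmap (cosT n B) u' ->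
    tvalid (PosG (bdry n B)) n v' -> covers (bdry n B) n v' -> v = Tmap (cotT n B) v' ->
    (forall p : PosT B, tvalid Y (pdim (proj1_sig p)) (s p)) ->
    (forall p : PosT B, 0 < pdim (proj1_sig p) ->
        tsrc Y (s p) = s (psrcT B p) /\ ttgt Y (s p) = s (ptgtT B p)) ->
    tvalid Y (S n) (coh B u v s).

Definition TGS (Y : GS) : GS :=
  {| cell := tm (cell Y); isc := tvalid Y; gsrc := tsrc Y; gtgt := ttgt Y |}.

Definition sigsrc (X : nat -> Type) (s : forall n, X (S n) -> X n)
  (x : {n : nat & X n}) : {n : nat & X n} :=
  match x with
  | existT _ n y =>
      match n return X n -> {m : nat & X m} with
      | 0 => fun y => existT X 0 y
      | S m => fun y => existT X m (s m y)
      end y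
  end.

Definition GSof (X : nat -> Type) (s t : forall n, X (S n) -> X n) : GS :=
  {| cell := {n : nat & X n};
     isc := fun n x => projT1 x = n;
     gsrc := sigsrc X s;
     gtgt := sigsrc X t |}.

(* A weak omega-category: a globular set X with a T-algebra structure
   alpha : T X -> X (a globular map satisfying the unit and multiplication
   laws).  alpha is given as a function on raw terms; only its values on
   cells of T X matter. *)
Record WCat : Type := {
  X : nat -> Type;
  xs : forall n, X (S n) -> X n;
  xt : forall n, X (S n) -> X n;
  xglob1 : forall n (x : X (S (S n))), xs n (xs (S n) x) = xs n (xt (S n) x);
  xglob2 : forall n (x : X (S (S n))), xt n (xs (S n) x) = xt n (xt (S n) x);
  alpha : tm {n : nat & X n} -> {n : nat & X n};
  alpha_dim : forall n t, tvalid (GSof X xs xt) n t -> projT1 (alpha t) = n;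
  alpha_src : forall n t, tvalid (GSof X xs xt) (S n) t ->
      sigsrc X xs (alpha t) = alpha (tsrc (GSof X xs xt) t);
  alpha_tgt : forall n t, tvalid (GSof X xs xt) (S n) t ->
      sigsrc X xt (alpha t) = alpha (ttgt (GSof X xs xt) t);
  alpha_unit : forall x, alpha (var x) = x;
  alpha_mult : forall n (F : tm (tm {n : nat & X n})),
      tvalid (TGS (GSof X xs xt)) n F ->
      alpha (bind (fun t => t) F) = alpha (Tmap alpha F) }.

Definition GX (C : WCat) : GS := GSof (X C) (xs C) (xt C).
Definition xcell (C : WCat) : Type := {n : nat & X C n}.
Definition xsrc (C : WCat) : xcell C -> xcell C := sigsrc (X C) (xs C).
Definition xtgt (C : WCat) : xcell C -> xcell C := sigsrc (X C) (xt C).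

Definition isgmap (C : WCat) (B : tree) (f : PosT B -> xcell C) : Prop :=
  forall p : PosT B,
    projT1 (f p) = pdim (proj1_sig p) /\
    (0 < pdim (proj1_sig p) -> xsrc C (f p) = f (psrcT B p) /\ xtgt C (f p) = f (ptgtT B p)).

Definition cohX (C : WCat) (B : tree) (u v : tm (PosT B)) (f : PosT B -> xcell C) : xcell C :=
  alpha C (Tmap f (coh B u v (@var (PosT B)))).

Fixpoint Dtree (n : nat) : tree :=
  match n with 0 => node [] | S k => node [Dtree k] end.
Fixpoint topD (n : nat) : pos :=
  match n with 0 => pv 0 | S k => pin 0 (topD k) end.
Lemma topD_valid n : pvalid (Dtree n) (topD n) = true.
Proof. induction n; simpl; auto. Qed.
Definition topDT (n : nat) : PosT (Dtree n) := exist _ (topD n) (topD_valid n).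

Fixpoint lastv (p : pos) : nat :=
  match p with pv j => j | pin _ q => lastv q end.
Fixpoint brn (p : pos) : nat :=
  match p with pv _ => 0 | pin i (pv _) => i | pin _ q => brn q end.

(* the globular map Pos(D_n) -> X classifying an n-cell x *)
Definition dispX (C : WCat) (n : nat) (x : xcell C) (p : PosT (Dtree n)) : xcell C :=
  let k := pdim (proj1_sig p) in
  if k =? n then x
  else if lastv (proj1_sig p) =? 0 then Nat.iter (n - k) (xsrc C) x
  else Nat.iter (n - k) (xtgt C) x.

Definition idc (C : WCat) (x : xcell C) : xcell C :=
  cohX C (Dtree (projT1 x)) (var (topDT (projT1 x))) (var (topDT (projT1 x)))
       (dispX C (projT1 x) x).

(* Canonical binary composition x *_n y of (n+1)-cells: coh over the tree
   Sigma^n [[],[]] *)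
Fixpoint Ctree (n : nat) : tree :=
  match n with 0 => node [node []; node []] | S k => node [Ctree k] end.
Fixpoint csrc (n : nat) : pos :=
  match n with 0 => pv 0 | S k => pin 0 (csrc k) end.
Fixpoint ctgt (n : nat) : pos :=
  match n with 0 => pv 2 | S k => pin 0 (ctgt k) end.
Lemma csrc_valid n : pvalid (Ctree n) (csrc n) = true.
Proof. induction n; simpl; auto. Qed.
Lemma ctgt_valid n : pvalid (Ctree n) (ctgt n) = true.
Proof. induction n; simpl; auto. Qed.
Definition csrcT n : PosT (Ctree n) := exist _ (csrc n) (csrc_valid n).
Definition ctgtT n : PosT (Ctree n) := exist _ (ctgt n) (ctgt_valid n).

(* the globular map Pos(Sigma^n [[],[]]) -> X classifying a composable pair *)
Definition cmapX (C : WCat) (n : nat) (x y : xcell C) (p : PosT (Ctree n)) : xcell C :=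
  let k := pdim (proj1_sig p) in
  if k =? S n then (if brn (proj1_sig p) =? 0 then x else y)
  else if k =? n then
    (match lastv (proj1_sig p) with 0 => xsrc C x | 1 => xtgt C x | _ => xtgt C y end)
  else if lastv (proj1_sig p) =? 0 then Nat.iter (S n - k) (xsrc C) x
  else Nat.iter (S n - k) (xtgt C) x.

Definition comp (C : WCat) (n : nat) (x y : xcell C) : xcell C :=
  cohX C (Ctree n) (var (csrcT n)) (var (ctgtT n)) (cmapX C n x y).

(* Invertible cells: the largest set W of positive-dimensional cells such
   that every x : u -> v in W of dimension n+1 has xb : v -> u and cells
   eta : x *_n xb -> id u, eps : xb *_n x -> id v lying in W. *)
Definition inv_closed (C : WCat) (S : xcell C -> Prop) : Prop :=
  forall x, S x ->
  exists n, projT1 x = Datatypes.S n /\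
  exists xb eta eps : xcell C,
    projT1 xb = Datatypes.S n /\ xsrc C xb = xtgt C x /\ xtgt C xb = xsrc C x /\
    projT1 eta = Datatypes.S (Datatypes.S n) /\
    xsrc C eta = comp C n x xb /\ xtgt C eta = idc C (xsrc C x) /\ S eta /\
    projT1 eps = Datatypes.S (Datatypes.S n) /\
    xsrc C eps = comp C n xb x /\ xtgt C eps = idc C (xtgt C x) /\ S eps.

Definition invertible (C : WCat) (x : xcell C) : Prop :=
  exists S, inv_closed C S /\ S x.

Definition Cset (C : WCat) (A : xcell C -> Prop) (c : xcell C) : Prop :=
  exists (B : tree) (d : nat), tdim B = S d /\
  exists a b : tm (PosT (bdry d B)),
    tvalid (PosG (bdry d B)) d a /\ tvalid (PosG (bdry d B)) d b /\
    (0 < d -> tsrc (PosG (bdry d B)) a = tsrc (PosG (bdry d B)) b /\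
              ttgt (PosG (bdry d B)) a = ttgt (PosG (bdry d B)) b) /\
    covers (bdry d B) d a /\ covers (bdry d B) d b /\
  exists sigma : PosT B -> xcell C,
    isgmap C B sigma /\
    (forall p : PosT B, pdim (proj1_sig p) = S d -> A (sigma p)) /\
    c = cohX C B (Tmap (cosT d B) a) (Tmap (cotT d B) b) sigma.

Fixpoint Wle (C : WCat) (n : nat) : xcell C -> Prop :=
  match n with
  | 0 => invertible C
  | S m => fun c => Wle C m c \/ Cset C (Wle C m) c
  end.
Definition Wn (C : WCat) (n : nat) : xcell C -> Prop :=
  match n with
  | 0 => invertible C
  | S m => Cset C (Wle C m)
  end.
Definition Winf (C : WCat) (c : xcell C) : Prop := exists n, Wn C n c.

(* Main.v *)
(** Call two parallel cells x, y linked, x ~ y, when some cell x -> y lies in the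
    closure of the invertible cells under the operations C.  Cells coh(B, t -> t')
    with dim B <= dim t are invertible, their cancellators being cells of the same
    kind; so parallel covering terms t, t' over B have linked values, and ~ is a
    congruence: growing a new leaf on every maximal position of B turns links between
    the arguments of an operation into a link between its values.

    For x = coh(B, a -> b, f) with P the boundary of B, coherence over B replaces B by
    the tree with one top cell over each top position of P, whose argument is the
    composite of the corresponding string of B.  The inverse is coh(B, b -> a, -) on
    the inverses of these strings, and
      x * x' ~ coh(P with one top cell each, a -> a, e_p * e'_p)
             ~ coh(P with one top cell each, a -> a, id) ~ id,
    by coherence over P with two top cells each, congruence, and coherence over P.
    So the closure is itself closed under inverses and cancellators, and coinduction
    applies. *)

From Stdlib Require Import List Arith Lia Bool FunctionalExtensionality Eqdep_dec.
From Stdlib Require Import ClassicalEpsilon.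
Import ListNotations.
Require Import Defs.

(** A link asks for a cell of the closure and not for an invertible cell, because congruence wraps
    given links in one more operation, whose invertibility is known only at the end. No circularity
    arises, since a single layer of data has to be produced for each cell: an inverse and two links.

    Strings are composed to single cells because one edge can be inverted within an unchanged tree:
    exchanging [a] with [b] and the two ends of each edge gives the inverse over the same shape. The
    lengths of the strings of [B], zero included, then matter only in an induction along binary
    composites.

    Coherence works in dimensions [n] with [tdim B <= n] because there [bdry n B = B] and both
    inclusions of the boundary are identities. Any two parallel covering n-cells thus form a full
    sphere, and the two sides of a cancellator form one again in the next dimension. *)

Record globular (Y : GS) : Prop := {
  gl_src : forall n y, isc Y (S n) y -> isc Y n (gsrc Y y);
  gl_tgt : forall n y, isc Y (S n) y -> isc Y n (gtgt Y y);
  gl_ss : forall n y, isc Y (S (S n)) y -> gsrc Y (gsrc Y y) = gsrc Y (gtgt Y y);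
  gl_tt : forall n y, isc Y (S (S n)) y -> gtgt Y (gsrc Y y) = gtgt Y (gtgt Y y) }.

(** Faces are compared only from dimension 1 on, since the face maps of a [GS] take arbitrary values
    on 0-cells. *)
Record gmap (Y Z : GS) (f : cell Y -> cell Z) : Prop := {
  gm_isc : forall n y, isc Y n y -> isc Z n (f y);
  gm_src : forall n y, isc Y (S n) y -> gsrc Z (f y) = f (gsrc Y y);
  gm_tgt : forall n y, isc Y (S n) y -> gtgt Z (f y) = f (gtgt Y y) }.

Definition parallel (Y : GS) (n : nat) (x y : cell Y) : Prop :=
  0 < n -> gsrc Y x = gsrc Y y /\ gtgt Y x = gtgt Y y.

Lemma gmap_comp Y Z V f g : gmap Y Z f -> gmap Z V g -> gmap Y V (fun y => g (f y)).
Proof.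
  intros [a1 a2 a3] [b1 b2 b3]; split; intros n y H; eauto.
  - rewrite (b2 n) by eauto. f_equal; eauto.
  - rewrite (b3 n) by eauto. f_equal; eauto.
Qed.

Lemma gmap_parallel Y Z f n x y :
  gmap Y Z f -> isc Y n x -> isc Y n y -> parallel Y n x y -> parallel Z n (f x) (f y).
Proof.
  intros Hf Hx Hy H Hn. destruct n as [|n]; [lia|]. destruct (H Hn) as [H1 H2].
  rewrite !(gm_src _ _ _ Hf n), !(gm_tgt _ _ _ Hf n) by assumption.
  rewrite H1, H2. auto.
Qed.

Lemma globular_parallel Y n x :
  globular Y -> isc Y (S n) x -> parallel Y n (gsrc Y x) (gtgt Y x).
Proof.
  intros HY Hx Hn. destruct n as [|n]; [lia|].
  split; [eapply gl_ss|eapply gl_tt]; eassumption.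
Qed.

(** * Terms, substitution and the free globular set of terms *)

Section TermAlgebra.
Context {G H K : Type}.

Lemma Tmap_id (t : tm G) : Tmap (fun g => g) t = t.
Proof.
  induction t; simpl; f_equal; apply functional_extensionality; auto.
Qed.

Lemma Tmap_Tmap (f : G -> H) (g : H -> K) (t : tm G) :
  Tmap g (Tmap f t) = Tmap (fun x => g (f x)) t.
Proof.
  induction t; simpl; f_equal; apply functional_extensionality; auto.
Qed.

Lemma Tmap_ext_occurs (f g : G -> H) (t : tm G) :
  (forall x, occurs x t -> f x = g x) -> Tmap f t = Tmap g t.
Proof.
  induction t; simpl; intros E; f_equal; try apply functional_extensionality;
    eauto using @occurs.
Qed.

Lemma bind_var (f : G -> H) (t : tm G) : bind (fun g => var (f g)) t = Tmap f t.
Proof.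
  induction t; simpl; f_equal; apply functional_extensionality; auto.
Qed.

Lemma bind_Tmap (f : G -> H) (s : H -> tm K) (t : tm G) :
  bind s (Tmap f t) = bind (fun x => s (f x)) t.
Proof.
  induction t; simpl; f_equal; apply functional_extensionality; auto.
Qed.

Lemma bind_bind (s : G -> tm H) (r : H -> tm K) (t : tm G) :
  bind r (bind s t) = bind (fun x => bind r (s x)) t.
Proof.
  induction t; simpl; f_equal; apply functional_extensionality; auto.
Qed.

Lemma occurs_Tmap (f : G -> H) g (t : tm G) : occurs g t -> occurs (f g) (Tmap f t).
Proof.
  induction 1; simpl; [apply occ_var|eapply occ_coh0|eapply occ_coh]; eauto.
Qed.

End TermAlgebra.

(** The conditions that [tv_coh] puts on the sphere of a coherence, in one bundle. *)
Definition admissible (B : tree) (n : nat) (u v : tm (PosT B)) : Prop :=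
  tvalid (PosG B) n u /\ tvalid (PosG B) n v /\ parallel (TGS (PosG B)) n u v /\
  exists u' v' : tm (PosT (bdry n B)),
    tvalid (PosG (bdry n B)) n u' /\ covers (bdry n B) n u' /\ u = Tmap (cosT n B) u' /\
    tvalid (PosG (bdry n B)) n v' /\ covers (bdry n B) n v' /\ v = Tmap (cotT n B) v'.

Lemma gmap_PosG B Z (s : PosT B -> cell Z) :
  (forall p, isc Z (pdim (proj1_sig p)) (s p)) ->
  (forall p, 0 < pdim (proj1_sig p) ->
     gsrc Z (s p) = s (psrcT B p) /\ gtgt Z (s p) = s (ptgtT B p)) ->
  gmap (PosG B) Z s.
Proof.
  intros H1 H2; split; simpl; intros n y Hy.
  - rewrite <- Hy; auto.
  - apply H2; lia.
  - apply H2; lia.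
Qed.

Lemma tvalid_coh Y n B u v (s : PosT B -> tm (cell Y)) :
  tdim B <= S n -> admissible B n u v -> gmap (PosG B) (TGS Y) s -> tvalid Y (S n) (coh B u v s).
Proof.
  intros HB (Hu & Hv & Hp & u' & v' & ? & ? & ? & ? & ? & ?) Hs.
  apply (tv_coh Y n B u v s u' v'); auto.
  - intros p. exact (gm_isc _ _ _ Hs _ p eq_refl).
  - intros p Hpd. simpl in *. destruct (pdim (proj1_sig p)) as [|k] eqn:E; [lia|].
    split; [apply (gm_src _ _ _ Hs k)|apply (gm_tgt _ _ _ Hs k)]; exact E.
Qed.

Lemma tvalid_coh0 Y B (s : PosT B -> tm (cell Y)) :
  tdim B <= 0 -> gmap (PosG B) (TGS Y) s -> tvalid Y 0 (coh0 B s).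
Proof.
  intros HB Hs. apply tv_coh0; auto.
  - intros p. exact (gm_isc _ _ _ Hs _ p eq_refl).
  - intros p Hpd. simpl in *. destruct (pdim (proj1_sig p)) as [|k] eqn:E; [lia|].
    split; [apply (gm_src _ _ _ Hs k)|apply (gm_tgt _ _ _ Hs k)]; exact E.
Qed.

(** The type of the term depends on the index [Y]. Matching on the term in the conclusion lets a
    plain case analysis replace an inversion with equations between dependent pairs. *)
Lemma tvalid_inv Y n t : tvalid Y n t ->
  match t with
  | var y => isc Y n y
  | coh0 B s => n = 0 /\ tdim B <= 0 /\ gmap (PosG B) (TGS Y) s
  | coh B u v s =>
      exists m, n = S m /\ tdim B <= S m /\ admissible B m u v /\ gmap (PosG B) (TGS Y) s
  end.
Proof.
  destruct 1; auto.
  - split; [|split]; auto. apply gmap_PosG; auto.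
  - exists n. split; [|split; [|split]]; auto; [|apply gmap_PosG; auto].
    split; [|split; [|split]]; auto. exists u', v'; auto 8.
Qed.

(** In [tvalid] the globular set is an index, because spheres are typed over [PosG B]. This
    principle keeps [Y] fixed: induction hypotheses are given for the arguments of a coherence,
    while its sphere only remains admissible. *)
Lemma tvalid_fixed_ind Y (P : nat -> tm (cell Y) -> Prop) :
  (forall n y, isc Y n y -> P n (var y)) ->
  (forall B s, tdim B <= 0 -> gmap (PosG B) (TGS Y) s ->
     (forall p, P (pdim (proj1_sig p)) (s p)) -> P 0 (coh0 B s)) ->
  (forall n B u v s, tdim B <= S n -> admissible B n u v -> gmap (PosG B) (TGS Y) s ->
     (forall p, P (pdim (proj1_sig p)) (s p)) -> P (S n) (coh B u v s)) ->
  forall n t, tvalid Y n t -> P n t.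
Proof.
  intros H1 H2 H3 n t Ht. revert P H1 H2 H3.
  induction Ht; intros P H1' H2' H3'; auto.
  - apply H2'; auto; [apply gmap_PosG; auto|].
    intros p; match goal with IH : forall p P, _ |- _ => apply IH; assumption end.
  - apply H3'; auto; [|apply gmap_PosG; auto|
      intros p; match goal with IH : forall p P, _ |- _ => apply IH; assumption end].
    split; [|split; [|split]]; auto. exists u', v'; auto 8.
Qed.

Lemma tsrc_bind Y Z (s : cell Y -> tm (cell Z)) n t :
  gmap Y (TGS Z) s -> tvalid Y (S n) t -> tsrc Z (bind s t) = bind s (tsrc Y t).
Proof.
  intros Hs Ht. apply tvalid_inv in Ht. destruct t; simpl in *.
  - exact (gm_src _ _ _ Hs n _ Ht).
  - destruct Ht; discriminate.
  - rewrite bind_bind; reflexivity.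
Qed.

Lemma ttgt_bind Y Z (s : cell Y -> tm (cell Z)) n t :
  gmap Y (TGS Z) s -> tvalid Y (S n) t -> ttgt Z (bind s t) = bind s (ttgt Y t).
Proof.
  intros Hs Ht. apply tvalid_inv in Ht. destruct t; simpl in *.
  - exact (gm_tgt _ _ _ Hs n _ Ht).
  - destruct Ht; discriminate.
  - rewrite bind_bind; reflexivity.
Qed.

Lemma tvalid_bind Y Z (s : cell Y -> tm (cell Z)) n t :
  gmap Y (TGS Z) s -> tvalid Y n t -> tvalid Z n (bind s t).
Proof.
  intros Hs Ht. revert n t Ht. apply tvalid_fixed_ind.
  - intros n y Hy. apply (gm_isc _ _ _ Hs n y Hy).
  - intros B r HB Hr IH. apply tvalid_coh0; auto. apply gmap_PosG; auto.
    intros p Hp. destruct (pdim (proj1_sig p)) as [|k] eqn:E; [lia|].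
    split; cbn.
    + rewrite (tsrc_bind Y Z s k) by (auto; exact (gm_isc _ _ _ Hr _ _ E)).
      exact (f_equal (bind s) (gm_src _ _ _ Hr k _ E)).
    + rewrite (ttgt_bind Y Z s k) by (auto; exact (gm_isc _ _ _ Hr _ _ E)).
      exact (f_equal (bind s) (gm_tgt _ _ _ Hr k _ E)).
  - intros n B u v r HB Huv Hr IH. apply tvalid_coh; auto. apply gmap_PosG; auto.
    intros p Hp. destruct (pdim (proj1_sig p)) as [|k] eqn:E; [lia|].
    split; cbn.
    + rewrite (tsrc_bind Y Z s k) by (auto; exact (gm_isc _ _ _ Hr _ _ E)).
      exact (f_equal (bind s) (gm_src _ _ _ Hr k _ E)).
    + rewrite (ttgt_bind Y Z s k) by (auto; exact (gm_isc _ _ _ Hr _ _ E)).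
      exact (f_equal (bind s) (gm_tgt _ _ _ Hr k _ E)).
Qed.

Lemma gmap_bind Y Z (s : cell Y -> tm (cell Z)) :
  gmap Y (TGS Z) s -> gmap (TGS Y) (TGS Z) (bind s).
Proof.
  intros Hs; split; cbn; intros n t Ht.
  - eapply tvalid_bind; eauto.
  - eapply tsrc_bind; eauto.
  - eapply ttgt_bind; eauto.
Qed.

Lemma gmap_var Y : gmap Y (TGS Y) var.
Proof. split; cbn; intros; auto. apply tv_var; auto. Qed.

Lemma gmap_Tmap Y Z (f : cell Y -> cell Z) : gmap Y Z f -> gmap (TGS Y) (TGS Z) (Tmap f).
Proof.
  intros Hf.
  replace (Tmap f) with (bind (fun y => var (f y)))
    by (apply functional_extensionality; intros; apply bind_var).
  apply gmap_bind. exact (gmap_comp _ _ _ _ _ Hf (gmap_var Z)).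
Qed.

(** For a coherence, globularity is the parallelism of its sphere, carried along by substitution. *)
Lemma globular_TGS Y : globular Y -> globular (TGS Y).
Proof.
  intros HY.
  split; cbn; intros n t Ht; pose proof (tvalid_inv _ _ _ Ht) as Hi; destruct t; cbn in *;
    try (destruct Hi; discriminate).
  - apply tv_var. eapply gl_src; eauto.
  - destruct Hi as (m & E & _ & Hf & Hs). injection E as ->.
    apply (tvalid_bind (PosG B) Y); [exact Hs|apply Hf].
  - apply tv_var. eapply gl_tgt; eauto.
  - destruct Hi as (m & E & _ & Hf & Hs). injection E as ->.
    apply (tvalid_bind (PosG B) Y); [exact Hs|apply Hf].
  - f_equal. eapply gl_ss; eauto.
  - destruct Hi as (m & E & _ & (Hu & Hv & Hp & _) & Hs). injection E as <-.
    rewrite !(tsrc_bind (PosG B) Y _ n) by assumption. apply f_equal. apply Hp; lia.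
  - f_equal. eapply gl_tt; eauto.
  - destruct Hi as (m & E & _ & (Hu & Hv & Hp & _) & Hs). injection E as <-.
    rewrite !(ttgt_bind (PosG B) Y _ n) by assumption. apply f_equal. apply Hp; lia.
Qed.

Lemma insupp_Tmap Y Z (f : cell Y -> cell Z) n t y :
  gmap Y Z f -> tvalid Y n t -> globular Y ->
  insupp Y n t y -> insupp Z n (Tmap f t) (f y).
Proof.
  intros Hf Ht HY. pose proof (globular_TGS Y HY) as HT. pose proof (gmap_Tmap _ _ _ Hf) as HTf.
  revert t Ht. induction n as [|n IH]; cbn; intros t Ht [Ho|Hi];
    try (left; apply occurs_Tmap; exact Ho).
  - contradiction.
  - right.
    pose proof (gm_src _ _ _ HTf n t Ht) as E1. pose proof (gm_tgt _ _ _ HTf n t Ht) as E2.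
    cbn in E1, E2. rewrite E1, E2.
    destruct Hi as [Hi|Hi]; [left|right]; apply IH; auto.
    + apply (gl_src _ HT); exact Ht.
    + apply (gl_tgt _ HT); exact Ht.
Qed.

(** * Evaluation of terms in a weak omega-category *)

Lemma globular_GX C : globular (GX C).
Proof.
  split; cbn; intros n [k x] E; simpl in E; subst k; simpl; auto.
  - f_equal. apply xglob1.
  - f_equal. apply xglob2.
Qed.

Lemma gmap_alpha C : gmap (TGS (GX C)) (GX C) (alpha C).
Proof.
  split; cbn; intros n t Ht.
  - apply alpha_dim; exact Ht.
  - exact (alpha_src C n t Ht).
  - exact (alpha_tgt C n t Ht).
Qed.

Definition ev (C : WCat) {B : tree} (f : PosT B -> xcell C) (t : tm (PosT B)) : xcell C :=
  alpha C (Tmap f t).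

Lemma gmap_ev C B f : gmap (PosG B) (GX C) f -> gmap (TGS (PosG B)) (GX C) (@ev C B f).
Proof.
  intros Hf. exact (gmap_comp _ _ _ _ _ (gmap_Tmap _ _ _ Hf) (gmap_alpha C)).
Qed.

Lemma ev_var C B f p : @ev C B f (var p) = f p.
Proof. apply alpha_unit. Qed.

(** The multiplication law is applied to a two-level term: the outer level is the coherence with the
    terms [s p] as generators. Flattening it gives [coh B u v s], evaluating the inner level first
    gives [cohX]. *)
Lemma alpha_coh C n B u v s : tvalid (GX C) (S n) (coh B u v s) ->
  alpha C (coh B u v s) = cohX C B u v (fun p => alpha C (s p)).
Proof.
  intros H. apply tvalid_inv in H. destruct H as (m & E & HB & Hf & Hs).
  injection E as <-.
  refine (alpha_mult C (S n) (coh B u v (fun p => var (s p))) _).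
  apply tvalid_coh; auto.
  exact (gmap_comp _ _ _ _ _ Hs (gmap_var (TGS (GX C)))).
Qed.

Lemma ev_coh C Q f n B u v (s : PosT B -> tm (PosT Q)) :
  gmap (PosG Q) (GX C) f -> tdim B <= S n -> admissible B n u v ->
    gmap (PosG B) (TGS (PosG Q)) s ->
  ev C f (coh B u v s) = cohX C B u v (fun p => ev C f (s p)).
Proof.
  intros Hf HB Huv Hs. unfold ev. simpl. eapply (alpha_coh C n).
  apply tvalid_coh; auto.
  exact (gmap_comp _ _ _ _ _ Hs (gmap_Tmap _ _ _ Hf)).
Qed.

Lemma ev_Tmap C P Q (h : PosT P -> PosT Q) f t : ev C f (Tmap h t) = ev C (fun p => f (h p)) t.
Proof. unfold ev. rewrite Tmap_Tmap. reflexivity. Qed.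

Lemma cohX_ev C B u v f : cohX C B u v f = ev C f (coh B u v var).
Proof. reflexivity. Qed.

Lemma tvalid_cohX C n B u v f :
  tdim B <= S n -> admissible B n u v -> gmap (PosG B) (GX C) f ->
  tvalid (GX C) (S n) (coh B u v (fun p => var (f p))).
Proof.
  intros HB Huv Hf. apply tvalid_coh; auto.
  exact (gmap_comp _ _ _ _ _ Hf (gmap_var (GX C))).
Qed.

Lemma cohX_dim C n B u v f :
  tdim B <= S n -> admissible B n u v -> gmap (PosG B) (GX C) f -> projT1 (cohX C B u v f) = S n.
Proof. intros. apply alpha_dim. apply tvalid_cohX; auto. Qed.

Lemma cohX_src C n B u v f :
  tdim B <= S n -> admissible B n u v -> gmap (PosG B) (GX C) f ->
  xsrc C (cohX C B u v f) = ev C f u.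
Proof.
  intros HB Huv Hf. unfold ev. rewrite <- bind_var.
  exact (alpha_src C n _ (tvalid_cohX C n B u v f HB Huv Hf)).
Qed.

Lemma cohX_tgt C n B u v f :
  tdim B <= S n -> admissible B n u v -> gmap (PosG B) (GX C) f ->
  xtgt C (cohX C B u v f) = ev C f v.
Proof.
  intros HB Huv Hf. unfold ev. rewrite <- bind_var.
  exact (alpha_tgt C n _ (tvalid_cohX C n B u v f HB Huv Hf)).
Qed.

(** * Positions *)

Notation leaf := (node []).

(** Replaces the nested recursion in [tdim] by a bound on each summand, in the indexed form in which
    [pvalid] addresses summands. *)
Lemma tdim_le_nth l n :
  tdim (node l) <= n <-> forall i, i < length l -> S (tdim (nth i l leaf)) <= n.
Proof.
  induction l as [|B l IH].
  - split; [intros _ i Hi; inversion Hi|intros; apply Nat.le_0_l].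
  - change (tdim (node (B :: l))) with (Nat.max (S (tdim B)) (tdim (node l))).
    split.
    + intros H [|i] Hi; simpl nth; simpl in Hi; [lia|]. apply IH; lia.
    + intros H. apply Nat.max_lub; [apply (H 0); simpl; lia|].
      apply IH. intros i Hi. apply (H (S i)). simpl; lia.
Qed.

Lemma pdim_le_tdim B p : pvalid B p = true -> pdim p <= tdim B.
Proof.
  revert B; induction p as [j|i q IH]; intros [l] H; simpl pdim; [lia|].
  simpl in H. apply andb_prop in H as [H1 H2]. apply Nat.ltb_lt in H1.
  specialize (IH _ H2).
  pose proof (proj1 (tdim_le_nth l (tdim (node l))) (le_n _) i H1). lia.
Qed.

(** Reduces dimensions of boundaries and sprouted trees to the existence of single positions. *)
Lemma tdim_attained n B : n <= tdim B -> exists p, pvalid B p = true /\ pdim p = n.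
Proof.
  revert B; induction n as [|n IH]; intros [l] H.
  - exists (pv 0); auto.
  - assert (Hn : exists i, i < length l /\ n <= tdim (nth i l leaf)).
    { apply NNPP; intros Hc. enough (tdim (node l) <= n) by lia.
      apply tdim_le_nth. intros i Hi.
      destruct (le_lt_dec n (tdim (nth i l leaf))); [exfalso; eauto|lia]. }
    destruct Hn as (i & Hi & Hd). destruct (IH _ Hd) as (p & Hp & E).
    exists (pin i p); simpl; split; [|congruence].
    rewrite Hp. apply Nat.ltb_lt in Hi; rewrite Hi; reflexivity.
Qed.

Lemma PosT_eq B (p q : PosT B) : proj1_sig p = proj1_sig q -> p = q.
Proof.
  destruct p as [p Hp], q as [q Hq]; simpl; intros <-.
  f_equal. apply UIP_dec, bool_dec.
Qed.

(* Invalid raw positions are sent to the vertex [pv 0]. *)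
Definition mkpos (B : tree) (p : pos) : PosT B :=
  match bool_dec (pvalid B p) true with
  | left H => exist _ p H
  | right _ => exist _ (pv 0) eq_refl
  end.

Lemma mkpos_val B p : pvalid B p = true -> proj1_sig (mkpos B p) = p.
Proof. unfold mkpos. destruct (bool_dec _ _); [reflexivity|contradiction]. Qed.

Lemma mkpos_proj B (p : PosT B) : mkpos B (proj1_sig p) = p.
Proof. apply PosT_eq, mkpos_val, proj2_sig. Qed.

(* For a [d]-dimensional position [p] of [bdry d B], the part of [B] lying over [p] is a
   string of composable [(d+1)]-cells: [vtx d j p] is its [j]-th vertex, [edge d j p] its
   [j]-th edge and [arity d B p] its length.  Below dimension [d], [vtx d j] is the identity. *)
Fixpoint vtx (d j : nat) (p : pos) : pos :=
  match d with
  | 0 => pv j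
  | S d' => match p with pv i => pv i | pin i q => pin i (vtx d' j q) end
  end.

Fixpoint edge (d j : nat) (p : pos) : pos :=
  match d with
  | 0 => pin j (pv 0)
  | S d' => match p with pv i => pv i | pin i q => pin i (edge d' j q) end
  end.

Fixpoint arity (d : nat) (B : tree) (p : pos) : nat :=
  match d with
  | 0 => length (children B)
  | S d' => match p with pv i => 0 | pin i q => arity d' (nth i (children B) leaf) q end
  end.

(* Prescribes the number [m] of [(d+1)]-cells over each [d]-cell of [bdry d B]. *)
Fixpoint sprout (d m : nat) (B : tree) : tree :=
  match d with
  | 0 => node (repeat leaf m)
  | S d' => node (map (sprout d' m) (children B))
  end.

Lemma cos_vtx d B p : cos d B p = vtx d 0 p.
Proof.
  revert B p; induction d as [|d IH]; intros B [j|i q]; simpl; try reflexivity.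
  rewrite IH; reflexivity.
Qed.

Lemma cot_vtx d B p : cot d B p = vtx d (arity d B p) p.
Proof.
  revert B p; induction d as [|d IH]; intros B [j|i q]; simpl; try reflexivity.
  rewrite IH; reflexivity.
Qed.

Lemma vtx_vtx d i j p : vtx d i (vtx d j p) = vtx d i p.
Proof. revert p; induction d; intros [?|? q]; simpl; f_equal; auto. Qed.

Lemma pdim_vtx d j p : pdim p = d -> pdim (vtx d j p) = d.
Proof. revert p; induction d; intros [?|? q]; simpl; intros; auto; discriminate. Qed.

Lemma pdim_edge d j p : pdim p = d -> pdim (edge d j p) = S d.
Proof. revert p; induction d; intros [?|? q]; simpl; intros; auto; discriminate. Qed.

Lemma vtx_low d j p : pdim p < d -> vtx d j p = p.
Proof.
  revert p; induction d; intros [?|? q]; simpl; intros; auto; try lia.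
  rewrite IHd by lia; reflexivity.
Qed.

Lemma vtx_edge d i j p : pdim p = d -> vtx d i (edge d j p) = vtx d i p.
Proof.
  revert p; induction d; intros [?|? q]; simpl; intros H; try discriminate; auto.
  rewrite IHd by lia; reflexivity.
Qed.

(** With [brn_edge], makes a position in a string decodable: its index is read off by [lastv] or
    [brn], and the cell below it by [vtx d 0]. This is what [glue] relies on. *)
Lemma lastv_vtx d j p : pdim p = d -> lastv (vtx d j p) = j.
Proof. revert p; induction d; intros [?|? q]; simpl; intros; auto; discriminate. Qed.

Lemma brn_edge d j p : pdim p = d -> brn (edge d j p) = j.
Proof.
  revert p; induction d as [|d IH]; intros [?|? q]; simpl; intros H; auto; try discriminate.
  rewrite <- (IH q) at 2 by lia.
  destruct d, q; simpl in *; try reflexivity; discriminate.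
Qed.

Lemma pdim_psrc p k : pdim p = S k -> pdim (psrc p) = k.
Proof.
  revert k; induction p as [|i q IH]; intros k H; [discriminate|].
  destruct q as [j|i' q']; simpl in *; [lia|].
  destruct k; [discriminate|]. rewrite (IH k) by lia; reflexivity.
Qed.

Lemma pdim_ptgt p k : pdim p = S k -> pdim (ptgt p) = k.
Proof.
  revert k; induction p as [|i q IH]; intros k H; [discriminate|].
  destruct q as [j|i' q']; simpl in *; [lia|].
  destruct k; [discriminate|]. rewrite (IH k) by lia; reflexivity.
Qed.

Lemma psrc_pin i q : 0 < pdim q -> psrc (pin i q) = pin i (psrc q).
Proof. destruct q; simpl; [lia|reflexivity]. Qed.

Lemma ptgt_pin i q : 0 < pdim q -> ptgt (pin i q) = pin i (ptgt q).
Proof. destruct q; simpl; [lia|reflexivity]. Qed.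

Lemma psrc_psrc p n : pdim p = S (S n) -> psrc (psrc p) = psrc (ptgt p).
Proof.
  revert n; induction p as [|i q IH]; intros n H; [discriminate|]. simpl in H.
  rewrite psrc_pin, ptgt_pin by lia.
  destruct n.
  - assert (pdim (psrc q) = 0) by (apply pdim_psrc; lia).
    assert (pdim (ptgt q) = 0) by (apply pdim_ptgt; lia).
    destruct (psrc q), (ptgt q); try discriminate; reflexivity.
  - assert (pdim (psrc q) = S n) by (apply pdim_psrc; lia).
    assert (pdim (ptgt q) = S n) by (apply pdim_ptgt; lia).
    rewrite !psrc_pin by lia. f_equal. apply (IH n); lia.
Qed.

Lemma ptgt_ptgt p n : pdim p = S (S n) -> ptgt (psrc p) = ptgt (ptgt p).
Proof.
  revert n; induction p as [|i q IH]; intros n H; [discriminate|]. simpl in H.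
  rewrite (psrc_pin i q), (ptgt_pin i q) by lia.
  destruct n.
  - assert (pdim (psrc q) = 0) by (apply pdim_psrc; lia).
    assert (pdim (ptgt q) = 0) by (apply pdim_ptgt; lia).
    destruct (psrc q), (ptgt q); try discriminate; reflexivity.
  - assert (pdim (psrc q) = S n) by (apply pdim_psrc; lia).
    assert (pdim (ptgt q) = S n) by (apply pdim_ptgt; lia).
    rewrite !ptgt_pin by lia. f_equal. apply (IH n); lia.
Qed.

Lemma globular_PosG B : globular (PosG B).
Proof.
  split; simpl; intros n p H.
  - apply pdim_psrc; exact H.
  - apply pdim_ptgt; exact H.
  - apply PosT_eq; simpl. eapply psrc_psrc; exact H.
  - apply PosT_eq; simpl. eapply ptgt_ptgt; exact H.
Qed.

Lemma psrc_edge d j p : pdim p = d -> psrc (edge d j p) = vtx d j p.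
Proof.
  revert p; induction d as [|d IH]; intros [?|i q] H; try discriminate; try reflexivity.
  simpl in H. change (edge (S d) j (pin i q)) with (pin i (edge d j q)).
  rewrite psrc_pin by (rewrite pdim_edge; lia). rewrite IH by lia. reflexivity.
Qed.

Lemma ptgt_edge d j p : pdim p = d -> ptgt (edge d j p) = vtx d (S j) p.
Proof.
  revert p; induction d as [|d IH]; intros [?|i q] H; try discriminate; try reflexivity.
  simpl in H. change (edge (S d) j (pin i q)) with (pin i (edge d j q)).
  rewrite ptgt_pin by (rewrite pdim_edge; lia). rewrite IH by lia. reflexivity.
Qed.

(** [vtx] alters only the innermost index, which the source forgets; so all vertices of a string are
    parallel. *)
Lemma psrc_vtx d j p : pdim p = S d -> psrc (vtx (S d) j p) = psrc p.
Proof.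
  revert p; induction d as [|d IH]; intros [?|i q] H; try discriminate; simpl in H.
  - destruct q; [reflexivity|discriminate].
  - change (vtx (S (S d)) j (pin i q)) with (pin i (vtx (S d) j q)).
    rewrite !psrc_pin by (try rewrite pdim_vtx; lia). rewrite IH by lia. reflexivity.
Qed.

Lemma ptgt_vtx d j p : pdim p = S d -> ptgt (vtx (S d) j p) = ptgt p.
Proof.
  revert p; induction d as [|d IH]; intros [?|i q] H; try discriminate; simpl in H.
  - destruct q; [reflexivity|discriminate].
  - change (vtx (S (S d)) j (pin i q)) with (pin i (vtx (S d) j q)).
    rewrite !ptgt_pin by (try rewrite pdim_vtx; lia). rewrite IH by lia. reflexivity.
Qed.

Lemma pvalid_pin B i q :
  pvalid B (pin i q) = true <->
  i < length (children B) /\ pvalid (nth i (children B) leaf) q = true.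
Proof. simpl. rewrite andb_true_iff, Nat.ltb_lt. reflexivity. Qed.

Lemma pvalid_bdry_pin d B i q :
  pvalid (bdry (S d) B) (pin i q) = true <->
  i < length (children B) /\ pvalid (bdry d (nth i (children B) leaf)) q = true.
Proof. rewrite pvalid_pin. simpl. rewrite length_map, nth_bdry. reflexivity. Qed.

Lemma pvalid_bdry_low d B p :
  pdim p < d -> pvalid (bdry d B) p = pvalid B p.
Proof.
  revert B p; induction d as [|d IH]; intros B [j|i q] H; simpl in H; try lia.
  - simpl. rewrite length_map. reflexivity.
  - simpl. rewrite length_map, nth_bdry, IH by lia. reflexivity.
Qed.

Lemma pdim_bdry d B p : pvalid (bdry d B) p = true -> pdim p <= d.
Proof.
  revert B p; induction d as [|d IH]; intros B [j|i q] H; simpl pdim; try lia.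
  - apply pvalid_pin in H. simpl in H. lia.
  - apply pvalid_bdry_pin in H as [_ H]. apply IH in H. lia.
Qed.

(** [bdry 0] is a point, so the innermost index of a d-cell of the boundary is already 0. *)
Lemma vtx0_bdry d B p : pvalid (bdry d B) p = true -> vtx d 0 p = p.
Proof.
  revert B p; induction d as [|d IH]; intros B [j|i q] H; simpl; try reflexivity.
  - apply Nat.leb_le in H. simpl in H. f_equal; lia.
  - apply pvalid_pin in H. simpl in H. lia.
  - apply pvalid_bdry_pin in H as [_ H]. apply IH in H. congruence.
Qed.

Lemma pvalid_vtx d B p j :
  pvalid (bdry d B) p = true -> pdim p = d -> j <= arity d B p -> pvalid B (vtx d j p) = true.
Proof.
  revert B p; induction d as [|d IH]; intros B [j'|i q] H Hd Hj; try discriminate.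
  - apply Nat.leb_le. exact Hj.
  - apply pvalid_bdry_pin in H as [H1 H2]. apply pvalid_pin. simpl in *. auto.
Qed.

Lemma pvalid_edge d B p j :
  pvalid (bdry d B) p = true -> pdim p = d -> j < arity d B p -> pvalid B (edge d j p) = true.
Proof.
  revert B p; induction d as [|d IH]; intros B [j'|i q] H Hd Hj; try discriminate.
  - apply pvalid_pin. simpl in *. auto.
  - apply pvalid_bdry_pin in H as [H1 H2]. apply pvalid_pin. simpl in *. auto.
Qed.

(** The normal form behind every later case distinction on positions: below dimension [d], or a
    vertex or an edge of the string over a d-cell of the boundary. *)
Lemma position_cases d B q : pvalid B q = true -> tdim B <= S d ->
  pdim q < d \/
  (exists p j, pvalid (bdry d B) p = true /\ pdim p = d /\ j <= arity d B p /\ q = vtx d j p) \/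
  (exists p j, pvalid (bdry d B) p = true /\ pdim p = d /\ j < arity d B p /\ q = edge d j p).
Proof.
  revert B q; induction d as [|d IH]; intros [l] [j|i q] H HB.
  - right; left. exists (pv 0), j. simpl in *. apply Nat.leb_le in H. auto.
  - right; right. apply pvalid_pin in H as [H1 H2].
    cbn [children] in H1, H2. exists (pv 0), i. repeat split; auto.
    pose proof (proj1 (tdim_le_nth l 1) HB i H1) as H4.
    apply pdim_le_tdim in H2 as H3. destruct q as [j|]; [|simpl pdim in H3; lia].
    (* The dimension bound forces the summand to be a point, hence the inner index to be 0. *)
    destruct (nth i l leaf) as [[|B l']].
    2: { pose proof (proj1 (tdim_le_nth (B :: l') 0) ltac:(lia) 0 (Nat.lt_0_succ _)). lia. }
    apply Nat.leb_le in H2. simpl in H2 |- *. do 2 f_equal; lia.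
  - left. simpl; lia.
  - apply pvalid_pin in H as [H1 H2]. simpl in H1, H2.
    pose proof (proj1 (tdim_le_nth l _) HB i H1) as H3.
    destruct (IH _ q H2 ltac:(lia)) as [H4|[(p & j & ? & ? & ? & ->)|(p & j & ? & ? & ? & ->)]].
    + left; simpl; lia.
    + right; left. exists (pin i p), j. split; [apply pvalid_bdry_pin; auto|].
      simpl; auto.
    + right; right. exists (pin i p), j. split; [apply pvalid_bdry_pin; auto|].
      simpl; auto.
Qed.

Lemma tdim_bdry d B : tdim (bdry d B) <= d.
Proof.
  destruct (le_lt_dec (tdim (bdry d B)) d) as [|H]; [assumption|].
  apply tdim_attained in H as (p & Hp & E). apply pdim_bdry in Hp. lia.
Qed.

Lemma bdry_id n B : tdim B <= n -> bdry n B = B.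
Proof.
  revert B; induction n as [|n IH]; intros [l] H.
  - destruct l as [|B l]; [reflexivity|].
    pose proof (proj1 (tdim_le_nth (B :: l) 0) H 0 (Nat.lt_0_succ _)). lia.
  - simpl. f_equal. rewrite <- (map_id l) at 2. apply map_ext_in. intros B HB.
    apply IH. apply In_nth with (d := leaf) in HB as (i & Hi & <-).
    pose proof (proj1 (tdim_le_nth l _) H i Hi). lia.
Qed.

Lemma bdry_sprout d m B : bdry d (sprout d m B) = bdry d B.
Proof.
  revert B; induction d as [|d IH]; intros [l]; simpl; [reflexivity|].
  f_equal. rewrite map_map. apply map_ext. auto.
Qed.

(** The index has to be in range: [sprout 0 m] does not fix the default [leaf], in contrast to
    [bdry]. *)
Lemma nth_sprout d m l i : i < length l ->
  nth i (map (sprout d m) l) leaf = sprout d m (nth i l leaf).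
Proof.
  intros H. rewrite nth_indep with (d' := sprout d m leaf) by (rewrite length_map; exact H).
  apply map_nth.
Qed.

Lemma arity_sprout d m B p :
  pvalid (bdry d B) p = true -> pdim p = d -> arity d (sprout d m B) p = m.
Proof.
  revert B p; induction d as [|d IH]; intros B [j|i q] H Hd; try discriminate.
  - simpl. apply repeat_length.
  - apply pvalid_bdry_pin in H as [H1 H2]. simpl in *. rewrite nth_sprout; auto.
Qed.

Lemma tdim_sprout_le d m B : tdim (sprout d m B) <= S d.
Proof.
  revert B; induction d as [|d IH]; intros [l]; apply tdim_le_nth; intros i Hi.
  - rewrite nth_repeat. auto.
  - simpl in *. rewrite length_map in Hi. rewrite nth_sprout by exact Hi.
    apply le_n_S. apply IH.
Qed.

Lemma tdim_sprout d m B : tdim (bdry d B) = d -> tdim (sprout d (S m) B) = S d.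
Proof.
  intros H. apply Nat.le_antisymm; [apply tdim_sprout_le|].
  destruct (tdim_attained d (bdry d B)) as (p & Hp & E); [lia|].
  rewrite <- (pdim_edge d 0 p E). apply pdim_le_tdim, pvalid_edge; auto.
  - rewrite bdry_sprout; exact Hp.
  - rewrite arity_sprout; auto; lia.
Qed.

Lemma tdim_bdry_eq d B : d <= tdim B -> tdim (bdry d B) = d.
Proof.
  intros H. apply Nat.le_antisymm; [apply tdim_bdry|].
  revert B H; induction d as [|d IH]; intros B H; [lia|].
  apply tdim_attained in H as ([j|i p] & Hp & E); [discriminate|].
  apply pvalid_pin in Hp as [H1 H2]. injection E as E.
  apply pdim_le_tdim in H2. rewrite E in H2. apply IH in H2.
  pose proof (proj1 (tdim_le_nth (map (bdry d) (children B)) _) (le_n _) i) as H3.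
  rewrite length_map, nth_bdry in H3. specialize (H3 H1). simpl in *. lia.
Qed.

Lemma tdim_Dtree n : tdim (Dtree n) = n.
Proof.
  induction n as [|n IH]; [reflexivity|].
  change (Nat.max (S (tdim (Dtree n))) 0 = S n). rewrite IH. lia.
Qed.

(** Brings binary composition under the general results on sprouted trees. *)
Lemma sprout_Dtree n : sprout n 2 (Dtree n) = Ctree n.
Proof. induction n as [|n IH]; simpl; [reflexivity|]. rewrite IH. reflexivity. Qed.

Lemma bdry_Dtree n : bdry n (Dtree n) = Dtree n.
Proof. apply bdry_id. rewrite tdim_Dtree. lia. Qed.

Lemma tdim_Ctree n : tdim (Ctree n) = S n.
Proof. rewrite <- sprout_Dtree. apply tdim_sprout. rewrite bdry_Dtree. apply tdim_Dtree. Qed.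

Lemma pdim_topD n : pdim (topD n) = n.
Proof. induction n; simpl; auto. Qed.

Lemma Dtree_top n p : pvalid (Dtree n) p = true -> pdim p = n -> p = topD n.
Proof.
  revert p; induction n as [|n IH]; intros [j|i q] H E; try discriminate.
  - apply Nat.leb_le in H. simpl in *. f_equal; lia.
  - apply pvalid_pin in H as [H1 H2]. simpl in *. assert (i = 0) as -> by lia.
    f_equal. apply IH; auto.
Qed.

Definition pvar (B : tree) (p : pos) : tm (PosT B) := var (mkpos B p).

(** Maps are given on raw positions, so that [glue] and iterated index changes need no validity
    proofs; only the values on valid positions count. *)
Definition rawmap (B : tree) (Z : GS) (f : pos -> cell Z) : Prop :=
  gmap (PosG B) Z (fun p : PosT B => f (proj1_sig p)).

Lemma rawmap_intro B Z f :
  (forall p, pvalid B p = true -> isc Z (pdim p) (f p)) ->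
  (forall p k, pvalid B p = true -> pdim p = S k ->
     gsrc Z (f p) = f (psrc p) /\ gtgt Z (f p) = f (ptgt p)) ->
  rawmap B Z f.
Proof.
  intros H1 H2; apply gmap_PosG.
  - intros [p Hp]; simpl; auto.
  - intros [p Hp]; simpl. intros H. apply (H2 p (pdim p - 1)); auto; lia.
Qed.

Lemma rawmap_isc B Z f p n :
  rawmap B Z f -> pvalid B p = true -> pdim p = n -> isc Z n (f p).
Proof. intros H Hp E. exact (gm_isc _ _ _ H n (exist _ p Hp) E). Qed.

Lemma rawmap_src B Z f p n :
  rawmap B Z f -> pvalid B p = true -> pdim p = S n -> gsrc Z (f p) = f (psrc p).
Proof. intros H Hp E. exact (gm_src _ _ _ H n (exist _ p Hp) E). Qed.

Lemma rawmap_tgt B Z f p n :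
  rawmap B Z f -> pvalid B p = true -> pdim p = S n -> gtgt Z (f p) = f (ptgt p).
Proof. intros H Hp E. exact (gm_tgt _ _ _ H n (exist _ p Hp) E). Qed.

Lemma rawmap_comp B Y Z f g : rawmap B Y f -> gmap Y Z g -> rawmap B Z (fun p => g (f p)).
Proof. intros Hf Hg. exact (gmap_comp _ _ _ _ _ Hf Hg). Qed.

Lemma rawmap_mkpos B Z (f : PosT B -> cell Z) :
  gmap (PosG B) Z f -> rawmap B Z (fun p => f (mkpos B p)).
Proof.
  intros H. unfold rawmap.
  replace (fun p : PosT B => f (mkpos B (proj1_sig p))) with f; [exact H|].
  apply functional_extensionality. intros p. rewrite mkpos_proj. reflexivity.
Qed.

(* A map out of a tree of dimension at most [d+1]: [f] below dimension [d], and the vertices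
   [v p] and edges [e p] of the string over each [d]-cell [p]. *)
Definition glue {Z : Type} (d : nat) (f : pos -> Z) (v e : pos -> nat -> Z) (q : pos) : Z :=
  if pdim q <? d then f q
  else if pdim q =? d then v (vtx d 0 q) (lastv q) else e (vtx d 0 q) (brn q).

Lemma glue_low {Z} d f v e q : pdim q < d -> @glue Z d f v e q = f q.
Proof. intros H. unfold glue. apply Nat.ltb_lt in H. rewrite H. reflexivity. Qed.

Lemma glue_vtx {Z} d f v e B p j : pvalid (bdry d B) p = true -> pdim p = d ->
  @glue Z d f v e (vtx d j p) = v p j.
Proof.
  intros H E. unfold glue. rewrite pdim_vtx, vtx_vtx, lastv_vtx by exact E.
  rewrite Nat.ltb_irrefl, Nat.eqb_refl. erewrite vtx0_bdry; eauto.
Qed.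

Lemma glue_mid {Z} d f v e B p : pvalid (bdry d B) p = true -> pdim p = d ->
  @glue Z d f v e p = v p 0.
Proof. intros H E. rewrite <- (vtx0_bdry d B p H) at 1. eapply glue_vtx; eauto. Qed.

Lemma glue_edge {Z} d f v e B p j : pvalid (bdry d B) p = true -> pdim p = d ->
  @glue Z d f v e (edge d j p) = e p j.
Proof.
  intros H E. unfold glue. rewrite pdim_edge, vtx_edge, brn_edge by exact E.
  replace (S d <? d) with false by (symmetry; apply Nat.ltb_ge; lia).
  replace (S d =? d) with false by (symmetry; apply Nat.eqb_neq; lia).
  erewrite vtx0_bdry; eauto.
Qed.

Lemma glue_map {Y Z} (h : Y -> Z) d f v e q :
  h (glue d f v e q) = glue d (fun p => h (f p)) (fun p i => h (v p i)) (fun p i => h (e p i)) q.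
Proof. unfold glue. destruct (pdim q <? d), (pdim q =? d); reflexivity. Qed.

Lemma glue_ext {Z} B d (f : pos -> Z) v e f' v' e' q : pvalid B q = true -> tdim B <= S d ->
  (forall p, pvalid B p = true -> pdim p < d -> f p = f' p) ->
  (forall p i, pvalid (bdry d B) p = true -> pdim p = d -> i <= arity d B p -> v p i = v' p i) ->
  (forall p i, pvalid (bdry d B) p = true -> pdim p = d -> i < arity d B p -> e p i = e' p i) ->
  glue d f v e q = glue d f' v' e' q.
Proof.
  intros Hq HB H1 H2 H3.
  destruct (position_cases d B q Hq HB)
    as [H|[(p & j & Hp & E & Hj & ->)|(p & j & Hp & E & Hj & ->)]].
  - rewrite !glue_low; auto.
  - erewrite !glue_vtx; eauto.
  - erewrite !glue_edge; eauto.
Qed.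

(** On d-cells [f] serves as a reference: every vertex over [p] is parallel to [f p], so its faces
    are the values of [f] below dimension [d], which are those of the glued map. *)
Lemma rawmap_glue Z B d f v e :
  tdim B <= S d -> rawmap (bdry d B) Z f ->
  (forall p i, pvalid (bdry d B) p = true -> pdim p = d -> i <= arity d B p ->
     isc Z d (v p i) /\ parallel Z d (v p i) (f p)) ->
  (forall p i, pvalid (bdry d B) p = true -> pdim p = d -> i < arity d B p ->
     isc Z (S d) (e p i) /\ gsrc Z (e p i) = v p i /\ gtgt Z (e p i) = v p (S i)) ->
  rawmap B Z (glue d f v e).
Proof.
  intros HB Hf Hv He. apply rawmap_intro.
  - intros q Hq.
    destruct (position_cases d B q Hq HB)
      as [H|[(p & j & Hp & E & Hj & ->)|(p & j & Hp & E & Hj & ->)]].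
    + rewrite glue_low by exact H. eapply rawmap_isc; eauto. rewrite pvalid_bdry_low; auto.
    + erewrite glue_vtx, pdim_vtx by eauto. apply Hv; auto.
    + erewrite glue_edge, pdim_edge by eauto. apply He; auto.
  - intros q k Hq Ek.
    destruct (position_cases d B q Hq HB)
      as [H|[(p & j & Hp & E & Hj & ->)|(p & j & Hp & E & Hj & ->)]].
    + rewrite !glue_low by (try rewrite (pdim_psrc _ _ Ek); try rewrite (pdim_ptgt _ _ Ek); lia).
      rewrite <- (pvalid_bdry_low d) in Hq by exact H.
      split; [eapply rawmap_src|eapply rawmap_tgt]; eauto.
    + rewrite pdim_vtx in Ek by exact E. subst d. rename E into Ek.
      erewrite glue_vtx by eauto.
      rewrite psrc_vtx, ptgt_vtx by exact Ek.
      rewrite !glue_low by (try rewrite (pdim_psrc _ _ Ek); try rewrite (pdim_ptgt _ _ Ek); lia).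
      destruct (Hv p j Hp Ek Hj) as [_ Hpar]. destruct Hpar as [-> ->]; [lia|].
      split; [eapply rawmap_src|eapply rawmap_tgt]; eauto.
    + rewrite psrc_edge, ptgt_edge by exact E.
      erewrite glue_edge, !glue_vtx by eauto. apply He; auto.
Qed.

Lemma rawmap_pvar B : rawmap B (TGS (PosG B)) (pvar B).
Proof. apply (rawmap_mkpos B (TGS (PosG B)) var), gmap_var. Qed.

(** * Spheres and canonical terms *)

(* [occurs] in the form of a recursive function, which avoids inverting its dependent indices. *)
Definition occurs_rec {G : Type} (g : G) : tm G -> Prop :=
  fix occ t := match t with
  | var y => y = g
  | coh0 B s => exists p, occ (s p)
  | coh B u v s => exists p, occ (s p)
  end.

Lemma occurs_iff {G : Type} (g : G) t : occurs g t <-> occurs_rec g t.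
Proof.
  split.
  - induction 1; simpl; eauto.
  - induction t as [y|B s IH|B u v s]; simpl.
    + intros ->; constructor.
    + intros [p Hp]; eapply occ_coh0; eauto.
    + intros [p Hp]; eapply occ_coh; eauto.
Qed.

Lemma occurs_dim Y n t y : tvalid Y n t -> occurs y t -> exists k, k <= n /\ isc Y k y.
Proof.
  intros Ht Ho; apply occurs_iff in Ho. revert n t Ht Ho; refine (tvalid_fixed_ind Y _ _ _ _).
  - intros n z Hz Ho. simpl in Ho; subst. eauto.
  - intros B s HB Hs IH [p Hp]. destruct (IH p Hp) as (k & Hk & ?).
    exists k; split; auto. pose proof (pdim_le_tdim B _ (proj2_sig p)). lia.
  - intros n B u v s HB Huv Hs IH [p Hp]. destruct (IH p Hp) as (k & Hk & ?).
    exists k; split; auto. pose proof (pdim_le_tdim B _ (proj2_sig p)). lia.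
Qed.

Lemma rawmap_ext B Z f g :
  (forall p, pvalid B p = true -> f p = g p) -> rawmap B Z f -> rawmap B Z g.
Proof.
  intros E H. unfold rawmap.
  replace (fun p : PosT B => g (proj1_sig p)) with (fun p : PosT B => f (proj1_sig p)); auto.
  apply functional_extensionality. intros [p Hp]; simpl; auto.
Qed.

Lemma pvalid_vtx_le d B p j :
  pvalid (bdry d B) p = true -> (pdim p = d -> j <= arity d B p) -> pvalid B (vtx d j p) = true.
Proof.
  intros H Hj. destruct (Nat.eq_dec (pdim p) d) as [E|E].
  - apply pvalid_vtx; auto.
  - apply pdim_bdry in H as H'. rewrite vtx_low by lia.
    rewrite <- (pvalid_bdry_low d) by lia. exact H.
Qed.

(** The copy of [P] at height [j]: d-cells go to the j-th vertices of their strings, lower cells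
    stay. [P] is a free parameter because it is in general only provably equal to [bdry d B]. *)
Definition incl_at (d : nat) (B : tree) (j : nat) {P : tree} (p : PosT P) : PosT B :=
  mkpos B (vtx d j (proj1_sig p)).

(** The height may vary with the position: 0 gives the cosource, the arity the cotarget, and
    constants the maps [incl_at]. *)
Lemma rawmap_vtx d B (j : pos -> nat) :
  (forall p, pvalid (bdry d B) p = true -> pdim p = d -> j p <= arity d B p) ->
  rawmap (bdry d B) (PosG B) (fun p => mkpos B (vtx d (j p) p)).
Proof.
  intros Hj. apply rawmap_intro; simpl.
  - intros p Hp. rewrite mkpos_val by (apply pvalid_vtx_le; auto).
    apply pdim_bdry in Hp as Hd.
    destruct (Nat.eq_dec (pdim p) d) as [E|E].
    + rewrite pdim_vtx; auto.
    + rewrite vtx_low; auto; lia.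
  - intros p k Hp E. apply pdim_bdry in Hp as Hd.
    pose proof (pdim_psrc _ _ E) as Es. pose proof (pdim_ptgt _ _ E) as Et.
    apply psrc_valid in Hp as Hps. apply ptgt_valid in Hp as Hpt.
    split; apply PosT_eq; simpl; rewrite !mkpos_val by (apply pvalid_vtx_le; auto; lia);
      rewrite (vtx_low d _ (psrc p)) || rewrite (vtx_low d _ (ptgt p)); try lia;
      (destruct (Nat.eq_dec (pdim p) d) as [<-|E']; [rewrite E; auto using psrc_vtx, ptgt_vtx|
        rewrite vtx_low by lia; reflexivity]).
Qed.

Definition full_sphere (B : tree) (n : nat) (u v : tm (PosT B)) : Prop :=
  exists a b : tm (PosT (bdry n B)),
    tvalid (PosG (bdry n B)) n a /\ tvalid (PosG (bdry n B)) n b /\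
    parallel (TGS (PosG (bdry n B))) n a b /\
    covers (bdry n B) n a /\ covers (bdry n B) n b /\
    u = Tmap (cosT n B) a /\ v = Tmap (cotT n B) b.

Lemma gmap_cosT d B : gmap (PosG (bdry d B)) (PosG B) (cosT d B).
Proof.
  assert (H : rawmap (bdry d B) (PosG B) (fun p => mkpos B (vtx d 0 p)))
    by (apply (rawmap_vtx d B (fun _ => 0)); lia).
  unfold rawmap in H. replace (cosT d B) with (fun p : PosT (bdry d B) =>
    mkpos B (vtx d 0 (proj1_sig p))); auto.
  apply functional_extensionality; intros [p Hp]. apply PosT_eq; simpl.
  rewrite cos_vtx. apply mkpos_val, pvalid_vtx_le; auto; lia.
Qed.

Lemma gmap_cotT d B : gmap (PosG (bdry d B)) (PosG B) (cotT d B).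
Proof.
  assert (H : rawmap (bdry d B) (PosG B) (fun p => mkpos B (vtx d (arity d B p) p)))
    by (apply (rawmap_vtx d B (arity d B)); auto).
  unfold rawmap in H. replace (cotT d B) with (fun p : PosT (bdry d B) =>
    mkpos B (vtx d (arity d B (proj1_sig p)) (proj1_sig p))); auto.
  apply functional_extensionality; intros [p Hp]. apply PosT_eq; simpl.
  rewrite cot_vtx. apply mkpos_val, pvalid_vtx_le; auto.
Qed.

(** By [occurs_dim], only positions below dimension [d] occur in [t], and there cosource and
    cotarget agree. *)
Lemma Tmap_cosT_cotT d B k t : tvalid (PosG (bdry d B)) k t -> k < d ->
  Tmap (cosT d B) t = Tmap (cotT d B) t.
Proof.
  intros Ht Hk. apply Tmap_ext_occurs. intros [p Hp] Ho. apply PosT_eq; simpl.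
  destruct (occurs_dim _ _ _ _ Ht Ho) as (i & Hi & E). simpl in E.
  rewrite cos_vtx, cot_vtx, !vtx_low by lia. reflexivity.
Qed.

Lemma tvalid_Tmap P Q (h : PosT P -> PosT Q) n t : gmap (PosG P) (PosG Q) h ->
  tvalid (PosG P) n t -> tvalid (PosG Q) n (Tmap h t).
Proof. intros Hh. exact (gm_isc _ _ _ (gmap_Tmap _ _ _ Hh) n t). Qed.

Lemma tsrc_Tmap P Q (h : PosT P -> PosT Q) n t : gmap (PosG P) (PosG Q) h ->
  tvalid (PosG P) (S n) t -> tsrc (PosG Q) (Tmap h t) = Tmap h (tsrc (PosG P) t).
Proof. intros Hh. exact (gm_src _ _ _ (gmap_Tmap _ _ _ Hh) n t). Qed.

Lemma ttgt_Tmap P Q (h : PosT P -> PosT Q) n t : gmap (PosG P) (PosG Q) h ->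
  tvalid (PosG P) (S n) t -> ttgt (PosG Q) (Tmap h t) = Tmap h (ttgt (PosG P) t).
Proof. intros Hh. exact (gm_tgt _ _ _ (gmap_Tmap _ _ _ Hh) n t). Qed.

Lemma full_sphere_admissible B n u v : full_sphere B n u v -> admissible B n u v.
Proof.
  intros (a & b & Ha & Hb & Hp & Ca & Cb & -> & ->).
  pose proof (gmap_cosT n B) as Hs. pose proof (gmap_cotT n B) as Ht.
  split; [exact (tvalid_Tmap _ _ _ n a Hs Ha)|split; [exact (tvalid_Tmap _ _ _ n b Ht Hb)|split]].
  - intros Hn. destruct n as [|n]; [lia|]. destruct (Hp Hn) as [E1 E2].
    cbn [gsrc gtgt TGS] in *.
    pose proof (globular_TGS _ (globular_PosG (bdry (S n) B))) as HT.
    rewrite (tsrc_Tmap _ _ _ n a Hs Ha), (tsrc_Tmap _ _ _ n b Ht Hb).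
    rewrite (ttgt_Tmap _ _ _ n a Hs Ha), (ttgt_Tmap _ _ _ n b Ht Hb). rewrite E1, E2.
    pose proof (gl_src _ HT n b Hb) as H1. pose proof (gl_tgt _ HT n b Hb) as H2.
    (* The common faces of [a] and [b] have dimension [n], one less than the boundary, so both
       inclusions send them to the same term. *)
    split; apply (Tmap_cosT_cotT _ _ n); auto.
  - exists a, b; auto 8.
Qed.

(** The equation [bdry n B = P] is a hypothesis and the inclusions are given by their raw values,
    which avoids transporting terms along an equality of trees. *)
Lemma full_sphere_intro B n P (a b : tm (PosT P)) (h0 h1 : PosT P -> PosT B) :
  bdry n B = P ->
  tvalid (PosG P) n a -> tvalid (PosG P) n b -> parallel (TGS (PosG P)) n a b ->
  covers P n a -> covers P n b ->
  (forall p, proj1_sig (h0 p) = vtx n 0 (proj1_sig p)) ->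
  (forall p, proj1_sig (h1 p) = vtx n (arity n B (proj1_sig p)) (proj1_sig p)) ->
  full_sphere B n (Tmap h0 a) (Tmap h1 b).
Proof.
  intros <- Ha Hb Hp Ca Cb H0 H1. exists a, b. do 5 (split; [assumption|]).
  split; f_equal; apply functional_extensionality; intros p; apply PosT_eq; simpl.
  - rewrite H0, cos_vtx; reflexivity.
  - rewrite H1, cot_vtx; reflexivity.
Qed.

(** Without cells above dimension [n], the strings over n-cells have length 0 and a single
    vertex. *)
Lemma vtx_id n B p j : tdim B <= n -> pvalid B p = true -> j <= arity n B p -> vtx n j p = p.
Proof.
  intros HB Hp Hj. rewrite <- (bdry_id n B HB) in Hp.
  apply pdim_bdry in Hp as Hd. destruct (Nat.eq_dec (pdim p) n) as [E|E].
  - assert (arity n B p = 0).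
    { destruct (Nat.eq_dec (arity n B p) 0) as [|Hc]; auto. exfalso.
      assert (Hv : pvalid B (edge n 0 p) = true) by (apply pvalid_edge; auto; lia).
      apply pdim_le_tdim in Hv. rewrite pdim_edge in Hv; lia. }
    replace j with 0 by lia. eapply vtx0_bdry; eauto.
  - apply vtx_low; lia.
Qed.

(** The n-boundary is [B] itself and both inclusions are identities, so fullness reduces to
    covering. *)
Lemma full_sphere_id B n u v : tdim B <= n ->
  tvalid (PosG B) n u -> tvalid (PosG B) n v -> parallel (TGS (PosG B)) n u v ->
  covers B n u -> covers B n v -> full_sphere B n u v.
Proof.
  intros HB Hu Hv Hp Cu Cv. rewrite <- (Tmap_id u), <- (Tmap_id v).
  apply (full_sphere_intro B n B); auto using bdry_id.
  - intros [p Hpv]; simpl. rewrite (vtx_id n B); auto; lia.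
  - intros [p Hpv]; simpl. rewrite (vtx_id n B); auto.
Qed.

Lemma bdry_sprout_id d m P : tdim P <= d -> bdry d (sprout d m P) = P.
Proof. intros H. rewrite bdry_sprout. apply bdry_id, H. Qed.

Lemma pvalid_sprout_vtx d m P p j : tdim P <= d -> pvalid P p = true -> j <= m ->
  pvalid (sprout d m P) (vtx d j p) = true.
Proof.
  intros HP Hp Hj. rewrite <- (bdry_id d P HP) in Hp.
  apply pvalid_vtx_le; [rewrite bdry_sprout; exact Hp|].
  intros E. rewrite arity_sprout; auto.
Qed.

Lemma pvalid_sprout_edge d m P p j : tdim P <= d -> pvalid P p = true -> pdim p = d -> j < m ->
  pvalid (sprout d m P) (edge d j p) = true.
Proof.
  intros HP Hp E Hj. rewrite <- (bdry_id d P HP) in Hp.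
  apply pvalid_edge; auto; [rewrite bdry_sprout; exact Hp|].
  rewrite arity_sprout; auto.
Qed.

Lemma incl_at_val d m P j (p : PosT P) : tdim P <= d -> j <= m ->
  proj1_sig (incl_at d (sprout d m P) j p) = vtx d j (proj1_sig p).
Proof. intros HP Hj. apply mkpos_val, pvalid_sprout_vtx; auto. apply proj2_sig. Qed.

Lemma gmap_incl_at d m P j : tdim P <= d -> j <= m ->
  gmap (PosG P) (PosG (sprout d m P)) (incl_at d (sprout d m P) j).
Proof.
  intros HP Hj. pose proof (rawmap_vtx d (sprout d m P) (fun _ => j)) as H.
  rewrite bdry_sprout_id in H by exact HP. apply H. intros p Hp E.
  rewrite arity_sprout; auto. rewrite bdry_id; auto.
Qed.

Lemma full_sphere_sprout d m P a b : tdim P <= d ->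
  tvalid (PosG P) d a -> tvalid (PosG P) d b -> parallel (TGS (PosG P)) d a b ->
  covers P d a -> covers P d b ->
  full_sphere (sprout d m P) d (Tmap (incl_at d (sprout d m P) 0) a) (Tmap (incl_at d (sprout d m
    P) m) b).
Proof.
  intros HP Ha Hb Hp Ca Cb. apply (full_sphere_intro _ _ P); auto using bdry_sprout_id.
  - intros p. apply incl_at_val; auto; lia.
  - intros [p Hpv]. rewrite incl_at_val by auto; simpl. rewrite <- (bdry_id d P HP) in Hpv.
    apply pdim_bdry in Hpv as Hd. destruct (Nat.eq_dec (pdim p) d) as [E|E].
    + rewrite arity_sprout; auto.
    + rewrite !vtx_low by lia. reflexivity.
Qed.

Lemma covers_src P n t : covers P n (tsrc (PosG P) t) -> covers P (S n) t.
Proof. intros H p. right; left. apply H. Qed.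

Lemma covers_occurs P n t : (forall p, occurs p t) -> covers P n t.
Proof. intros H p. destruct n; left; apply H. Qed.

Lemma tvalid_pvar B p n : pvalid B p = true -> pdim p = n -> tvalid (PosG B) n (pvar B p).
Proof. intros Hp E. apply tv_var. simpl. rewrite mkpos_val; auto. Qed.

Lemma tsrc_pvar B p : pvalid B p = true -> tsrc (PosG B) (pvar B p) = pvar B (psrc p).
Proof.
  intros Hp. unfold pvar; simpl. f_equal. apply PosT_eq; simpl.
  rewrite !mkpos_val; auto using psrc_valid.
Qed.

Lemma ttgt_pvar B p : pvalid B p = true -> ttgt (PosG B) (pvar B p) = pvar B (ptgt p).
Proof.
  intros Hp. unfold pvar; simpl. f_equal. apply PosT_eq; simpl.
  rewrite !mkpos_val; auto using ptgt_valid.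
Qed.

Lemma lastv_psrc p k : pdim p = S k -> lastv (psrc p) = brn p.
Proof.
  revert k; induction p as [|i q IH]; intros k H; [discriminate|]. simpl in H.
  destruct q as [j|i' q']; [reflexivity|].
  rewrite psrc_pin by (simpl; lia). simpl in H. destruct k; [discriminate|].
  apply (IH k). simpl; lia.
Qed.

Lemma lastv_ptgt p k : pdim p = S k -> lastv (ptgt p) = S (brn p).
Proof.
  revert k; induction p as [|i q IH]; intros k H; [discriminate|]. simpl in H.
  destruct q as [j|i' q']; [reflexivity|].
  rewrite ptgt_pin by (simpl; lia). simpl in H. destruct k; [discriminate|].
  apply (IH k). simpl; lia.
Qed.

Lemma brn_Dtree n p : pvalid (Dtree n) p = true -> brn p = 0.
Proof.
  revert n; induction p as [j|i q IH]; intros n H; [reflexivity|].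
  destruct n as [|n]; apply pvalid_pin in H as [H1 H2]; simpl in H1; [lia|].
  assert (i = 0) as -> by lia. simpl in H2. specialize (IH n H2).
  destruct q; auto.
Qed.

Lemma Dtree_faces n p q k : pvalid (Dtree n) p = true -> pvalid (Dtree n) q = true ->
  pdim q = S k -> pdim p = k -> p = psrc q \/ p = ptgt q.
Proof.
  revert n q k; induction p as [j|i p IH]; intros n [j'|i' q] k Hp Hq Eq Ep;
    try discriminate; destruct n as [|n]; apply pvalid_pin in Hq as [H1 H2];
    simpl in H1, Eq, Ep; try lia; assert (i' = 0) as -> by lia.
  - apply Nat.leb_le in Hp. simpl in Hp. destruct q; [|simpl in Eq; lia].
    destruct j as [|[|]]; auto; lia.
  - apply pvalid_pin in Hp as [H3 H4]. simpl in H3, H2, H4. assert (i = 0) as -> by lia.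
    destruct k; [discriminate|].
    rewrite psrc_pin, ptgt_pin by lia.
    destruct (IH n q k) as [->| ->]; auto; lia.
Qed.

(** Generalizes from the top cell to any [q] for the induction. In its own dimension [q] supports
    only itself, whence the last hypothesis; one dimension below, all cells of the disc are faces of
    [q]. *)
Lemma insupp_Dtree n k p q : pvalid (Dtree n) p = true -> pvalid (Dtree n) q = true ->
  pdim q = k -> pdim p <= k -> (pdim p = k -> p = q) ->
  insupp (PosG (Dtree n)) k (pvar (Dtree n) q) (mkpos (Dtree n) p).
Proof.
  revert q; induction k as [|k IH]; intros q Hp Hq Eq Hle Hpq.
  - left. rewrite Hpq by lia. constructor.
  - destruct (Nat.eq_dec (pdim p) (S k)) as [E|E].
    { left. rewrite Hpq by auto. constructor. }
    right. rewrite tsrc_pvar, ttgt_pvar by exact Hq.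
    pose proof (pdim_psrc _ _ Eq). pose proof (pdim_ptgt _ _ Eq).
    destruct (Nat.eq_dec (pdim p) k) as [E'|E'].
    + destruct (Dtree_faces n p q k) as [->| ->]; auto; [left|right]; apply IH;
        auto using psrc_valid, ptgt_valid; lia.
    + left. apply IH; auto using psrc_valid; lia.
Qed.

Lemma covers_top n : covers (Dtree n) n (pvar (Dtree n) (topD n)).
Proof.
  intros p. rewrite <- (mkpos_proj _ p). pose proof (proj2_sig p) as Hp. simpl in Hp.
  apply insupp_Dtree; auto using topD_valid, pdim_topD.
  - apply pdim_le_tdim in Hp. rewrite tdim_Dtree in Hp. exact Hp.
  - intros E. apply Dtree_top; auto.
Qed.

Lemma topD_ok n : pvalid (Dtree n) (topD n) = true /\ pdim (topD n) = n.
Proof. split; [apply topD_valid|apply pdim_topD]. Qed.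

Lemma pvar_topDT n : var (topDT n) = pvar (Dtree n) (topD n).
Proof. unfold pvar. f_equal. apply PosT_eq. rewrite mkpos_val; auto using topD_valid. Qed.

Lemma full_sphere_Dtree n : full_sphere (Dtree n) n (pvar (Dtree n) (topD n)) (pvar (Dtree n)
  (topD n)).
Proof.
  apply full_sphere_id; auto using covers_top, tvalid_pvar, topD_valid, pdim_topD.
  - rewrite tdim_Dtree; auto.
  - intros _; auto.
Qed.

Lemma csrc_vtx n : csrc n = vtx n 0 (topD n).
Proof. induction n; simpl; congruence. Qed.

Lemma ctgt_vtx n : ctgt n = vtx n 2 (topD n).
Proof. induction n; simpl; congruence. Qed.

Lemma pvar_csrcT n : var (csrcT n) = pvar (Ctree n) (vtx n 0 (topD n)).
Proof.
  unfold pvar. f_equal. apply PosT_eq. rewrite <- csrc_vtx, mkpos_val; auto using csrc_valid.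
Qed.

Lemma pvar_ctgtT n : var (ctgtT n) = pvar (Ctree n) (vtx n 2 (topD n)).
Proof.
  unfold pvar. f_equal. apply PosT_eq. rewrite <- ctgt_vtx, mkpos_val; auto using ctgt_valid.
Qed.

Lemma full_sphere_Ctree n :
  full_sphere (Ctree n) n (pvar (Ctree n) (vtx n 0 (topD n))) (pvar (Ctree n) (vtx n 2 (topD n))).
Proof.
  rewrite <- sprout_Dtree.
  assert (E : forall j, pvar (sprout n 2 (Dtree n)) (vtx n j (topD n)) =
    Tmap (incl_at n (sprout n 2 (Dtree n)) j) (pvar (Dtree n) (topD n))).
  { intros j. unfold pvar, incl_at; simpl. rewrite (mkpos_val (Dtree n)); auto using topD_valid. }
  rewrite !E. apply full_sphere_sprout; auto using covers_top, tvalid_pvar, topD_valid, pdim_topD.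
  - rewrite tdim_Dtree; auto.
  - intros _; auto.
Qed.

(** * Classifying maps of discs and composable pairs; identity and composition terms *)

Section Iterates.
Context (Z : GS) (HZ : globular Z).

Lemma isc_iter_src n m x : isc Z n x -> m <= n -> isc Z (n - m) (Nat.iter m (gsrc Z) x).
Proof.
  intros Hx; induction m as [|m IH]; intros Hm; simpl.
  - rewrite Nat.sub_0_r; exact Hx.
  - apply (gl_src _ HZ). replace (S (n - S m)) with (n - m) by lia. apply IH; lia.
Qed.

Lemma isc_iter_tgt n m x : isc Z n x -> m <= n -> isc Z (n - m) (Nat.iter m (gtgt Z) x).
Proof.
  intros Hx; induction m as [|m IH]; intros Hm; simpl.
  - rewrite Nat.sub_0_r; exact Hx.
  - apply (gl_tgt _ HZ). replace (S (n - S m)) with (n - m) by lia. apply IH; lia.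
Qed.

Lemma src_iter_tgt n m x : isc Z n x -> m < n ->
  gsrc Z (Nat.iter m (gtgt Z) x) = Nat.iter (S m) (gsrc Z) x.
Proof.
  intros Hx; induction m as [|m IH]; intros Hm; [reflexivity|].
  simpl Nat.iter at 1. rewrite <- (gl_ss _ HZ (n - m - 2)).
  - rewrite IH by lia. reflexivity.
  - replace (S (S (n - m - 2))) with (n - m) by lia. apply isc_iter_tgt; auto; lia.
Qed.

Lemma tgt_iter_src n m x : isc Z n x -> m < n ->
  gtgt Z (Nat.iter m (gsrc Z) x) = Nat.iter (S m) (gtgt Z) x.
Proof.
  intros Hx; induction m as [|m IH]; intros Hm; [reflexivity|].
  simpl Nat.iter at 1. rewrite (gl_tt _ HZ (n - m - 2)).
  - rewrite IH by lia. reflexivity.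
  - replace (S (S (n - m - 2))) with (n - m) by lia. apply isc_iter_src; auto; lia.
Qed.

Lemma gmap_iter_src Z' h n m x : gmap Z Z' h -> isc Z n x -> m <= n ->
  h (Nat.iter m (gsrc Z) x) = Nat.iter m (gsrc Z') (h x).
Proof.
  intros Hh Hx; induction m as [|m IH]; intros Hm; simpl; [reflexivity|].
  rewrite <- IH by lia. symmetry. apply (gm_src _ _ _ Hh (n - S m)).
  replace (S (n - S m)) with (n - m) by lia. apply isc_iter_src; auto; lia.
Qed.

Lemma gmap_iter_tgt Z' h n m x : gmap Z Z' h -> isc Z n x -> m <= n ->
  h (Nat.iter m (gtgt Z) x) = Nat.iter m (gtgt Z') (h x).
Proof.
  intros Hh Hx; induction m as [|m IH]; intros Hm; simpl; [reflexivity|].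
  rewrite <- IH by lia. symmetry. apply (gm_tgt _ _ _ Hh (n - S m)).
  replace (S (n - S m)) with (n - m) by lia. apply isc_iter_tgt; auto; lia.
Qed.

End Iterates.

(* [dispX] and [cmapX] in an arbitrary globular set and on raw positions. *)
Definition disp (Z : GS) (n : nat) (x : cell Z) (p : pos) : cell Z :=
  let k := pdim p in
  if k =? n then x
  else if lastv p =? 0 then Nat.iter (n - k) (gsrc Z) x
  else Nat.iter (n - k) (gtgt Z) x.

Lemma rawmap_disp Z n x : globular Z -> isc Z n x -> rawmap (Dtree n) Z (disp Z n x).
Proof.
  intros HZ Hx. apply rawmap_intro.
  - intros p Hp. apply pdim_le_tdim in Hp as Hd. rewrite tdim_Dtree in Hd. unfold disp.
    destruct (Nat.eqb_spec (pdim p) n) as [->|E]; [exact Hx|].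
    assert (Ep : n - (n - pdim p) = pdim p) by lia. rewrite <- Ep at 1.
    destruct (lastv p =? 0); [apply isc_iter_src|apply isc_iter_tgt]; auto; lia.
  - intros p k Hp E. apply pdim_le_tdim in Hp as Hd. rewrite tdim_Dtree in Hd.
    (* In a disc every [brn] is 0, so sources end in vertex 0 and targets in vertex 1: the test on
       [lastv] tells them apart. *)
    unfold disp. rewrite (lastv_psrc _ _ E), (lastv_ptgt _ _ E), (brn_Dtree _ _ Hp).
    rewrite (pdim_psrc _ _ E), (pdim_ptgt _ _ E), E.
    change (0 =? 0) with true. change (1 =? 0) with false. cbv iota.
    replace (k =? n) with false by (symmetry; apply Nat.eqb_neq; lia).
    replace (n - k) with (S (n - S k)) by lia.
    destruct (Nat.eqb_spec (S k) n) as [<-|E'].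
    + rewrite Nat.sub_diag, ?Nat.eqb_refl. split; reflexivity.
    + destruct (lastv p =? 0).
      * split; [reflexivity|]. apply (tgt_iter_src _ HZ n); auto; lia.
      * split; [|reflexivity]. apply (src_iter_tgt _ HZ n); auto; lia.
Qed.

Lemma disp_map Z Z' h n x p : globular Z -> gmap Z Z' h -> isc Z n x ->
  h (disp Z n x p) = disp Z' n (h x) p.
Proof.
  intros HZ Hh Hx. unfold disp. destruct (pdim p =? n); [reflexivity|].
  destruct (lastv p =? 0).
  - apply (gmap_iter_src Z HZ Z' h n); auto; lia.
  - apply (gmap_iter_tgt Z HZ Z' h n); auto; lia.
Qed.

Lemma disp_top Z n x p : pdim p = n -> disp Z n x p = x.
Proof. intros <-. unfold disp. rewrite Nat.eqb_refl. reflexivity. Qed.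

Definition pairing (Z : GS) (n : nat) (x y : cell Z) (p : pos) : cell Z :=
  let k := pdim p in
  if k =? S n then (if brn p =? 0 then x else y)
  else if k =? n then
    (match lastv p with 0 => gsrc Z x | 1 => gtgt Z x | _ => gtgt Z y end)
  else if lastv p =? 0 then Nat.iter (S n - k) (gsrc Z) x
  else Nat.iter (S n - k) (gtgt Z) x.

(** The string lies over the single top cell of the disc; the position argument gives the family the
    shape that [glue] takes. *)
Definition cvert (Z : GS) (x y : cell Z) (_ : pos) (i : nat) : cell Z :=
  match i with 0 => gsrc Z x | 1 => gtgt Z x | _ => gtgt Z y end.
Definition cedge (Z : GS) (x y : cell Z) (_ : pos) (i : nat) : cell Z :=
  if i =? 0 then x else y.

(** Makes [rawmap_glue] applicable to composable pairs. Below dimension [n], globularity identifies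
    the iterated targets of [x] with those of its source. *)
Lemma pairing_glue Z n x y p : globular Z -> isc Z (S n) x -> pdim p <= S n ->
  pairing Z n x y p = glue n (disp Z n (gsrc Z x)) (cvert Z x y) (cedge Z x y) p.
Proof.
  intros HZ Hx Hp. unfold pairing, glue, disp.
  destruct (Nat.ltb_spec (pdim p) n) as [H|H].
  - replace (pdim p =? S n) with false by (symmetry; apply Nat.eqb_neq; lia).
    replace (pdim p =? n) with false by (symmetry; apply Nat.eqb_neq; lia).
    replace (S n - pdim p) with (S (n - pdim p)) by lia.
    destruct (lastv p =? 0); [apply Nat.iter_succ_r|].
    replace (n - pdim p) with (S (n - pdim p - 1)) by lia.
    rewrite !(Nat.iter_succ_r _ _ (S _)) || rewrite Nat.iter_succ_r.
    rewrite !Nat.iter_succ_r. f_equal. symmetry.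
    destruct n as [|n]; [lia|]. apply (gl_tt _ HZ n). exact Hx.
  - destruct (Nat.eqb_spec (pdim p) n) as [E|E].
    + rewrite E. replace (n =? S n) with false by (symmetry; apply Nat.eqb_neq; lia).
      reflexivity.
    + replace (pdim p) with (S n) by lia. rewrite Nat.eqb_refl. reflexivity.
Qed.

Lemma rawmap_cmap Z n x y : globular Z -> isc Z (S n) x -> isc Z (S n) y ->
  gtgt Z x = gsrc Z y -> rawmap (Ctree n) Z (pairing Z n x y).
Proof.
  intros HZ Hx Hy E.
  apply (rawmap_ext _ _ (glue n (disp Z n (gsrc Z x)) (cvert Z x y) (cedge Z x y))).
  { intros p Hp. symmetry. apply pairing_glue; auto.
    apply pdim_le_tdim in Hp. rewrite tdim_Ctree in Hp. exact Hp. }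
  rewrite <- sprout_Dtree.
  assert (HD : tdim (Dtree n) <= n) by (rewrite tdim_Dtree; auto).
  assert (Px : parallel Z n (gtgt Z x) (gsrc Z x)).
  { intros Hn. destruct (globular_parallel Z n x HZ Hx Hn); auto. }
  assert (Py : parallel Z n (gtgt Z y) (gsrc Z y)).
  { intros Hn. destruct (globular_parallel Z n y HZ Hy Hn); auto. }
  apply rawmap_glue.
  - apply tdim_sprout_le.
  - rewrite bdry_sprout_id by exact HD. apply rawmap_disp; auto. apply (gl_src _ HZ); exact Hx.
  - intros p i Hp Ep Hi. rewrite (disp_top _ n) by exact Ep.
    destruct i as [|[|i]]; simpl; split;
      try (apply (gl_src _ HZ); assumption); try (apply (gl_tgt _ HZ); assumption); auto.
    + intros _; auto.
    + intros Hn. destruct (Py Hn) as [-> ->]. rewrite <- E. apply Px, Hn.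
  - intros p i Hp Ep Hi. rewrite bdry_sprout in Hp. rewrite arity_sprout in Hi by auto.
    destruct i as [|[|i]]; [| |lia]; unfold cedge, cvert; simpl; auto.
Qed.

Lemma pairing_map Z Z' h n x y p : globular Z -> gmap Z Z' h ->
  isc Z (S n) x -> isc Z (S n) y ->
  h (pairing Z n x y p) = pairing Z' n (h x) (h y) p.
Proof.
  intros HZ Hh Hx Hy. unfold pairing. destruct (pdim p =? S n).
  { destruct (brn p =? 0); reflexivity. }
  destruct (pdim p =? n).
  - destruct (lastv p) as [|[|]]; symmetry;
      [apply (gm_src _ _ _ Hh n)|apply (gm_tgt _ _ _ Hh n)|apply (gm_tgt _ _ _ Hh n)]; auto.
  - destruct (lastv p =? 0).
    + apply (gmap_iter_src Z HZ Z' h (S n)); auto; lia.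
    + apply (gmap_iter_tgt Z HZ Z' h (S n)); auto; lia.
Qed.

(** Identity and, in [compT], composition on the level of terms, so that coherence can compare
    expressions built from them before evaluation. *)
Definition idT (Y : GS) (n : nat) (t : tm (cell Y)) : tm (cell Y) :=
  coh (Dtree n) (pvar (Dtree n) (topD n)) (pvar (Dtree n) (topD n))
    (fun p => disp (TGS Y) n t (proj1_sig p)).

Definition compT (Y : GS) (n : nat) (x y : tm (cell Y)) : tm (cell Y) :=
  coh (Ctree n) (pvar (Ctree n) (vtx n 0 (topD n))) (pvar (Ctree n) (vtx n 2 (topD n)))
    (fun p => pairing (TGS Y) n x y (proj1_sig p)).

Lemma tvalid_idT Y n t : globular Y -> tvalid Y n t -> tvalid Y (S n) (idT Y n t).
Proof.
  intros HY Ht. apply tvalid_coh; [rewrite tdim_Dtree; auto|apply full_sphere_admissible,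
    full_sphere_Dtree|].
  apply rawmap_disp; [apply globular_TGS, HY|exact Ht].
Qed.

Lemma tsrc_idT Y n t : tsrc Y (idT Y n t) = t.
Proof.
  simpl. rewrite mkpos_val by apply topD_valid. apply (disp_top (TGS Y)), pdim_topD.
Qed.

Lemma ttgt_idT Y n t : ttgt Y (idT Y n t) = t.
Proof. exact (tsrc_idT Y n t). Qed.

Lemma pvalid_Ctree_vtx n i : i <= 2 -> pvalid (Ctree n) (vtx n i (topD n)) = true.
Proof.
  intros H. rewrite <- sprout_Dtree. apply pvalid_sprout_vtx; auto using topD_valid.
  rewrite tdim_Dtree; auto.
Qed.

Lemma pvalid_Ctree_edge n i : i < 2 -> pvalid (Ctree n) (edge n i (topD n)) = true.
Proof.
  intros H. rewrite <- sprout_Dtree. apply pvalid_sprout_edge; auto using topD_valid, pdim_topD.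
  rewrite tdim_Dtree; auto.
Qed.

Lemma pairing_vtx Z n x y i : pairing Z n x y (vtx n i (topD n)) = cvert Z x y (pv 0) i.
Proof.
  unfold pairing. rewrite pdim_vtx, lastv_vtx by apply pdim_topD. rewrite Nat.eqb_refl.
  replace (n =? S n) with false by (symmetry; apply Nat.eqb_neq; lia). reflexivity.
Qed.

Lemma pairing_edge Z n x y i : pairing Z n x y (edge n i (topD n)) = cedge Z x y (pv 0) i.
Proof.
  unfold pairing. rewrite pdim_edge, brn_edge by apply pdim_topD. rewrite Nat.eqb_refl.
  reflexivity.
Qed.

Lemma tvalid_compT Y n x y : globular Y -> tvalid Y (S n) x -> tvalid Y (S n) y ->
  ttgt Y x = tsrc Y y -> tvalid Y (S n) (compT Y n x y).
Proof.
  intros HY Hx Hy E. apply tvalid_coh; [rewrite tdim_Ctree; auto|apply full_sphere_admissible,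
    full_sphere_Ctree|].
  apply (rawmap_cmap (TGS Y)); auto. apply globular_TGS, HY.
Qed.

Lemma tsrc_compT Y n x y : tsrc Y (compT Y n x y) = tsrc Y x.
Proof.
  simpl. rewrite mkpos_val by (apply pvalid_Ctree_vtx; lia). apply (pairing_vtx (TGS Y)).
Qed.

Lemma ttgt_compT Y n x y : ttgt Y (compT Y n x y) = ttgt Y y.
Proof.
  simpl. rewrite mkpos_val by (apply pvalid_Ctree_vtx; lia). apply (pairing_vtx (TGS Y)).
Qed.

(** The arguments of a composite range over all positions of its tree. Thus the endpoints of [x] and
    [y] occur too, which is how vertices of strings get covered. *)
Lemma occurs_compT Y n x y g :
  occurs g x \/ occurs g y \/ occurs g (tsrc Y x) \/ occurs g (ttgt Y x) \/ occurs g (ttgt Y y) ->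
  occurs g (compT Y n x y).
Proof.
  assert (Hv : forall i, i <= 2 -> occurs g (cvert (TGS Y) x y (pv 0) i) ->
    occurs g (compT Y n x y)).
  { intros i Hi H. apply (occ_coh _ _ _ _ _ (mkpos (Ctree n) (vtx n i (topD n)))).
    rewrite mkpos_val by (apply pvalid_Ctree_vtx; lia). rewrite (pairing_vtx (TGS Y)). exact H. }
  assert (He : forall i, i < 2 -> occurs g (cedge (TGS Y) x y (pv 0) i) ->
    occurs g (compT Y n x y)).
  { intros i Hi H. apply (occ_coh _ _ _ _ _ (mkpos (Ctree n) (edge n i (topD n)))).
    rewrite mkpos_val by (apply pvalid_Ctree_edge; lia). rewrite (pairing_edge (TGS Y)). exact H. }
  intros [H|[H|[H|[H|H]]]].
  - apply (He 0); auto.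
  - apply (He 1); auto.
  - apply (Hv 0); auto; lia.
  - apply (Hv 1); auto; lia.
  - apply (Hv 2); auto.
Qed.

Lemma occurs_idT Y n t g : occurs g t -> occurs g (idT Y n t).
Proof.
  intros H. apply (occ_coh _ _ _ _ _ (mkpos (Dtree n) (topD n))).
  rewrite mkpos_val by apply topD_valid. rewrite (disp_top (TGS Y)) by apply pdim_topD. exact H.
Qed.

Lemma idc_eq C n x : projT1 x = n ->
  idc C x = cohX C (Dtree n) (pvar (Dtree n) (topD n)) (pvar (Dtree n) (topD n))
              (fun p => disp (GX C) n x (proj1_sig p)).
Proof. intros <-. unfold idc. rewrite pvar_topDT. reflexivity. Qed.

Lemma comp_eq C n x y :
  comp C n x y = cohX C (Ctree n) (pvar (Ctree n) (vtx n 0 (topD n)))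
     (pvar (Ctree n) (vtx n 2 (topD n))) (fun p => pairing (GX C) n x y (proj1_sig p)).
Proof. unfold comp. rewrite pvar_csrcT, pvar_ctgtT. reflexivity. Qed.

Lemma ev_idT C B f n t : gmap (PosG B) (GX C) f -> tvalid (PosG B) n t ->
  ev C f (idT (PosG B) n t) = idc C (ev C f t).
Proof.
  intros Hf Ht. unfold idT.
  pose proof (globular_TGS _ (globular_PosG B)) as HT.
  rewrite (ev_coh C B f n); auto.
  - rewrite (idc_eq C n) by exact (gm_isc _ _ _ (gmap_ev C B f Hf) n t Ht).
    f_equal. apply functional_extensionality; intros p.
    apply (disp_map (TGS (PosG B)) (GX C)); auto. apply gmap_ev, Hf.
  - rewrite tdim_Dtree; auto.
  - apply full_sphere_admissible, full_sphere_Dtree.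
  - apply rawmap_disp; auto.
Qed.

Lemma ev_compT C B f n x y : gmap (PosG B) (GX C) f ->
  tvalid (PosG B) (S n) x -> tvalid (PosG B) (S n) y -> ttgt (PosG B) x = tsrc (PosG B) y ->
  ev C f (compT (PosG B) n x y) = comp C n (ev C f x) (ev C f y).
Proof.
  intros Hf Hx Hy E. unfold compT.
  pose proof (globular_TGS _ (globular_PosG B)) as HT.
  rewrite (ev_coh C B f n); auto.
  - rewrite comp_eq.
    f_equal. apply functional_extensionality; intros p.
    apply (pairing_map (TGS (PosG B)) (GX C)); auto. apply gmap_ev, Hf.
  - rewrite tdim_Ctree; auto.
  - apply full_sphere_admissible, full_sphere_Ctree.
  - apply (rawmap_cmap (TGS (PosG B))); auto.
Qed.

Notation res B f := (fun p : PosT B => f (proj1_sig p)).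

(** * Links between cells *)

(** One inductive closure in place of the stages of [Winf], so that a single induction treats all of
    them. *)
Inductive generated (C : WCat) : xcell C -> Prop :=
| generated_inv x : invertible C x -> generated C x
| generated_coh d B u v f :
    tdim B = S d -> full_sphere B d u v -> gmap (PosG B) (GX C) f ->
    (forall p, pdim (proj1_sig p) = S d -> generated C (f p)) -> generated C (cohX C B u v f).

(** Links are directed. Reflexivity, transitivity and congruence suffice, and symmetry is never
    invoked. *)
Definition linked (C : WCat) (n : nat) (x y : xcell C) : Prop :=
  exists t, generated C t /\ projT1 t = S n /\ xsrc C t = x /\ xtgt C t = y.

Lemma isgmap_gmap C B f : isgmap C B f -> gmap (PosG B) (GX C) f.
Proof. intros H. apply gmap_PosG; apply H. Qed.

Lemma Cset_generated C (A : xcell C -> Prop) c : (forall x, A x -> generated C x) -> Cset C A c ->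
  generated C c.
Proof.
  intros HA (B & d & HB & a & b & Ha & Hb & Hp & Ca & Cb & f & Hf & Hm & ->).
  apply (generated_coh C d); auto using isgmap_gmap. exists a, b; auto 9.
Qed.

Lemma Wle_generated C n x : Wle C n x -> generated C x.
Proof.
  revert x; induction n as [|n IH]; simpl; intros x H; [apply generated_inv, H|].
  destruct H as [H|H]; [auto|]. apply (Cset_generated C (Wle C n)); auto.
Qed.

Lemma Winf_generated C x : Winf C x -> generated C x.
Proof.
  intros [[|n] H]; [apply generated_inv, H|]. apply (Cset_generated C (Wle C n)); auto.
    apply Wle_generated.
Qed.

Lemma bind_var_id G (t : tm G) : bind var t = t.
Proof. rewrite (bind_var (fun g => g)). apply Tmap_id. Qed.

Definition coherence_cell (C : WCat) (x : xcell C) : Prop :=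
  exists n B t t' f, tdim B <= n /\
    tvalid (PosG B) n t /\ tvalid (PosG B) n t' /\ parallel (TGS (PosG B)) n t t' /\
    covers B n t /\ covers B n t' /\ gmap (PosG B) (GX C) f /\ x = cohX C B t t' f.

Lemma parallel_sym Y n x y : parallel Y n x y -> parallel Y n y x.
Proof. intros H Hn. destruct (H Hn); auto. Qed.

(** The composite of the two coherences and the identity on [t] share their faces, and their source
    [t] already covers [B]. They form a full sphere over the same tree, so the cancellator is a
    coherence cell one dimension up. *)
Lemma coherence_cell_cancel C n B t t' f : tdim B <= n ->
  tvalid (PosG B) n t -> tvalid (PosG B) n t' -> parallel (TGS (PosG B)) n t t' ->
  covers B n t -> covers B n t' -> gmap (PosG B) (GX C) f ->
  exists eta, projT1 eta = S (S n) /\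
    xsrc C eta = comp C n (cohX C B t t' f) (cohX C B t' t f) /\
    xtgt C eta = idc C (ev C f t) /\ coherence_cell C eta.
Proof.
  intros HB Ht Ht' Hp Ct Ct' Hf. apply parallel_sym in Hp as Hp'.
  pose proof (globular_PosG B) as HG. pose proof (globular_TGS _ HG) as HT.
  assert (H1 : full_sphere B n t t') by (apply full_sphere_id; auto).
  assert (H2 : full_sphere B n t' t) by (apply full_sphere_id; auto).
  set (x := coh B t t' var). set (y := coh B t' t var).
  assert (Hx : tvalid (PosG B) (S n) x)
    by (apply tvalid_coh; auto using full_sphere_admissible, gmap_var).
  assert (Hy : tvalid (PosG B) (S n) y)
    by (apply tvalid_coh; auto using full_sphere_admissible, gmap_var).
  assert (Exy : ttgt (PosG B) x = tsrc (PosG B) y) by (simpl; rewrite !bind_var_id; auto).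
  assert (Ex : tsrc (PosG B) x = t) by (apply bind_var_id).
  assert (Ey : ttgt (PosG B) y = t) by (apply bind_var_id).
  assert (Hxy : tvalid (PosG B) (S n) (compT (PosG B) n x y)) by (apply tvalid_compT; auto).
  assert (Hi : tvalid (PosG B) (S n) (idT (PosG B) n t)) by (apply tvalid_idT; auto).
  assert (Hpar : parallel (TGS (PosG B)) (S n) (compT (PosG B) n x y) (idT (PosG B) n t)).
  { intros _. cbn [gsrc gtgt TGS]. rewrite tsrc_compT, ttgt_compT, tsrc_idT, ttgt_idT. auto. }
  assert (C1 : covers B (S n) (compT (PosG B) n x y))
    by (apply covers_src; rewrite tsrc_compT, Ex; auto).
  assert (C2 : covers B (S n) (idT (PosG B) n t))
    by (apply covers_src; rewrite tsrc_idT; auto).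
  assert (Hs : full_sphere B (S n) (compT (PosG B) n x y) (idT (PosG B) n t))
    by (apply full_sphere_id; auto).
  exists (cohX C B (compT (PosG B) n x y) (idT (PosG B) n t) f).
  split; [|split; [|split]].
  - apply cohX_dim; auto using full_sphere_admissible.
  - rewrite (cohX_src C (S n)); auto using full_sphere_admissible. rewrite ev_compT; auto.
  - rewrite (cohX_tgt C (S n)); auto using full_sphere_admissible. rewrite ev_idT; auto.
  - exists (S n), B, (compT (PosG B) n x y), (idT (PosG B) n t), f; auto 10.
Qed.

Lemma coherence_cell_invertible C x : coherence_cell C x -> invertible C x.
Proof.
  intros H. exists (coherence_cell C). split; [|exact H]. clear x H.
  intros x (n & B & t & t' & f & HB & Ht & Ht' & Hp & Ct & Ct' & Hf & ->).
  apply parallel_sym in Hp as Hp'.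
  assert (H1 : admissible B n t t') by (apply full_sphere_admissible, full_sphere_id; auto).
  assert (H2 : admissible B n t' t) by (apply full_sphere_admissible, full_sphere_id; auto).
  destruct (coherence_cell_cancel C n B t t' f) as (eta & E1 & E2 & E3 & E4); auto.
  destruct (coherence_cell_cancel C n B t' t f) as (eps & F1 & F2 & F3 & F4); auto.
  exists n. split; [apply cohX_dim; auto|].
  exists (cohX C B t' t f), eta, eps.
  rewrite !(cohX_src C n), !(cohX_tgt C n) by auto.
  rewrite (cohX_dim C n) by auto. auto 12.
Qed.

Lemma coherence C n B t t' f : tdim B <= n ->
  tvalid (PosG B) n t -> tvalid (PosG B) n t' -> parallel (TGS (PosG B)) n t t' ->
  covers B n t -> covers B n t' -> gmap (PosG B) (GX C) f ->
  linked C n (ev C f t) (ev C f t').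
Proof.
  intros HB Ht Ht' Hp Ct Ct' Hf.
  assert (H1 : admissible B n t t') by (apply full_sphere_admissible, full_sphere_id; auto).
  exists (cohX C B t t' f). split; [|split; [|split]].
  - apply generated_inv, coherence_cell_invertible. exists n, B, t, t', f; auto 10.
  - apply cohX_dim; auto.
  - apply (cohX_src C n); auto.
  - apply (cohX_tgt C n); auto.
Qed.

(** An identity is the coherence cell over a disc with the top variable on both sides. *)
Lemma idc_invertible C n x : projT1 x = n -> invertible C (idc C x).
Proof.
  intros E. apply coherence_cell_invertible. rewrite (idc_eq C n) by exact E.
  assert (Ht : tvalid (PosG (Dtree n)) n (pvar (Dtree n) (topD n)))
    by auto using tvalid_pvar, topD_valid, pdim_topD.
  exists n, (Dtree n), (pvar (Dtree n) (topD n)), (pvar (Dtree n) (topD n)),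
    (res (Dtree n) (disp (GX C) n x)).
  rewrite tdim_Dtree. repeat (split; [solve [auto using covers_top]|]).
  split; [intros _; auto|]. repeat (split; [solve [auto using covers_top]|]).
  split; [|reflexivity]. apply rawmap_disp; auto using globular_GX.
Qed.

Lemma idc_type C n x : projT1 x = n ->
  projT1 (idc C x) = S n /\ xsrc C (idc C x) = x /\ xtgt C (idc C x) = x.
Proof.
  intros E. rewrite (idc_eq C n) by exact E.
  assert (HB : tdim (Dtree n) <= S n) by (rewrite tdim_Dtree; auto).
  pose proof (full_sphere_admissible _ _ _ _ (full_sphere_Dtree n)) as Hs.
  assert (Hf : rawmap (Dtree n) (GX C) (disp (GX C) n x))
    by (apply rawmap_disp; auto using globular_GX).
  rewrite (cohX_dim C n), (cohX_src C n), (cohX_tgt C n) by auto.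
  unfold pvar. rewrite ev_var, mkpos_val by apply topD_valid.
  rewrite disp_top by apply pdim_topD. auto.
Qed.

Lemma linked_refl C n x : projT1 x = n -> linked C n x x.
Proof.
  intros E. exists (idc C x). split; [|apply idc_type, E].
  apply generated_inv, (idc_invertible C n), E.
Qed.

Lemma comp_type C n x y : projT1 x = S n -> projT1 y = S n -> xtgt C x = xsrc C y ->
  projT1 (comp C n x y) = S n /\ xsrc C (comp C n x y) = xsrc C x /\
  xtgt C (comp C n x y) = xtgt C y.
Proof.
  intros Hx Hy E. rewrite comp_eq.
  assert (HB : tdim (Ctree n) <= S n) by (rewrite tdim_Ctree; auto).
  pose proof (full_sphere_admissible _ _ _ _ (full_sphere_Ctree n)) as Hs.
  assert (Hf : rawmap (Ctree n) (GX C) (pairing (GX C) n x y))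
    by (apply rawmap_cmap; auto using globular_GX).
  rewrite (cohX_dim C n), (cohX_src C n), (cohX_tgt C n) by auto.
  unfold pvar. rewrite !ev_var, !mkpos_val by (apply pvalid_Ctree_vtx; lia).
  rewrite !pairing_vtx. auto.
Qed.

Lemma linked_type C n x y : linked C n x y ->
  projT1 x = n /\ projT1 y = n /\ parallel (GX C) n x y.
Proof.
  intros (t & _ & Et & <- & <-). split; [|split].
  - apply (gl_src _ (globular_GX C)). exact Et.
  - apply (gl_tgt _ (globular_GX C)). exact Et.
  - exact (globular_parallel (GX C) n t (globular_GX C) Et).
Qed.

(** Binary composition is itself one of the operations under which [generated] is closed. *)
Lemma linked_trans C n x y z : linked C n x y -> linked C n y z -> linked C n x z.
Proof.
  intros (s & Hs & Es & <- & <-) (t & Ht & Et & E & <-).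
  destruct (comp_type C n s t) as (E1 & E2 & E3); auto.
  exists (comp C n s t). split; auto. rewrite comp_eq.
  apply (generated_coh C n); auto using tdim_Ctree, full_sphere_Ctree.
  - apply (rawmap_cmap (GX C)); auto using globular_GX.
  - intros p Ep. unfold pairing. rewrite Ep, Nat.eqb_refl.
    destruct (brn (proj1_sig p) =? 0); auto.
Qed.

Definition pair_fam {Z : Type} (v0 v1 : pos -> Z) (p : pos) (i : nat) : Z :=
  match i with 0 => v0 p | _ => v1 p end.

Lemma glue_incl_at {Z} d m P j (f : pos -> Z) v e (p : PosT P) : tdim P <= d -> j <= m ->
  glue d f v e (proj1_sig (incl_at d (sprout d m P) j p)) =
  if pdim (proj1_sig p) <? d then f (proj1_sig p) else v (proj1_sig p) j.
Proof.
  intros HP Hj. rewrite incl_at_val by auto. destruct p as [p Hp]; simpl.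
  rewrite <- (bdry_id d P HP) in Hp. apply pdim_bdry in Hp as Hd.
  destruct (Nat.ltb_spec (pdim p) d) as [H|H].
  - rewrite vtx_low, glue_low; auto.
  - eapply glue_vtx; eauto; lia.
Qed.

(** The link is a coherence over [G], from the lower to the upper copy of the operation [a]. The
    chosen links fill the new edges, so the lower copy takes the values of [f] and the upper one
    those of [g]. *)
Lemma congruence C d B u v f g : tdim B = S d -> full_sphere B d u v ->
  rawmap B (GX C) f -> rawmap B (GX C) g ->
  (forall p, pvalid B p = true -> pdim p <= d -> f p = g p) ->
  (forall p, pvalid B p = true -> pdim p = S d -> linked C (S d) (f p) (g p)) ->
  linked C (S d) (cohX C B u v (res B f)) (cohX C B u v (res B g)).
Proof.
  intros HB Huv Hf Hg Hlow Htop.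
  pose proof (globular_GX C) as HX. pose proof (full_sphere_admissible _ _ _ _ Huv) as Hfull.
  set (R := fun p t => generated C t /\ projT1 t = S (S d) /\ xsrc C t = f p /\ xtgt C t = g p).
  (* A link is chosen at all top positions at once; [f p] only witnesses that the type is
     inhabited. *)
  set (th := fun p (_ : nat) => epsilon (inhabits (f p)) (R p)).
  assert (Hth : forall p i, pvalid B p = true -> pdim p = S d -> R p (th p i))
    by (intros; apply epsilon_spec, Htop; auto).
  set (G := sprout (S d) 1 B). set (tau := glue (S d) f (pair_fam f g) th).
  assert (HB' : tdim B <= S d) by lia.
  assert (EG : bdry (S d) G = B) by (apply bdry_sprout_id; auto).
  assert (Hcnt : forall p, pvalid B p = true -> pdim p = S d -> arity (S d) G p = 1).
  { intros p Hp Ep. apply arity_sprout; auto. rewrite bdry_id; auto. }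
  assert (Htau : rawmap G (GX C) tau).
  { apply rawmap_glue.
    - apply tdim_sprout_le.
    - rewrite EG; exact Hf.
    - rewrite EG. intros p i Hp Ep Hi.
      destruct (linked_type _ _ _ _ (Htop p Hp Ep)) as (E1 & E2 & E3).
      destruct i; simpl; split; auto.
      + intros _; auto.
      + apply parallel_sym, E3.
    - rewrite EG. intros p i Hp Ep Hi. rewrite Hcnt in Hi by auto.
      destruct (Hth p i Hp Ep) as (_ & E1 & E2 & E3).
      destruct i; [|lia]. simpl. auto. }
  set (a := coh B u v var).
  assert (Ha : tvalid (PosG B) (S d) a) by (apply tvalid_coh; auto using gmap_var).
  assert (Ca : covers B (S d) a).
  { apply covers_occurs. intros p. apply (occ_coh _ _ _ _ _ p). constructor. }
  assert (Hs : full_sphere G (S d) (Tmap (incl_at (S d) G 0) a) (Tmap (incl_at (S d) G 1) a)).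
  { apply full_sphere_sprout; auto. intros _; auto. }
  assert (HG : tdim G = S (S d)).
  { apply tdim_sprout. rewrite bdry_id; auto. }
  pose proof (full_sphere_admissible _ _ _ _ Hs) as Hsf.
  exists (cohX C G (Tmap (incl_at (S d) G 0) a) (Tmap (incl_at (S d) G 1) a) (res G tau)).
  assert (Hsplit : forall p : PosT B, pdim (proj1_sig p) < S d \/ pdim (proj1_sig p) = S d).
  { intros p. pose proof (pdim_le_tdim B _ (proj2_sig p)). lia. }
  split; [|split; [|split]].
  - apply (generated_coh C (S d)); auto. intros [q Hq] Eq; cbn [proj1_sig] in *.
    destruct (position_cases (S d) G q Hq (tdim_sprout_le _ _ _))
      as [H|[(p & j & Hp & E & Hj & ->)|(p & j & Hp & E & Hj & ->)]];
      [lia|rewrite pdim_vtx in Eq by exact E; lia|].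
    unfold tau. erewrite glue_edge by eauto. apply Hth; auto. rewrite <- EG; exact Hp.
  - apply cohX_dim; auto; lia.
  - rewrite (cohX_src C (S d)) by (auto; lia). rewrite ev_Tmap, cohX_ev. f_equal.
    apply functional_extensionality; intros p. unfold tau, G. rewrite glue_incl_at by auto.
    destruct (_ <? _); reflexivity.
  - rewrite (cohX_tgt C (S d)) by (auto; lia). rewrite ev_Tmap, cohX_ev. f_equal.
    apply functional_extensionality; intros p. unfold tau, G. rewrite glue_incl_at by auto.
    destruct (Nat.ltb_spec (pdim (proj1_sig p)) (S d)); [|reflexivity].
    (* Below the top [tau] is [f] at both ends, so the upper copy has the values of [g] only because
       the two maps agree there. *)
    apply Hlow; [apply proj2_sig|lia].
Qed.

Lemma comp_congr C n x x' y y' : linked C (S n) x x' -> linked C (S n) y y' ->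
  xtgt C x = xsrc C y ->
  linked C (S n) (comp C n x y) (comp C n x' y').
Proof.
  intros Rx Ry E.
  destruct (linked_type _ _ _ _ Rx) as (X1 & X2 & X3).
  destruct (linked_type _ _ _ _ Ry) as (Y1 & Y2 & Y3).
  destruct X3 as [X3 X4]; [lia|]. destruct Y3 as [Y3 Y4]; [lia|].
  assert (E' : xtgt C x' = xsrc C y') by (cbn in *; unfold xtgt, xsrc in *; congruence).
  rewrite !comp_eq.
  apply congruence; auto using tdim_Ctree, full_sphere_Ctree.
  - apply (rawmap_cmap (GX C)); auto using globular_GX.
  - apply (rawmap_cmap (GX C)); auto using globular_GX.
  (* Below the top a composable pair enters only through its faces, which linked cells share. *)
  - intros p _ Hp. unfold pairing.
    replace (pdim p =? S n) with false by (symmetry; apply Nat.eqb_neq; lia).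
    replace (S n - pdim p) with (S (n - pdim p)) by lia.
    rewrite !Nat.iter_succ_r, X3, X4, Y4. reflexivity.
  - intros p _ Hp. unfold pairing. rewrite Hp, Nat.eqb_refl. destruct (brn p =? 0); auto.
Qed.

(** One unfolding of invertibility, with cancellators in [generated]: it is the closure condition
    that makes [generated] a coinduction witness. *)
Definition cancellable (C : WCat) (d : nat) (x : xcell C) : Prop :=
  projT1 x = S d /\ exists xb,
    projT1 xb = S d /\ xsrc C xb = xtgt C x /\ xtgt C xb = xsrc C x /\
    linked C (S d) (comp C d x xb) (idc C (xsrc C x)) /\
    linked C (S d) (comp C d xb x) (idc C (xtgt C x)).

Lemma cancellable_inv_closed C : (forall x, generated C x -> exists d, cancellable C d x) ->
  inv_closed C (generated C).
Proof.
  intros H x Hx. destruct (H x Hx) as (d & Ex & xb & E1 & E2 & E3 & (eta & H1 & H2 & H3 & H4) &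
    (eps & F1 & F2 & F3 & F4)).
  exists d. split; auto. exists xb, eta, eps. auto 12.
Qed.

Lemma invertible_cancellable C x : invertible C x -> exists d, cancellable C d x.
Proof.
  intros (S & HS & Hx).
  destruct (HS x Hx) as (d & Ex & xb & eta & eps & E1 & E2 & E3 & H1 & H2 & H3 & H4 & F1 & F2 &
    F3 & F4).
  exists d. split; auto. exists xb. repeat (split; [assumption|]).
  split; [exists eta|exists eps]; repeat split; auto; apply generated_inv; exists S; auto.
Qed.

Lemma invertible_cancellable_dim C d x : projT1 x = S d -> invertible C x -> cancellable C d x.
Proof.
  intros E H. destruct (invertible_cancellable C x H) as (d' & HQ).
  assert (d' = d) as -> by (destruct HQ; congruence). exact HQ.
Qed.

(** The inverse of [x'] serves for [x]: replace [x] by [x'] in both composites by congruence, then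
    cancel. *)
Lemma cancellable_linked C d x x' : linked C (S d) x x' -> cancellable C d x' ->
  cancellable C d x.
Proof.
  intros R (_ & xb & E1 & E2 & E3 & R1 & R2).
  destruct (linked_type _ _ _ _ R) as (X1 & X2 & X3). destruct X3 as [X3 X4]; [lia|].
  change (gsrc (GX C)) with (xsrc C) in *. change (gtgt (GX C)) with (xtgt C) in *.
  split; auto. exists xb. repeat split; auto; try congruence.
  - rewrite X3. eapply linked_trans; [|exact R1]. apply comp_congr; auto using linked_refl.
    congruence.
  - rewrite X4. eapply linked_trans; [|exact R2]. apply comp_congr; auto using linked_refl.
    congruence.
Qed.

Lemma cancellable_idc C d x : projT1 x = d -> cancellable C d (idc C x).
Proof.
  intros E. apply invertible_cancellable_dim; [apply idc_type, E|apply (idc_invertible C d), E].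
Qed.

Lemma gmap_incl_at0 d B : gmap (PosG (bdry d B)) (PosG B) (incl_at d B 0).
Proof. apply (rawmap_vtx d B (fun _ => 0)). intros; lia. Qed.

(** Positions below dimension [d] are supplied by the source of [t], a copy of the covering [a];
    only those in strings have to occur in [t] itself. *)
Lemma covers_cases P d B a t : bdry d B = P -> tdim B <= S d ->
  tvalid (PosG P) d a -> covers P d a -> tsrc (PosG B) t = Tmap (incl_at d B 0) a ->
  (forall p j, pvalid P p = true -> pdim p = d -> j <= arity d B p ->
    occurs (mkpos B (vtx d j p)) t) ->
  (forall p j, pvalid P p = true -> pdim p = d -> j < arity d B p ->
    occurs (mkpos B (edge d j p)) t) ->
  covers B (S d) t.
Proof.
  intros <- HB Ha Ca Es Hv He q. rewrite <- (mkpos_proj B q). pose proof (proj2_sig q) as Hq.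
  cbn beta in Hq.
  destruct (position_cases d B _ Hq HB)
    as [H|[(p & j & Hp & E & Hj & ->)|(p & j & Hp & E & Hj & ->)]];
    [right; left|left; auto|left; auto].
  rewrite Es. rewrite <- (pvalid_bdry_low d) in Hq by exact H.
  replace (mkpos B (proj1_sig q)) with (incl_at d B 0 (mkpos (bdry d B) (proj1_sig q))).
  - apply (insupp_Tmap (PosG (bdry d B)) (PosG B)); auto using gmap_incl_at0, globular_PosG.
  - unfold incl_at. rewrite mkpos_val by exact Hq. rewrite vtx_low by exact H. reflexivity.
Qed.

(** * Chains of composable cells *)

Section Chains.
Context (C : WCat) (d m : nat) (V F : nat -> xcell C).
Hypothesis HV : forall i, i <= m -> projT1 (V i) = d.
Hypothesis HF : forall i, i < m ->
  projT1 (F i) = S d /\ xsrc C (F i) = V i /\ xtgt C (F i) = V (S i).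

Local Notation L := (sprout d m (Dtree d)).
Local Notation LG := (PosG L).

(** All vertices of a chain are parallel, so the iterated faces of [V 0] serve as the lower
    cells. *)
Definition chain : pos -> xcell C :=
  glue d (disp (GX C) d (V 0)) (fun _ i => V i) (fun _ i => F i).
Definition chain_vertex (i : nat) : tm (PosT L) := pvar L (vtx d i (topD d)).
Definition chain_edge (i : nat) : tm (PosT L) := pvar L (edge d i (topD d)).

Lemma tdim_Dtree_le : tdim (Dtree d) <= d.
Proof. rewrite tdim_Dtree. auto. Qed.

Lemma bdry_chain : bdry d L = Dtree d.
Proof. apply bdry_sprout_id, tdim_Dtree_le. Qed.

Lemma arity_chain p : pvalid (Dtree d) p = true -> pdim p = d -> arity d L p = m.
Proof. intros Hp Ep. apply arity_sprout; auto. rewrite bdry_Dtree; auto. Qed.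

Lemma chain_vertices_parallel i : i <= m -> parallel (GX C) d (V i) (V 0).
Proof.
  induction i as [|i IH]; intros Hi Hn; [auto|].
  destruct (HF i) as (E1 & E2 & E3); [lia|].
  destruct (globular_parallel (GX C) d (F i) (globular_GX C) E1 Hn) as [E4 E5].
  destruct (IH ltac:(lia) Hn) as [E6 E7].
  unfold xsrc, xtgt in *. cbn [gsrc gtgt GX GSof] in *.
  rewrite E2, E3 in *. split; congruence.
Qed.

Lemma rawmap_chain : rawmap L (GX C) chain.
Proof.
  apply rawmap_glue.
  - apply tdim_sprout_le.
  - rewrite bdry_chain. apply rawmap_disp; auto using globular_GX.
    apply HV; lia.
  - rewrite bdry_chain. intros p i Hp Ep Hi. rewrite arity_chain in Hi by auto.
    split; [apply HV, Hi|]. rewrite disp_top by exact Ep.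
    apply chain_vertices_parallel, Hi.
  - rewrite bdry_chain. intros p i Hp Ep Hi. rewrite arity_chain in Hi by auto.
    apply HF, Hi.
Qed.

Lemma ev_chain_vertex i : i <= m -> ev C (res L chain) (chain_vertex i) = V i.
Proof.
  intros Hi. unfold chain_vertex, pvar. rewrite ev_var, mkpos_val.
  - unfold chain. rewrite (glue_vtx d _ _ _ (Dtree d)); rewrite ?bdry_Dtree;
    auto using topD_valid, pdim_topD.
  - apply pvalid_sprout_vtx; auto using tdim_Dtree_le, topD_valid.
Qed.

Lemma ev_chain_edge i : i < m -> ev C (res L chain) (chain_edge i) = F i.
Proof.
  intros Hi. unfold chain_edge, pvar. rewrite ev_var, mkpos_val.
  - unfold chain. rewrite (glue_edge d _ _ _ (Dtree d)); rewrite ?bdry_Dtree;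
    auto using topD_valid, pdim_topD.
  - apply pvalid_sprout_edge; auto using tdim_Dtree_le, topD_valid, pdim_topD.
Qed.

Lemma tvalid_chain_vertex i : i <= m -> tvalid LG d (chain_vertex i).
Proof.
  intros Hi. apply tvalid_pvar; [|apply pdim_vtx, pdim_topD].
  apply pvalid_sprout_vtx; auto using tdim_Dtree_le, topD_valid.
Qed.

Lemma tvalid_chain_edge i : i < m -> tvalid LG (S d) (chain_edge i).
Proof.
  intros Hi. apply tvalid_pvar; [|apply pdim_edge, pdim_topD].
  apply pvalid_sprout_edge; auto using tdim_Dtree_le, topD_valid, pdim_topD.
Qed.

Lemma tsrc_chain_edge i : i < m -> tsrc LG (chain_edge i) = chain_vertex i.
Proof.
  intros Hi. unfold chain_edge. rewrite tsrc_pvar, psrc_edge; auto using pdim_topD.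
  apply pvalid_sprout_edge; auto using tdim_Dtree_le, topD_valid, pdim_topD.
Qed.

Lemma ttgt_chain_edge i : i < m -> ttgt LG (chain_edge i) = chain_vertex (S i).
Proof.
  intros Hi. unfold chain_edge. rewrite ttgt_pvar, ptgt_edge; auto using pdim_topD.
  apply pvalid_sprout_edge; auto using tdim_Dtree_le, topD_valid, pdim_topD.
Qed.

(** Any two such pastings of the whole chain are linked by coherence, which gives associativity and
    unit laws in any bracketing. *)
Definition total_composite (t : tm (PosT L)) : Prop :=
  tvalid LG (S d) t /\ tsrc LG t = chain_vertex 0 /\ ttgt LG t = chain_vertex m /\
  (forall i, i <= m -> occurs (mkpos L (vtx d i (topD d))) t) /\
  (forall i, i < m -> occurs (mkpos L (edge d i (topD d))) t).

Lemma covers_total_composite t : total_composite t -> covers L (S d) t.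
Proof.
  intros (Ht & Es & Et & Hv & He).
  apply (covers_cases (Dtree d) d L (pvar (Dtree d) (topD d))).
  - apply bdry_chain.
  - apply tdim_sprout_le.
  - apply tvalid_pvar; apply topD_ok.
  - apply covers_top.
  - rewrite Es. unfold chain_vertex, pvar, incl_at. cbn [Tmap]. rewrite (mkpos_val (Dtree d)) by
    apply topD_valid. reflexivity.
  - intros p j Hp Ep Hj. rewrite arity_chain in Hj by auto.
    rewrite (Dtree_top d p) by auto. auto.
  - intros p j Hp Ep Hj. rewrite arity_chain in Hj by auto.
    rewrite (Dtree_top d p) by auto. auto.
Qed.

Lemma chain_coherence t t' : total_composite t -> total_composite t' ->
  linked C (S d) (ev C (res L chain) t) (ev C (res L chain) t').
Proof.
  intros H H'. apply coherence; auto using covers_total_composite, rawmap_chain.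
  - apply tdim_sprout_le.
  - apply H.
  - apply H'.
  - destruct H as (_ & E1 & E2 & _), H' as (_ & E1' & E2' & _).
    intros _. cbn [gsrc gtgt TGS]. split; congruence.
  - apply rawmap_chain.
Qed.

End Chains.

(** A vertex may be present only as a face of an edge, hence the branches that rewrite sources and
    targets. *)
Ltac occ_search :=
  first [ apply occ_var
        | apply (occurs_compT (PosG _)); first
            [ left; occ_search
            | right; left; occ_search
            | right; right; left; rewrite tsrc_chain_edge by lia; occ_search
            | right; right; right; left; rewrite ttgt_chain_edge by lia; occ_search
            | right; right; right; right; rewrite ttgt_chain_edge by lia; occ_search ]
        | apply (occurs_idT (PosG _)); occ_search ].

Ltac term_side :=
  repeat first [ rewrite tsrc_compT | rewrite ttgt_compT | rewrite tsrc_idT | rewrite ttgt_idT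
               | rewrite tsrc_chain_edge by lia | rewrite ttgt_chain_edge by lia ];
  first [ reflexivity
        | apply tvalid_compT; [apply globular_PosG|term_side|term_side|term_side]
        | apply tvalid_idT; [apply globular_PosG|term_side]
        | apply tvalid_chain_edge; lia
        | apply tvalid_chain_vertex; lia ].

(** The rebracketing that brings the two inner cells of a composite and its inverse next to each
    other. *)
Lemma comp_assoc4 C d f0 f1 f2 f3 :
  projT1 f0 = S d -> projT1 f1 = S d -> projT1 f2 = S d -> projT1 f3 = S d ->
  xtgt C f0 = xsrc C f1 -> xtgt C f1 = xsrc C f2 -> xtgt C f2 = xsrc C f3 ->
  linked C (S d) (comp C d (comp C d f0 f1) (comp C d f2 f3))
              (comp C d f0 (comp C d (comp C d f1 f2) f3)).
Proof.
  intros D0 D1 D2 D3 E0 E1 E2.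
  set (F := fun i => nth i [f0; f1; f2; f3] f0).
  (* The default of [nth] supplies the last vertex, [V 4]. *)
  set (V := fun i => nth i [xsrc C f0; xsrc C f1; xsrc C f2; xsrc C f3] (xtgt C f3)).
  pose proof (globular_GX C) as HX.
  assert (HV : forall i, i <= 4 -> projT1 (V i) = d).
  { intros i Hi. do 5 (destruct i as [|i]; [
      first [exact (gl_src _ HX d _ D0)|exact (gl_src _ HX d _ D1)|exact (gl_src _ HX d _ D2)
            |exact (gl_src _ HX d _ D3)|exact (gl_tgt _ HX d _ D3)]|]). lia. }
  assert (HF : forall i, i < 4 ->
    projT1 (F i) = S d /\ xsrc C (F i) = V i /\ xtgt C (F i) = V (S i)).
  { intros i Hi. do 4 (destruct i as [|i]; [unfold F, V; cbn [nth]; auto|]). lia. }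
  pose proof (rawmap_chain C d 4 V F HV HF) as Hg.
  set (c0 := chain_edge d 4 0). set (c1 := chain_edge d 4 1). set (c2 := chain_edge d 4 2).
    set (c3 := chain_edge d 4 3).
  set (LG := PosG (sprout d 4 (Dtree d))).
  set (t := compT LG d (compT LG d c0 c1) (compT LG d c2 c3)).
  set (t' := compT LG d c0 (compT LG d (compT LG d c1 c2) c3)).
  assert (R : linked C (S d) (ev C (res _ (chain C d V F)) t) (ev C (res _ (chain C d V F)) t')).
  { apply (chain_coherence C d 4 V F HV HF); subst t t' c0 c1 c2 c3 LG;
      (split; [term_side|split; [term_side|split; [term_side|split]]]);
      intros i Hi.
    - do 5 (destruct i as [|i]; [occ_search|]); lia.
    - do 4 (destruct i as [|i]; [occ_search|]); lia.
    - do 5 (destruct i as [|i]; [occ_search|]); lia.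
    - do 4 (destruct i as [|i]; [occ_search|]); lia. }
  subst t t' c0 c1 c2 c3 LG.
  repeat rewrite ev_compT in R by first [exact Hg|term_side].
  rewrite !ev_chain_edge in R by lia. exact R.
Qed.

Lemma comp_unit_middle C d f0 f1 :
  projT1 f0 = S d -> projT1 f1 = S d -> xtgt C f0 = xsrc C f1 ->
  linked C (S d) (comp C d f0 (comp C d (idc C (xsrc C f1)) f1)) (comp C d f0 f1).
Proof.
  intros D0 D1 E0.
  set (F := fun i => nth i [f0; f1] f0).
  set (V := fun i => nth i [xsrc C f0; xsrc C f1] (xtgt C f1)).
  pose proof (globular_GX C) as HX.
  assert (HV : forall i, i <= 2 -> projT1 (V i) = d).
  { intros i Hi. do 3 (destruct i as [|i]; [
      first [exact (gl_src _ HX d _ D0)|exact (gl_src _ HX d _ D1)|exact (gl_tgt _ HX d _ D1)]|]).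
    lia. }
  assert (HF : forall i, i < 2 ->
    projT1 (F i) = S d /\ xsrc C (F i) = V i /\ xtgt C (F i) = V (S i)).
  { intros i Hi. do 2 (destruct i as [|i]; [unfold F, V; cbn [nth]; auto|]). lia. }
  pose proof (rawmap_chain C d 2 V F HV HF) as Hg.
  set (LG := PosG (sprout d 2 (Dtree d))).
  set (t := compT LG d (chain_edge d 2 0) (compT LG d (idT LG d (chain_vertex d 2 1)) (chain_edge
    d 2 1))).
  set (t' := compT LG d (chain_edge d 2 0) (chain_edge d 2 1)).
  assert (R : linked C (S d) (ev C (res _ (chain C d V F)) t) (ev C (res _ (chain C d V F)) t')).
  { apply (chain_coherence C d 2 V F HV HF); subst t t' LG;
      (split; [term_side|split; [term_side|split; [term_side|split]]]);
      intros i Hi.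
    - do 3 (destruct i as [|i]; [occ_search|]); lia.
    - do 2 (destruct i as [|i]; [occ_search|]); lia.
    - do 3 (destruct i as [|i]; [occ_search|]); lia.
    - do 2 (destruct i as [|i]; [occ_search|]); lia. }
  subst t t' LG.
  repeat rewrite ev_compT in R by first [exact Hg|term_side].
  rewrite ev_idT in R by first [exact Hg|term_side].
  rewrite !ev_chain_edge, ev_chain_vertex in R by lia. exact R.
Qed.

(** Cancels from the inside: [(f g)(gb fb) ~ f ((g gb) fb) ~ f (id fb) ~ f fb ~ id]. *)
Lemma comp_cancel C d f g gb fb :
  projT1 f = S d -> projT1 g = S d -> projT1 gb = S d -> projT1 fb = S d ->
  xtgt C f = xsrc C g -> xtgt C g = xsrc C gb -> xtgt C gb = xsrc C fb ->
  linked C (S d) (comp C d g gb) (idc C (xsrc C g)) ->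
  linked C (S d) (comp C d f fb) (idc C (xsrc C f)) ->
  xsrc C g = xsrc C fb ->
  linked C (S d) (comp C d (comp C d f g) (comp C d gb fb)) (idc C (xsrc C f)).
Proof.
  intros D0 D1 D2 D3 E0 E1 E2 Rg Rf E3.
  destruct (comp_type C d g gb) as (X1 & X2 & X3); auto.
  destruct (comp_type C d (comp C d g gb) fb) as (Y1 & Y2 & Y3); auto; [congruence|].
  eapply linked_trans; [apply comp_assoc4; auto|].
  eapply linked_trans; [|exact Rf].
  eapply linked_trans; [|apply comp_unit_middle; congruence].
  apply comp_congr; [apply linked_refl; auto| |congruence].
  rewrite <- E3. apply comp_congr; [exact Rg|apply linked_refl; auto|congruence].
Qed.

Lemma cancellable_comp C d f g : cancellable C d f -> cancellable C d g -> xtgt C f = xsrc C g ->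
  cancellable C d (comp C d f g).
Proof.
  intros (Df & fb & F1 & F2 & F3 & F4 & F5) (Dg & gb & G1 & G2 & G3 & G4 & G5) E.
  destruct (comp_type C d f g) as (X1 & X2 & X3); auto.
  destruct (comp_type C d gb fb) as (Y1 & Y2 & Y3); auto; [congruence|].
  split; auto. exists (comp C d gb fb). rewrite X2, X3, Y2, Y3.
  repeat split; auto.
  - apply comp_cancel; auto; congruence.
  - rewrite <- G2. apply comp_cancel; auto; congruence.
Qed.

(** * Glued maps on sprouted trees *)

Lemma Tmap_incl_at_id d P (a : tm (PosT P)) : tdim P <= d -> Tmap (incl_at d P 0) a = a.
Proof.
  intros HP. rewrite <- (Tmap_id a) at 2. f_equal.
  apply functional_extensionality; intros p. unfold incl_at.
  rewrite (vtx_id d P) by (auto using proj2_sig; try apply (proj2_sig p); lia).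
  apply mkpos_proj.
Qed.

(** Computes the faces of a coherence with glued arguments. [k p] is the vertex of the string in [R]
    to which the i-th vertex over [p] is sent: a constant, or [arity d B] when the end of a string
    is meant. *)
Lemma bind_glue_incl_at d m P R i (k : pos -> nat) v e (a : tm (PosT P)) : tdim P <= d ->
  i <= m ->
  (forall p, pvalid P p = true -> pdim p = d -> v p i = pvar R (vtx d (k p) p)) ->
  bind (res (sprout d m P) (glue d (pvar R) v e)) (Tmap (incl_at d (sprout d m P) i) a) =
  Tmap (fun p : PosT P => mkpos R (vtx d (k (proj1_sig p)) (proj1_sig p))) a.
Proof.
  intros HP Hi Hv. rewrite bind_Tmap, <- bind_var. f_equal.
  apply functional_extensionality; intros p. rewrite glue_incl_at by auto.
  pose proof (proj2_sig p) as Hp. cbn beta in Hp. apply pdim_le_tdim in Hp as Hd.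
  destruct (Nat.ltb_spec (pdim (proj1_sig p)) d) as [H|H].
  - rewrite vtx_low by exact H. reflexivity.
  - apply Hv; auto; lia.
Qed.

(** [rawmap_glue] with the boundary of the sprouted tree simplified to [P] and every arity to
    [m]. *)
Lemma rawmap_glue_sprout Z d m P f v e : tdim P <= d -> rawmap P Z f ->
  (forall p i, pvalid P p = true -> pdim p = d -> i <= m ->
     isc Z d (v p i) /\ parallel Z d (v p i) (f p)) ->
  (forall p i, pvalid P p = true -> pdim p = d -> i < m ->
     isc Z (S d) (e p i) /\ gsrc Z (e p i) = v p i /\ gtgt Z (e p i) = v p (S i)) ->
  rawmap (sprout d m P) Z (glue d f v e).
Proof.
  intros HP Hf Hv He.
  assert (Hc : forall p, pvalid P p = true -> pdim p = d -> arity d (sprout d m P) p = m).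
  { intros p Hp Ep. apply arity_sprout; auto. rewrite bdry_id; auto. }
  apply rawmap_glue; rewrite ?bdry_sprout_id by exact HP; auto.
  - apply tdim_sprout_le.
  - intros p i Hp Ep Hi. rewrite Hc in Hi; auto.
  - intros p i Hp Ep Hi. rewrite Hc in Hi; auto.
Qed.

Lemma glue_sprout_ext {Z} d m P (f : pos -> Z) v e f' v' e' :
  tdim P <= d ->
  (forall p, pvalid P p = true -> pdim p < d -> f p = f' p) ->
  (forall p i, pvalid P p = true -> pdim p = d -> i <= m -> v p i = v' p i) ->
  (forall p i, pvalid P p = true -> pdim p = d -> i < m -> e p i = e' p i) ->
  res (sprout d m P) (glue d f v e) = res (sprout d m P) (glue d f' v' e').
Proof.
  intros HP Hf Hv He. apply functional_extensionality; intros p.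
  apply (glue_ext (sprout d m P)).
  - apply (proj2_sig p).
  - apply tdim_sprout_le.
  - intros q Hq Hd. apply Hf; auto.
    rewrite <- (pvalid_bdry_low d), bdry_sprout_id in Hq; auto.
  - intros q i Hq Ed Hi. rewrite bdry_sprout in Hq. rewrite arity_sprout in Hi by auto.
    rewrite bdry_id in Hq; auto.
  - intros q i Hq Ed Hi. rewrite bdry_sprout in Hq. rewrite arity_sprout in Hi by auto.
    rewrite bdry_id in Hq; auto.
Qed.

Lemma ev_coh_sprout C R rho d m P u w f v e f' v' e' :
  gmap (PosG R) (GX C) rho -> tdim P <= d -> admissible (sprout d m P) d u w ->
  rawmap (sprout d m P) (TGS (PosG R)) (glue d f v e) ->
  (forall p, pvalid P p = true -> pdim p < d -> ev C rho (f p) = f' p) ->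
  (forall p i, pvalid P p = true -> pdim p = d -> i <= m -> ev C rho (v p i) = v' p i) ->
  (forall p i, pvalid P p = true -> pdim p = d -> i < m -> ev C rho (e p i) = e' p i) ->
  ev C rho (coh (sprout d m P) u w (res (sprout d m P) (glue d f v e))) =
  cohX C (sprout d m P) u w (res (sprout d m P) (glue d f' v' e')).
Proof.
  intros Hr HP Hf Hg H1 H2 H3. rewrite (ev_coh C R rho d); auto using tdim_sprout_le.
  f_equal. rewrite <- (glue_sprout_ext d m P _ _ _ f' v' e' HP H1 H2 H3).
  apply functional_extensionality; intros p. apply glue_map.
Qed.

Lemma ev_pvar C B (f : pos -> xcell C) p : pvalid B p = true -> ev C (res B f) (pvar B p) = f p.
Proof. intros Hp. unfold pvar. rewrite ev_var, mkpos_val; auto. Qed.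

Lemma parallel_pvar_vtx d B p i : pvalid B p = true -> pvalid B (vtx d i p) = true ->
  pdim p = d ->
  parallel (TGS (PosG B)) d (pvar B (vtx d i p)) (pvar B p).
Proof.
  intros Hp Hi Ep Hd. destruct d as [|d]; [lia|]. cbn [gsrc gtgt TGS].
  rewrite !tsrc_pvar, !ttgt_pvar, psrc_vtx, ptgt_vtx by auto. auto.
Qed.

Definition const_fam {Z : Type} (f : pos -> Z) (p : pos) (_ : nat) : Z := f p.

Lemma arity_top n B p : tdim B <= n -> pvalid B p = true -> pdim p = n -> arity n B p = 0.
Proof.
  intros HB Hp E. destruct (Nat.eq_dec (arity n B p) 0) as [|Hc]; auto. exfalso.
  assert (Hv : pvalid B (edge n 0 p) = true)
    by (apply pvalid_edge; [rewrite bdry_id; auto|auto|lia]).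
  apply pdim_le_tdim in Hv. rewrite pdim_edge in Hv; lia.
Qed.

(** * Cancellation over a boundary with one top cell over each position *)

Section Cancellation.
Context (C : WCat) (d : nat) (P : tree) (HP : tdim P = d) (a b : tm (PosT P)).
Hypothesis Ha : tvalid (PosG P) d a.
Hypothesis Hb : tvalid (PosG P) d b.
Hypothesis Hab : parallel (TGS (PosG P)) d a b.
Hypothesis Ca : covers P d a.
Hypothesis Cb : covers P d b.
Context (f0 v0 v1 e eb : pos -> xcell C).
Hypothesis Hf0 : rawmap P (GX C) f0.
Hypothesis Hv : forall p, pvalid P p = true -> pdim p = d ->
  (projT1 (v0 p) = d /\ parallel (GX C) d (v0 p) (f0 p)) /\
  (projT1 (v1 p) = d /\ parallel (GX C) d (v1 p) (f0 p)).
Hypothesis He : forall p, pvalid P p = true -> pdim p = d ->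
  projT1 (e p) = S d /\ xsrc C (e p) = v0 p /\ xtgt C (e p) = v1 p.
Hypothesis Heb : forall p, pvalid P p = true -> pdim p = d ->
  projT1 (eb p) = S d /\ xsrc C (eb p) = v1 p /\ xtgt C (eb p) = v0 p.
Hypothesis Hrel : forall p, pvalid P p = true -> pdim p = d ->
  linked C (S d) (comp C d (e p) (eb p)) (idc C (v0 p)).

Local Notation G1 := (sprout d 1 P).
Local Notation G2 := (sprout d 2 P).
Local Notation T2 := (TGS (PosG G2)).

Let HPle : tdim P <= d.
Proof. lia. Qed.

(** Places [e p] followed by [eb p] over each top cell, so the vertices are [v0], [v1], [v0]. *)
Definition doubled : pos -> xcell C :=
  glue d f0 (fun p i => match i with 1 => v1 p | _ => v0 p end)
      (fun p i => if i =? 0 then e p else eb p).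

(** Selects the i-th edge of each string of [G2], between its vertices [i] and [i + 1]. *)
Definition half (i : nat) : pos -> tm (PosT G2) :=
  glue d (pvar G2) (fun p k => pvar G2 (vtx d (i + k) p)) (const_fam (fun p =>
    pvar G2 (edge d i p))).

(** Each edge becomes the composite of both edges of a string; the factor 2 sends its ends to the
    outer vertices 0 and 2. *)
Definition folded : pos -> tm (PosT G2) :=
  glue d (pvar G2) (fun p k => pvar G2 (vtx d (2 * k) p))
    (const_fam (fun p => compT (PosG G2) d (pvar G2 (edge d 0 p)) (pvar G2 (edge d 1 p)))).

Definition collapsed : pos -> tm (PosT P) :=
  glue d (pvar P) (const_fam (fun p => pvar P (vtx d 0 p))) (const_fam (fun p =>
    idT (PosG P) d (pvar P p))).

Definition base : pos -> xcell C := glue d f0 (const_fam v0) (const_fam v0).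

Lemma rawmap_doubled : rawmap G2 (GX C) doubled.
Proof.
  apply rawmap_glue_sprout; auto.
  - intros p i Hp Ep Hi. destruct (Hv p Hp Ep) as [V0 V1].
    destruct i as [|[|i]]; assumption.
  - intros p i Hp Ep Hi. destruct i as [|[|i]]; [apply He|apply Heb|lia]; auto.
Qed.

Lemma gmap_doubled : gmap (PosG G2) (GX C) (res G2 doubled).
Proof. exact rawmap_doubled. Qed.

Lemma pvalid_G2_low p : pvalid P p = true -> pvalid G2 p = true.
Proof.
  intros Hp. rewrite <- (vtx_id d P p 0) by (auto; lia). apply pvalid_sprout_vtx; auto; lia.
Qed.

Lemma rawmap_pvar_G2 : rawmap P T2 (pvar G2).
Proof.
  assert (H : rawmap P (PosG G2) (mkpos G2)).
  { assert (H : gmap (PosG P) (PosG G2) (incl_at d G2 0)) by (apply gmap_incl_at; auto; lia).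
    unfold rawmap. replace (res P (mkpos G2)) with (@incl_at d G2 0 P); [exact H|].
    apply functional_extensionality; intros p. unfold incl_at. f_equal.
    apply (vtx_id d P); auto; [apply (proj2_sig p)|lia]. }
  exact (rawmap_comp _ _ _ _ _ H (gmap_var _)).
Qed.

Lemma vertex_G2 p i : pvalid P p = true -> pdim p = d -> i <= 2 ->
  tvalid (PosG G2) d (pvar G2 (vtx d i p)) /\ parallel T2 d (pvar G2 (vtx d i p)) (pvar G2 p).
Proof.
  intros Hp Ep Hi. assert (H : pvalid G2 (vtx d i p) = true) by (apply pvalid_sprout_vtx; auto).
  split; [apply tvalid_pvar; auto using pdim_vtx|].
  apply parallel_pvar_vtx; auto using pvalid_G2_low.
Qed.

Lemma edge_G2 p i : pvalid P p = true -> pdim p = d -> i < 2 ->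
  tvalid (PosG G2) (S d) (pvar G2 (edge d i p)) /\
  tsrc (PosG G2) (pvar G2 (edge d i p)) = pvar G2 (vtx d i p) /\
  ttgt (PosG G2) (pvar G2 (edge d i p)) = pvar G2 (vtx d (S i) p).
Proof.
  intros Hp Ep Hi.
  assert (H : pvalid G2 (edge d i p) = true) by (apply pvalid_sprout_edge; auto).
  split; [apply tvalid_pvar; auto using pdim_edge|].
  rewrite tsrc_pvar, ttgt_pvar, psrc_edge, ptgt_edge by auto. auto.
Qed.

Lemma rawmap_half i : i <= 1 -> rawmap G1 T2 (half i).
Proof.
  intros Hi. apply rawmap_glue_sprout; auto using rawmap_pvar_G2.
  - intros p k Hp Ep Hk. apply vertex_G2; auto; lia.
  - intros p k Hp Ep Hk. assert (k = 0) as -> by lia. rewrite Nat.add_0_r, Nat.add_1_r.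
    apply edge_G2; auto; lia.
Qed.

Lemma rawmap_folded : rawmap G1 T2 folded.
Proof.
  apply rawmap_glue_sprout; auto using rawmap_pvar_G2.
  - intros p k Hp Ep Hk. apply vertex_G2; auto; lia.
  - intros p k Hp Ep Hk. assert (k = 0) as -> by lia. unfold const_fam. cbn [isc gsrc gtgt TGS].
    destruct (edge_G2 p 0 Hp Ep) as (X1 & X2 & X3); [lia|].
    destruct (edge_G2 p 1 Hp Ep) as (Y1 & Y2 & Y3); [lia|].
    rewrite tsrc_compT, ttgt_compT. split; auto.
    apply tvalid_compT; auto using globular_PosG. congruence.
Qed.

Lemma base_top p : pvalid P p = true -> pdim p = d -> base p = v0 p.
Proof.
  intros Hp Ep. unfold base. erewrite (glue_mid d _ _ _ P); [reflexivity| |exact Ep].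
  rewrite bdry_id; auto.
Qed.

Lemma rawmap_base : rawmap P (GX C) base.
Proof.
  apply rawmap_glue.
  - lia.
  - rewrite bdry_id; auto.
  - rewrite bdry_id by auto. intros p i Hp Ep Hi. apply Hv; auto.
  - rewrite bdry_id by auto. intros p i Hp Ep Hi. rewrite arity_top in Hi by auto. lia.
Qed.

Lemma gmap_base : gmap (PosG P) (GX C) (res P base).
Proof. exact rawmap_base. Qed.

Lemma rawmap_collapsed : rawmap G1 (TGS (PosG P)) collapsed.
Proof.
  apply rawmap_glue_sprout; auto using rawmap_pvar.
  - intros p k Hp Ep Hk. unfold const_fam. rewrite (vtx_id d P) by (auto; lia).
    split; [apply tvalid_pvar; auto|intros _; auto].
  - intros p k Hp Ep Hk. unfold const_fam. rewrite (vtx_id d P) by (auto; lia).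
    cbn [isc gsrc gtgt TGS]. rewrite tsrc_idT, ttgt_idT. split; auto.
    apply tvalid_idT; auto using globular_PosG, tvalid_pvar.
Qed.

Definition forward : xcell C :=
  cohX C G1 (Tmap (incl_at d G1 0) a) (Tmap (incl_at d G1 1) b) (res G1 (glue d f0 (pair_fam v0
    v1) (const_fam e))).
(** Convertible to [forward] with [a], [b] and [v0], [v1] exchanged and [eb] for [e]; one
    cancellation result then yields both cancellators. *)
Definition backward : xcell C :=
  cohX C G1 (Tmap (incl_at d G1 0) b) (Tmap (incl_at d G1 1) a) (res G1 (glue d f0 (pair_fam v1
    v0) (const_fam eb))).

Let Hba : parallel (TGS (PosG P)) d b a.
Proof. apply parallel_sym, Hab. Qed.

Let Haa (x : tm (PosT P)) : parallel (TGS (PosG P)) d x x.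
Proof. intros _; auto. Qed.

Lemma ev_doubled_vtx p i : pvalid P p = true -> pdim p = d -> i <= 2 ->
  ev C (res G2 doubled) (pvar G2 (vtx d i p)) = match i with 1 => v1 p | _ => v0 p end.
Proof.
  intros Hp Ep Hi. rewrite ev_pvar by (apply pvalid_sprout_vtx; auto).
  unfold doubled. erewrite (glue_vtx d _ _ _ P); [reflexivity| |exact Ep].
  rewrite bdry_id; auto.
Qed.

Lemma ev_doubled_edge p i : pvalid P p = true -> pdim p = d -> i < 2 ->
  ev C (res G2 doubled) (pvar G2 (edge d i p)) = if i =? 0 then e p else eb p.
Proof.
  intros Hp Ep Hi. rewrite ev_pvar by (apply pvalid_sprout_edge; auto).
  unfold doubled. erewrite (glue_edge d _ _ _ P); [reflexivity| |exact Ep].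
  rewrite bdry_id; auto.
Qed.

Lemma ev_doubled_low p : pvalid P p = true -> pdim p < d ->
  ev C (res G2 doubled) (pvar G2 p) = f0 p.
Proof.
  intros Hp Ep. rewrite ev_pvar by (apply pvalid_G2_low; auto).
  unfold doubled. apply glue_low, Ep.
Qed.

Lemma forward_doubled : ev C (res G2 doubled)
  (coh G1 (Tmap (incl_at d G1 0) a) (Tmap (incl_at d G1 1) b) (res G1 (half 0))) = forward.
Proof.
  apply ev_coh_sprout; auto using gmap_doubled, ev_doubled_low.
  - apply full_sphere_admissible, full_sphere_sprout; auto.
  - apply rawmap_half; lia.
  - intros p i Hp Ep Hi. rewrite ev_doubled_vtx by (auto; lia).
    destruct i as [|[|i]]; [reflexivity|reflexivity|lia].
  - intros p i Hp Ep Hi. unfold const_fam. rewrite ev_doubled_edge by (auto; lia). reflexivity.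
Qed.

Lemma backward_doubled : ev C (res G2 doubled)
  (coh G1 (Tmap (incl_at d G1 0) b) (Tmap (incl_at d G1 1) a) (res G1 (half 1))) = backward.
Proof.
  apply ev_coh_sprout; auto using gmap_doubled, ev_doubled_low.
  - apply full_sphere_admissible, full_sphere_sprout; auto.
  - apply rawmap_half; lia.
  - intros p i Hp Ep Hi. rewrite ev_doubled_vtx by (auto; lia).
    destruct i as [|[|i]]; [reflexivity|reflexivity|lia].
  - intros p i Hp Ep Hi. unfold const_fam. rewrite ev_doubled_edge by (auto; lia). reflexivity.
Qed.

Definition sandwich (h : pos -> xcell C) : xcell C :=
  cohX C G1 (Tmap (incl_at d G1 0) a) (Tmap (incl_at d G1 1) a) (res G1 (glue d f0 (const_fam v0)
    (const_fam h))).

(** Coherence over [G2]: composing the two halves, or composing inside every string, gives two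
    covering terms from the lowest to the highest copy of [a]. *)
Lemma linked_forward_backward_sandwich :
  linked C (S d) (comp C d forward backward) (sandwich (fun p => comp C d (e p) (eb p))).
Proof.
  set (t1 := coh G1 (Tmap (incl_at d G1 0) a) (Tmap (incl_at d G1 1) b) (res G1 (half 0))).
  set (t2 := coh G1 (Tmap (incl_at d G1 0) b) (Tmap (incl_at d G1 1) a) (res G1 (half 1))).
  set (t3 := coh G1 (Tmap (incl_at d G1 0) a) (Tmap (incl_at d G1 1) a) (res G1 folded)).
  pose proof (globular_PosG G2) as HG2.
  assert (H1 : tvalid (PosG G2) (S d) t1).
  { apply tvalid_coh; [apply tdim_sprout_le|apply full_sphere_admissible, full_sphere_sprout;
    auto|apply rawmap_half; lia]. }
  assert (H2 : tvalid (PosG G2) (S d) t2).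
  { apply tvalid_coh; [apply tdim_sprout_le|apply full_sphere_admissible, full_sphere_sprout;
    auto|apply rawmap_half; lia]. }
  assert (H3 : tvalid (PosG G2) (S d) t3).
  { apply tvalid_coh; [apply tdim_sprout_le|apply full_sphere_admissible, full_sphere_sprout;
    auto|apply rawmap_folded]. }
  assert (S1 : tsrc (PosG G2) t1 = Tmap (incl_at d G2 0) a)
    by (apply (bind_glue_incl_at d 1 P G2 0 (fun _ => 0)); auto).
  assert (U1 : ttgt (PosG G2) t1 = Tmap (incl_at d G2 1) b)
    by (apply (bind_glue_incl_at d 1 P G2 1 (fun _ => 1)); auto).
  assert (S2 : tsrc (PosG G2) t2 = Tmap (incl_at d G2 1) b)
    by (apply (bind_glue_incl_at d 1 P G2 0 (fun _ => 1)); auto).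
  assert (U2 : ttgt (PosG G2) t2 = Tmap (incl_at d G2 2) a)
    by (apply (bind_glue_incl_at d 1 P G2 1 (fun _ => 2)); auto).
  assert (S3 : tsrc (PosG G2) t3 = Tmap (incl_at d G2 0) a)
    by (apply (bind_glue_incl_at d 1 P G2 0 (fun _ => 0)); auto).
  assert (U3 : ttgt (PosG G2) t3 = Tmap (incl_at d G2 2) a)
    by (apply (bind_glue_incl_at d 1 P G2 1 (fun _ => 2)); auto).
  assert (H12 : tvalid (PosG G2) (S d) (compT (PosG G2) d t1 t2))
    by (apply tvalid_compT; auto; congruence).
  assert (Hc : forall m p, pvalid P p = true -> pdim p = d -> arity d (sprout d m P) p = m).
  { intros m p Hp Ep. apply arity_sprout; auto. rewrite bdry_id; auto. }
  assert (Hpb : forall p, pvalid P p = true -> pvalid (bdry d P) p = true)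
    by (intros; rewrite bdry_id; auto).
  assert (Ov : forall p i k u w, pvalid P p = true -> pdim p = d -> i <= 1 -> k <= 1 ->
    occurs (mkpos G2 (vtx d (i + k) p)) (coh G1 u w (res G1 (half i)))).
  { intros p i k u w Hp Ep Hi Hk. apply (occ_coh _ _ _ _ _ (mkpos G1 (vtx d k p))).
    rewrite mkpos_val by (apply pvalid_sprout_vtx; auto). unfold half.
    erewrite (glue_vtx d _ _ _ P); auto. constructor. }
  assert (Oe : forall p i u w, pvalid P p = true -> pdim p = d -> i <= 1 ->
    occurs (mkpos G2 (edge d i p)) (coh G1 u w (res G1 (half i)))).
  { intros p i u w Hp Ep Hi. apply (occ_coh _ _ _ _ _ (mkpos G1 (edge d 0 p))).
    rewrite mkpos_val by (apply pvalid_sprout_edge; auto). unfold half.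
    erewrite (glue_edge d _ _ _ P); auto. constructor. }
  assert (C12 : covers G2 (S d) (compT (PosG G2) d t1 t2)).
  { apply (covers_cases P d G2 a); auto using bdry_sprout_id, tdim_sprout_le.
    - rewrite tsrc_compT; exact S1.
    - intros p j Hp Ep Hj. rewrite Hc in Hj by auto. apply (occurs_compT (PosG G2)).
      (* Vertices 0 and 1 of each string occur in the first half, vertex 2 in the second. *)
      destruct j as [|[|[|j]]]; [left|left|right; left|lia].
      + apply (Ov p 0 0); auto.
      + apply (Ov p 0 1); auto.
      + apply (Ov p 1 1); auto.
    - intros p j Hp Ep Hj. rewrite Hc in Hj by auto. apply (occurs_compT (PosG G2)).
      destruct j as [|[|j]]; [left|right; left|lia]; apply Oe; auto. }
  assert (C3 : covers G2 (S d) t3).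
  (* Each string of [G2] enters [t3] through the one edge of [G1] over [p], whose argument is the
     composite of that string. *)
  { assert (O3 : forall p g, pvalid P p = true -> pdim p = d ->
      occurs g (compT (PosG G2) d (pvar G2 (edge d 0 p)) (pvar G2 (edge d 1 p))) -> occurs g t3).
    { intros p g Hp Ep Ho. apply (occ_coh _ _ _ _ _ (mkpos G1 (edge d 0 p))).
      rewrite mkpos_val by (apply pvalid_sprout_edge; auto). unfold folded.
      erewrite (glue_edge d _ _ _ P); auto. }
    apply (covers_cases P d G2 a); auto using bdry_sprout_id, tdim_sprout_le.
    - intros p j Hp Ep Hj. rewrite Hc in Hj by auto.
      destruct (edge_G2 p 0 Hp Ep) as (X1 & X2 & X3); [lia|].
      destruct (edge_G2 p 1 Hp Ep) as (Y1 & Y2 & Y3); [lia|].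
      apply (O3 p); auto. apply (occurs_compT (PosG G2)).
      destruct j as [|[|[|j]]]; [do 2 right; left|do 3 right; left|do 4 right|lia];
        rewrite ?X2, ?X3, ?Y3; constructor.
    - intros p j Hp Ep Hj. rewrite Hc in Hj by auto.
      apply (O3 p); auto. apply (occurs_compT (PosG G2)).
      destruct j as [|[|j]]; [left|right; left|lia]; constructor. }
  assert (E3 : ev C (res G2 doubled) t3 = sandwich (fun p => comp C d (e p) (eb p))).
  { apply ev_coh_sprout; auto using gmap_doubled, ev_doubled_low, rawmap_folded.
    - apply full_sphere_admissible, full_sphere_sprout; auto.
    - intros p i Hp Ep Hi. rewrite ev_doubled_vtx by (auto; lia).
      destruct i as [|[|i]]; [reflexivity|reflexivity|lia].
    - intros p i Hp Ep Hi. unfold const_fam.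
      destruct (edge_G2 p 0 Hp Ep) as (X1 & X2 & X3); [lia|].
      destruct (edge_G2 p 1 Hp Ep) as (Y1 & Y2 & Y3); [lia|].
      rewrite ev_compT; auto using gmap_doubled; [|congruence].
      rewrite !ev_doubled_edge by (auto; lia). reflexivity. }
  rewrite <- E3, <- forward_doubled, <- backward_doubled. fold t1 t2.
  rewrite <- ev_compT; auto using gmap_doubled; [|congruence].
  apply coherence; auto using tdim_sprout_le, gmap_doubled.
  intros _. cbn [gsrc gtgt TGS]. rewrite tsrc_compT, ttgt_compT. split; congruence.
Qed.

Lemma linked_sandwich_id :
  linked C (S d) (sandwich (fun p => comp C d (e p) (eb p))) (sandwich (fun p => idc C (v0 p))).
Proof.
  assert (Hpb : forall p, pvalid P p = true -> pvalid (bdry d P) p = true)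
    by (intros; rewrite bdry_id; auto).
  assert (HG : tdim G1 = S d) by (apply tdim_sprout; rewrite bdry_id; auto).
  apply congruence; auto.
  - apply full_sphere_sprout; auto.
  - apply rawmap_glue_sprout; auto.
    + intros p i Hp Ep Hi. apply Hv; auto.
    + intros p i Hp Ep Hi. destruct (He p Hp Ep) as (X1 & X2 & X3).
      destruct (Heb p Hp Ep) as (Y1 & Y2 & Y3). 
      destruct (comp_type C d (e p) (eb p)) as (Z1 & Z2 & Z3); auto; [congruence|].
      exact (conj Z1 (conj (eq_trans Z2 X2) (eq_trans Z3 Y3))).
  - apply rawmap_glue_sprout; auto.
    + intros p i Hp Ep Hi. apply Hv; auto.
    + intros p i Hp Ep Hi. apply idc_type. apply Hv; auto.
  - intros p Hp Hd. unfold glue.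
    destruct (Nat.ltb_spec (pdim p) d); [reflexivity|].
    replace (pdim p) with d by lia. rewrite Nat.eqb_refl. reflexivity.
  - intros q Hq Eq.
    destruct (position_cases d G1 q Hq (tdim_sprout_le _ _ _))
      as [H|[(p & j & Hp & E & Hj & ->)|(p & j & Hp & E & Hj & ->)]];
      [lia|rewrite pdim_vtx in Eq by exact E; lia|].
    rewrite bdry_sprout_id in Hp by auto. rewrite !(glue_edge d _ _ _ P) by auto.
    apply Hrel; auto.
Qed.

(** With identities on all edges, the operation is the value of a term over [P] from [a] to [a].
    Coherence over [P] compares it with the identity on [a]. *)
Lemma linked_sandwich_collapse :
  linked C (S d) (sandwich (fun p => idc C (v0 p))) (idc C (ev C (res P base) a)).
Proof.
  set (t := coh G1 (Tmap (incl_at d G1 0) a) (Tmap (incl_at d G1 1) a) (res G1 collapsed)).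
  assert (Ht : tvalid (PosG P) (S d) t).
  { apply tvalid_coh; [apply tdim_sprout_le|apply full_sphere_admissible, full_sphere_sprout;
    auto|apply rawmap_collapsed]. }
  assert (Et : tsrc (PosG P) t = a).
  { refine (eq_trans _ (Tmap_incl_at_id d P a HPle)).
    apply (bind_glue_incl_at d 1 P P 0 (fun _ => 0)); auto. }
  assert (Ut : ttgt (PosG P) t = a).
  { refine (eq_trans _ (Tmap_incl_at_id d P a HPle)).
    apply (bind_glue_incl_at d 1 P P 1 (fun _ => 0)); auto. }
  assert (Ev : forall p, pvalid P p = true -> pdim p = d -> ev C (res P base) (pvar P p) = v0 p).
  { intros p Hp Ep. rewrite ev_pvar by auto. apply base_top; auto. }
  assert (E : ev C (res P base) t = sandwich (fun p => idc C (v0 p))).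
  { apply ev_coh_sprout; auto using gmap_base, rawmap_collapsed.
    - apply full_sphere_admissible, full_sphere_sprout; auto.
    - intros p Hp Ep. rewrite ev_pvar by auto. apply glue_low, Ep.
    - intros p i Hp Ep Hi. unfold const_fam. rewrite (vtx_id d P) by (auto; lia). auto.
    - intros p i Hp Ep Hi. unfold const_fam. rewrite ev_idT; auto using gmap_base, tvalid_pvar.
      rewrite Ev; auto. }
  rewrite <- E, <- (ev_idT C P _ d) by auto using gmap_base.
  apply coherence; auto using gmap_base, tvalid_idT, globular_PosG.
  - intros _. cbn [gsrc gtgt TGS]. rewrite tsrc_idT, ttgt_idT. split; congruence.
  - apply covers_src. rewrite Et; auto.
  - apply covers_src. rewrite tsrc_idT; auto.
Qed.

Lemma rawmap_forward : rawmap G1 (GX C) (glue d f0 (pair_fam v0 v1) (const_fam e)).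
Proof.
  apply rawmap_glue_sprout; auto.
  - intros p i Hp Ep Hi. destruct i; apply Hv; auto.
  - intros p i Hp Ep Hi. destruct i; [apply He; auto|lia].
Qed.

(** The glued maps are spelled out so that, after exchanging [v0] and [v1], the target of one
    direction is literally the source of the other. *)
Lemma forward_type : projT1 forward = S d /\
  xsrc C forward = ev C (res P (glue d f0 (const_fam v0) (const_fam v0))) a /\
  xtgt C forward = ev C (res P (glue d f0 (const_fam v1) (const_fam v1))) b.
Proof.
  assert (Hs : admissible G1 d (Tmap (incl_at d G1 0) a) (Tmap (incl_at d G1 1) b))
    by (apply full_sphere_admissible, full_sphere_sprout; auto).
  pose proof rawmap_forward as Hr. unfold forward.
  rewrite (cohX_dim C d), (cohX_src C d), (cohX_tgt C d) by auto using tdim_sprout_le.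
  assert (Hpt : forall p : PosT P, pdim (proj1_sig p) < d \/ pdim (proj1_sig p) = d).
  { intros p. pose proof (pdim_le_tdim P _ (proj2_sig p)). lia. }
  split; [reflexivity|].
  rewrite !ev_Tmap. split; f_equal; apply functional_extensionality; intros p;
    rewrite glue_incl_at by auto; unfold glue;
    (destruct (Nat.ltb_spec (pdim (proj1_sig p)) d); [reflexivity|]);
    (destruct (Nat.eqb_spec (pdim (proj1_sig p)) d); [|destruct (Hpt p); lia]);
    unfold const_fam; rewrite (vtx_id d P) by (auto; try apply (proj2_sig p); lia); reflexivity.
Qed.

Lemma linked_forward_backward : linked C (S d) (comp C d forward backward) (idc C (xsrc C
  forward)).
Proof.
  destruct forward_type as (_ & -> & _).
  eapply linked_trans; [apply linked_forward_backward_sandwich|].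
  eapply linked_trans; [apply linked_sandwich_id|apply linked_sandwich_collapse].
Qed.

End Cancellation.

Lemma cancellable_forward C d P a b f0 v0 v1 e :
  tdim P = d -> tvalid (PosG P) d a -> tvalid (PosG P) d b ->
  parallel (TGS (PosG P)) d a b -> covers P d a -> covers P d b -> rawmap P (GX C) f0 ->
  (forall p, pvalid P p = true -> pdim p = d ->
     (projT1 (v0 p) = d /\ parallel (GX C) d (v0 p) (f0 p)) /\
     (projT1 (v1 p) = d /\ parallel (GX C) d (v1 p) (f0 p))) ->
  (forall p, pvalid P p = true -> pdim p = d ->
     cancellable C d (e p) /\ xsrc C (e p) = v0 p /\ xtgt C (e p) = v1 p) ->
  cancellable C d (forward C d P a b f0 v0 v1 e).
Proof.
  intros HP Ha Hb Hab Ca Cb Hf Hv HQ.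
  set (R := fun p xb => projT1 xb = S d /\ xsrc C xb = xtgt C (e p) /\ xtgt C xb = xsrc C (e p) /\
    linked C (S d) (comp C d (e p) xb) (idc C (xsrc C (e p))) /\
    linked C (S d) (comp C d xb (e p)) (idc C (xtgt C (e p)))).
  (* Inverses are chosen for all top positions at once; [e p] only shows inhabitation. *)
  set (eb := fun p => epsilon (inhabits (e p)) (R p)).
  assert (Hv' : forall p, pvalid P p = true -> pdim p = d ->
     (projT1 (v1 p) = d /\ parallel (GX C) d (v1 p) (f0 p)) /\
     (projT1 (v0 p) = d /\ parallel (GX C) d (v0 p) (f0 p))).
  { intros p Hp Ep. destruct (Hv p Hp Ep); auto. }
  assert (Heb : forall p, pvalid P p = true -> pdim p = d -> R p (eb p)).
  { intros p Hp Ep. apply epsilon_spec, (HQ p Hp Ep). }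
  assert (He1 : forall p, pvalid P p = true -> pdim p = d ->
    projT1 (e p) = S d /\ xsrc C (e p) = v0 p /\ xtgt C (e p) = v1 p).
  { intros p Hp Ep. destruct (HQ p Hp Ep) as ((E & _) & E1 & E2); auto. }
  assert (He2 : forall p, pvalid P p = true -> pdim p = d ->
    projT1 (eb p) = S d /\ xsrc C (eb p) = v1 p /\ xtgt C (eb p) = v0 p).
  { intros p Hp Ep. destruct (Heb p Hp Ep) as (E1 & E2 & E3 & _).
    destruct (He1 p Hp Ep) as (_ & <- & <-); auto. }
  assert (R1 : forall p, pvalid P p = true -> pdim p = d ->
    linked C (S d) (comp C d (e p) (eb p)) (idc C (v0 p))).
  { intros p Hp Ep. destruct (He1 p Hp Ep) as (_ & <- & _). apply Heb; auto. }
  assert (R2 : forall p, pvalid P p = true -> pdim p = d ->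
    linked C (S d) (comp C d (eb p) (e p)) (idc C (v1 p))).
  { intros p Hp Ep. destruct (He1 p Hp Ep) as (_ & _ & <-). apply Heb; auto. }
  apply parallel_sym in Hab as Hba.
  destruct (forward_type C d P HP a b Ha Hb Hab Ca Cb f0 v0 v1 e) as (T1 & T2 & T3); auto.
  destruct (forward_type C d P HP b a Hb Ha Hba Cb Ca f0 v1 v0 eb) as (T1' & T2' & T3'); auto.
  split; [exact T1|]. exists (forward C d P b a f0 v1 v0 eb).
  split; [exact T1'|]. split; [congruence|]. split; [congruence|]. split.
  - apply (linked_forward_backward C d P HP a b Ha Hb Hab Ca Cb f0 v0 v1 e eb); auto.
  - assert (E : xtgt C (forward C d P a b f0 v0 v1 e) = xsrc C (forward C d P b a f0 v1 v0 eb))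
      by congruence.
    rewrite E. apply (linked_forward_backward C d P HP b a Hb Ha Hba Cb Ca f0 v1 v0 eb e); auto.
Qed.

Lemma cosT_incl_at d B : cosT d B = incl_at d B 0.
Proof.
  apply functional_extensionality; intros [p Hp]. apply PosT_eq; simpl.
  rewrite cos_vtx. symmetry. apply mkpos_val, pvalid_vtx_le; auto; lia.
Qed.

Lemma cotT_incl_at d B :
  cotT d B = (fun p => mkpos B (vtx d (arity d B (proj1_sig p)) (proj1_sig p))).
Proof.
  apply functional_extensionality; intros [p Hp]. apply PosT_eq; simpl.
  rewrite cot_vtx. symmetry. apply mkpos_val, pvalid_vtx_le; auto.
Qed.

(** * Operations on cancellable cells *)

Section Strings.
Context (C : WCat) (d : nat) (B : tree) (HB : tdim B = S d) (a b : tm (PosT (bdry d B))).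
Hypothesis Ha : tvalid (PosG (bdry d B)) d a.
Hypothesis Hb : tvalid (PosG (bdry d B)) d b.
Hypothesis Hab : parallel (TGS (PosG (bdry d B))) d a b.
Hypothesis Ca : covers (bdry d B) d a.
Hypothesis Cb : covers (bdry d B) d b.
Context (f : pos -> xcell C).
Hypothesis Hf : rawmap B (GX C) f.
Hypothesis HQ : forall p, pvalid B p = true -> pdim p = S d -> cancellable C d (f p).

Local Notation P := (bdry d B).
Local Notation G1 := (sprout d 1 P).

(** Ending in an identity makes the composite defined for strings of length 0 as well, that is, for
    d-cells of the boundary with nothing above them in [B]. *)
Fixpoint string_tm (p : pos) (j k : nat) : tm (PosT B) :=
  match k with
  | 0 => idT (PosG B) d (pvar B (vtx d j p))
  | S k' => compT (PosG B) d (pvar B (edge d j p)) (string_tm p (S j) k')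
  end.

Lemma string_tm_type p j k : pvalid P p = true -> pdim p = d -> j + k <= arity d B p ->
  tvalid (PosG B) (S d) (string_tm p j k) /\ tsrc (PosG B) (string_tm p j k) = pvar B (vtx d j p)
    /\
  ttgt (PosG B) (string_tm p j k) = pvar B (vtx d (j + k) p).
Proof.
  intros Hp Ep. revert j; induction k as [|k IH]; intros j Hk; cbn [string_tm].
  - rewrite tsrc_idT, ttgt_idT, Nat.add_0_r. split; auto.
    apply tvalid_idT; auto using globular_PosG. apply tvalid_pvar; auto using pdim_vtx.
    apply pvalid_vtx; auto; lia.
  - destruct (IH (S j)) as (X1 & X2 & X3); [lia|].
    rewrite tsrc_compT, ttgt_compT, X3.
    assert (He : pvalid B (edge d j p) = true) by (apply pvalid_edge; auto; lia).
    rewrite tsrc_pvar, psrc_edge by auto. replace (j + S k) with (S j + k) by lia.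
    split; auto. apply tvalid_compT; auto using globular_PosG, tvalid_pvar, pdim_edge.
    rewrite ttgt_pvar, ptgt_edge by auto. auto.
Qed.

Lemma string_tm_vertices p j k i : pvalid P p = true -> pdim p = d -> j + k <= arity d B p ->
  j <= i <= j + k -> occurs (mkpos B (vtx d i p)) (string_tm p j k).
Proof.
  intros Hp Ep. revert j; induction k as [|k IH]; intros j Hk Hi; cbn [string_tm].
  - apply (occurs_idT (PosG B)). replace j with i by lia. constructor.
  - apply (occurs_compT (PosG B)). destruct (Nat.eq_dec i j) as [->|Hij].
    + do 2 right; left. rewrite tsrc_pvar, psrc_edge; auto; [constructor|].
      apply pvalid_edge; auto; lia.
    + right; left. apply IH; lia.
Qed.

Lemma string_tm_edges p j k i : j <= i < j + k -> occurs (mkpos B (edge d i p)) (string_tm p j k).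
Proof.
  revert j; induction k as [|k IH]; intros j Hi; cbn [string_tm]; [lia|].
  apply (occurs_compT (PosG B)). destruct (Nat.eq_dec i j) as [->|Hij].
  - left. constructor.
  - right; left. apply IH; lia.
Qed.

Lemma cancellable_string_tm p j k : pvalid P p = true -> pdim p = d -> j + k <= arity d B p ->
  cancellable C d (ev C (res B f) (string_tm p j k)).
Proof.
  intros Hp Ep. pose proof (gmap_ev C B _ Hf) as Hg.
  revert j; induction k as [|k IH]; intros j Hk; cbn [string_tm].
  - assert (Hi : pvalid B (vtx d j p) = true) by (apply pvalid_vtx; auto; lia).
    rewrite ev_idT; auto using tvalid_pvar, pdim_vtx. apply cancellable_idc.
    apply (gm_isc _ _ _ Hg). apply tvalid_pvar; auto using pdim_vtx.
  - destruct (string_tm_type p (S j) k) as (X1 & X2 & X3); auto; [lia|].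
    assert (He : pvalid B (edge d j p) = true) by (apply pvalid_edge; auto; lia).
    assert (Ht : tvalid (PosG B) (S d) (pvar B (edge d j p))) by auto using tvalid_pvar,
      pdim_edge.
    assert (E : ttgt (PosG B) (pvar B (edge d j p)) = tsrc (PosG B) (string_tm p (S j) k))
      by (rewrite ttgt_pvar, ptgt_edge by auto; auto).
    rewrite ev_compT; auto. apply cancellable_comp.
    + rewrite ev_pvar by auto. auto using pdim_edge.
    + apply IH; lia.
    + change (gtgt (GX C) (ev C (res B f) (pvar B (edge d j p))) =
              gsrc (GX C) (ev C (res B f) (string_tm p (S j) k))).
      rewrite (gm_tgt _ _ _ Hg d) by exact Ht. rewrite (gm_src _ _ _ Hg d) by exact X1.
      cbn [gsrc gtgt TGS]. congruence.
Qed.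

Let P_dim : tdim P = d.
Proof. apply tdim_bdry_eq. lia. Qed.

Let P_dim_le : tdim P <= d.
Proof. apply tdim_bdry. Qed.

Lemma pvalid_bdry p : pvalid P p = true -> pvalid B p = true.
Proof.
  intros Hp. rewrite <- (vtx0_bdry d B p Hp). apply pvalid_vtx_le; auto; lia.
Qed.

Lemma rawmap_bdry Z (g : pos -> cell Z) : rawmap B Z g -> rawmap P Z g.
Proof.
  intros Hg. apply rawmap_intro.
  - intros p Hp. apply (rawmap_isc B); auto using pvalid_bdry.
  - intros p k Hp Ek.
    split; [apply (rawmap_src B _ _ _ k)|apply (rawmap_tgt B _ _ _ k)]; auto using pvalid_bdry.
Qed.

Definition strings : pos -> tm (PosT B) :=
  glue d (pvar B) (pair_fam (fun p => pvar B (vtx d 0 p)) (fun p =>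
    pvar B (vtx d (arity d B p) p)))
    (const_fam (fun p => string_tm p 0 (arity d B p))).

Lemma rawmap_strings : rawmap G1 (TGS (PosG B)) strings.
Proof.
  apply rawmap_glue_sprout; auto using rawmap_bdry, rawmap_pvar.
  - intros p i Hp Ep Hi.
    assert (H : forall j, j <= arity d B p -> tvalid (PosG B) d (pvar B (vtx d j p)) /\
      parallel (TGS (PosG B)) d (pvar B (vtx d j p)) (pvar B p)).
    { intros j Hj. assert (Hv : pvalid B (vtx d j p) = true) by (apply pvalid_vtx; auto).
      split; [apply tvalid_pvar; auto using pdim_vtx|].
      apply parallel_pvar_vtx; auto using pvalid_bdry. }
    destruct i; apply H; lia.
  - intros p i Hp Ep Hi. assert (i = 0) as -> by lia. unfold const_fam, pair_fam.
    apply (string_tm_type p 0 (arity d B p)); auto.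
Qed.

Lemma cancellable_cohX : cancellable C d (cohX C B (Tmap (cosT d B) a) (Tmap (cotT d B) b) (res B
  f)).
Proof.
  set (t := coh B (Tmap (cosT d B) a) (Tmap (cotT d B) b) var).
  set (t' := coh G1 (Tmap (incl_at d G1 0) a) (Tmap (incl_at d G1 1) b) (res G1 strings)).
  assert (Hs : full_sphere B d (Tmap (cosT d B) a) (Tmap (cotT d B) b)) by (exists a, b; auto 9).
  assert (Ht : tvalid (PosG B) (S d) t).
  { apply tvalid_coh; [lia|apply full_sphere_admissible, Hs|apply gmap_var]. }
  assert (Hs' : admissible G1 d (Tmap (incl_at d G1 0) a) (Tmap (incl_at d G1 1) b))
    by (apply full_sphere_admissible, full_sphere_sprout; auto).
  assert (Ht' : tvalid (PosG B) (S d) t').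
  { apply tvalid_coh; [apply tdim_sprout_le|exact Hs'|apply rawmap_strings]. }
  assert (S1 : tsrc (PosG B) t' = Tmap (cosT d B) a).
  { rewrite cosT_incl_at. apply (bind_glue_incl_at d 1 P B 0 (fun _ => 0)); auto. }
  assert (U1 : ttgt (PosG B) t' = Tmap (cotT d B) b).
  { rewrite cotT_incl_at. apply (bind_glue_incl_at d 1 P B 1 (arity d B)); auto. }
  assert (Ct : covers B (S d) t).
  { apply covers_occurs. intros p. apply (occ_coh _ _ _ _ _ p). constructor. }
  (* The string composites contain all vertices and edges over d-cells of the boundary; lower
     positions come from the source. *)
  assert (Ct' : covers B (S d) t').
  { assert (O : forall p g, pvalid P p = true -> pdim p = d ->
      occurs g (string_tm p 0 (arity d B p)) -> occurs g t').
    { intros p g Hp Ep Ho. apply (occ_coh _ _ _ _ _ (mkpos G1 (edge d 0 p))).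
      rewrite mkpos_val by (apply pvalid_sprout_edge; auto). unfold strings.
      rewrite (glue_edge d _ _ _ B) by auto. exact Ho. }
    apply (covers_cases P d B a); auto.
    - lia.
    - rewrite S1, cosT_incl_at. reflexivity.
    - intros p j Hp Ep Hj. apply (O p); auto. apply string_tm_vertices; auto; lia.
    - intros p j Hp Ep Hj. apply (O p); auto. apply string_tm_edges; lia. }
  rewrite cohX_ev. fold t.
  apply (cancellable_linked C d _ (ev C (res B f) t')).
  { apply coherence; auto; [lia|].
    intros _. cbn [gsrc gtgt TGS]. rewrite S1, U1. unfold t. cbn [tsrc ttgt].
    rewrite !bind_var_id. auto. }
  (* The value of [t'] is a [forward] cell whose edges are the composed strings and whose vertices
     are their ends. *)
  set (v0 := fun p => f (vtx d 0 p)). set (v1 := fun p => f (vtx d (arity d B p) p)).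
  set (e := fun p => ev C (res B f) (string_tm p 0 (arity d B p))).
  assert (Hvv : forall p j, pvalid P p = true -> pdim p = d -> j <= arity d B p ->
    ev C (res B f) (pvar B (vtx d j p)) = f (vtx d j p)).
  { intros p j Hp Ep Hj. apply ev_pvar, pvalid_vtx; auto. }
  assert (E : ev C (res B f) t' = forward C d P a b f v0 v1 e).
  { apply ev_coh_sprout; auto.
    - exact rawmap_strings.
    - intros p Hp _. apply ev_pvar, pvalid_bdry, Hp.
    - intros p i Hp Ep Hi. destruct i; apply Hvv; auto; lia. }
  rewrite E. apply cancellable_forward; auto using rawmap_bdry.
  - assert (H : forall p j, pvalid P p = true -> pdim p = d -> j <= arity d B p ->
      projT1 (f (vtx d j p)) = d /\ parallel (GX C) d (f (vtx d j p)) (f p)).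
    { intros p j Hp Ep Hj. assert (Hv : pvalid B (vtx d j p) = true) by (apply pvalid_vtx; auto).
      split; [exact (rawmap_isc B (GX C) f _ d Hf Hv (pdim_vtx _ _ _ Ep))|].
      rewrite <- (Hvv p j), <- (ev_pvar C B f p) by auto using pvalid_bdry.
      apply (gmap_parallel (TGS (PosG B)) (GX C) (ev C (res B f)) d).
      - apply gmap_ev, Hf.
      - apply tvalid_pvar; auto using pdim_vtx.
      - apply tvalid_pvar; auto using pvalid_bdry.
      - apply parallel_pvar_vtx; auto using pvalid_bdry. }
    intros p Hp Ep. split; apply H; auto; lia.
  - intros p Hp Ep. split; [apply cancellable_string_tm; auto|].
    destruct (string_tm_type p 0 (arity d B p)) as (X1 & X2 & X3); auto.
    pose proof (gmap_ev C B _ Hf) as Hg.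
    pose proof (gm_src _ _ _ Hg d _ X1) as E1. pose proof (gm_tgt _ _ _ Hg d _ X1) as E2.
    cbn [gsrc gtgt TGS] in E1, E2. rewrite X2 in E1. rewrite X3 in E2.
    rewrite Hvv in E1, E2 by (auto; lia). split; [exact E1|exact E2].
Qed.

End Strings.

Lemma generated_cancellable C x : generated C x -> exists d, cancellable C d x.
Proof.
  induction 1 as [x Hx|d B u v f HB Hs Hf _ IH]; [apply invertible_cancellable, Hx|].
  exists d. destruct Hs as (a & b & Ha & Hb & Hab & Ca & Cb & -> & ->).
  replace f with (res B (fun p => f (mkpos B p)))
    by (apply functional_extensionality; intros p; rewrite mkpos_proj; reflexivity).
  apply (cancellable_cohX C d B HB a b Ha Hb Hab Ca Cb (fun p => f (mkpos B p))).
  - apply rawmap_mkpos, Hf.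
  - intros p Hp Ep. destruct (IH (mkpos B p)) as (d' & HQ); [rewrite mkpos_val; auto|].
    (* The induction hypothesis provides some dimension [d']; globularity of [f] forces it to be
       [d]. *)
    assert (E : projT1 (f (mkpos B p)) = S d).
    { apply (gm_isc _ _ _ Hf). simpl. rewrite mkpos_val; auto. }
    assert (d' = d) as <- by (destruct HQ; congruence). exact HQ.
Qed.

Theorem theorem5p3 (C : WCat) (c : xcell C) : Winf C c -> invertible C c.
Proof.
  intros H. exists (generated C). split; [apply cancellable_inv_closed,
    generated_cancellable|apply Winf_generated, H].
Qed.
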